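(* Let $\Gamma=\mathbb{Z}_9\rtimes\mathbb{Z}_3=\langle h,g\mid g^9=h^3=e,\ h^{-1}gh=g^4\rangle$ with generating set $S=\{h,h^{-1},g,g^{-1}\}$. Then $\mathbb{Q}(\Gamma,S)\cong\mathcal{D}_\theta(C^*(\Gamma))$ as compact quantum groups, where $\theta$ is the CQG automorphism of $C^*(\Gamma)$ induced by the group automorphism $g\mapsto g^{-1}$, $h\mapsto h$.
   Context: A compact quantum group (CQG) is a pair $(\mathcal{Q},\Delta)$ with $\mathcal{Q}$ a unital $C^*$-algebra and $\Delta:\mathcal{Q}\to\mathcal{Q}\hat\otimes\mathcal{Q}$ (minimal tensor product) a unital $*$-homomorphism that is coassociative and such that the linear spans of $\Delta(\mathcal{Q})(1\otimes\mathcal{Q})$ and $\Delta(\mathcal{Q})(\mathcal{Q}\otimes 1)$ are dense. A CQG morphism is a unital $*$-homomorphism intertwining coproducts. An action of $\mathcal{Q}$ on a unital $C^*$-algebra $B$ is a unital $*$-homomorphism $\alpha:B\to B\hat\otimes\mathcal{Q}$ with $(\alpha\otimes id)\alpha=(id\otimes\Delta)\alpha$ and $\alpha(B)(1\otimes\mathcal{Q})$ of dense linear span in $B\hat\otimes\mathcal{Q}$. For a discrete group $\Gamma$ with finite symmetric generating set $S$, let $l$ be the word length, $\lambda_g$ ($g\in\Gamma$) the canonical group elements in $\mathbb{C}\Gamma\subset C_r^*(\Gamma)$, and $\tau(\sum c_g\lambda_g)=c_e$ the canonical trace. $\mathbb{Q}(\Gamma,S)$ is the quantum group of orientation preserving isometries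 of the spectral triple $(\mathbb{C}\Gamma,l^2(\Gamma),D_\Gamma)$, $D_\Gamma\delta_g=l(g)\delta_g$; equivalently, it is the universal (initial) object $(\mathcal{Q},\alpha)$ in the category of CQG's $\mathcal{Q}$ with an action $\alpha$ on $C_r^*(\Gamma)$ such that $(\tau\otimes id)\alpha=\tau(\cdot)1$ and $\alpha$ maps $\mathrm{Span}\{\lambda_g: l(g)=r\}$ into $\mathrm{Span}\{\lambda_g: l(g)=r\}\otimes\mathcal{Q}$ for every $r\ge 0$ (morphisms: CQG morphisms intertwining the actions). The full group $C^*$-algebra $C^*(\Gamma)$ is a CQG with $\Delta(\lambda_g)=\lambda_g\otimes\lambda_g$ (the canonical generators are again denoted $\lambda_g$). Doubling: for a CQG $(\mathcal{Q},\Delta)$ with a CQG automorphism $\theta$, $\theta^2=id$, let $\mathcal{D}_\theta(\mathcal{Q})=\mathcal{Q}\oplus\mathcal{Q}$ as a $C^*$-algebra, $\xi(x)=(x,0)$, $\eta(x)=(0,x)$, with coproduct $\tilde\Delta$ determined by $\tilde\Delta\circ\xi=(\xi\otimes\xi+\eta\otimes[\eta\circ\theta])\circ\Delta$ and $\tilde\Delta\circ\eta=(\xi\otimes\eta+\eta\otimes[\xi\circ\theta])\circ\Delta$. *)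

(* Defs.v *)
From HB Require Import structures.
From mathcomp Require Import all_boot all_order all_algebra all_fingroup all_solvable.
From mathcomp Require Import complex.
From mathcomp Require Import classical_sets reals.

Set Implicit Arguments.
Unset Strict Implicit.
Unset Printing Implicit Defensive.

Import Order.TTheory GRing.Theory Num.Theory.

Local Open Scope classical_set_scope.
Local Open Scope ring_scope.
Local Open Scope complex_scope.

Definition cmod (R : realType) (z : R[i]) : R := complex.Re `|z|.

(* Unital C*-algebras over C = R[i], with a real-valued norm; 1 != 0 is part of
   algType.  The normed modules of MathComp-Analysis cannot be joined with
   algType: the only common refinement of their norm and product is
   numDomainType. *)
HB.mixin Record isCstar (R : realType) A of GRing.Algebra R[i] A := {
  star : A -> A;
  starD : {morph star : x y / x + y};
  starZ : forall (c : R[i]) x, star (c *: x) = conjc c *: star x;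
  starM : forall x y, star (x * y) = star y * star x;
  starK : involutive star;
  cnorm : A -> R;
  cnorm_eq0 : forall x, cnorm x = 0 -> x = 0;
  cnormD : forall x y, cnorm (x + y) <= cnorm x + cnorm y;
  cnormZ : forall (c : R[i]) x, cnorm (c *: x) = cmod c * cnorm x;
  cnormM : forall x y, cnorm (x * y) <= cnorm x * cnorm y;
  cnorm_star_mul : forall x, cnorm (star x * x) = cnorm x ^+ 2;
  cnorm_complete : forall u : nat -> A,
    (forall e, 0 < e -> exists N : nat, forall m n : nat,
       (N <= m)%N -> (N <= n)%N -> cnorm (u m - u n) < e) ->
    exists l, forall e, 0 < e -> exists N : nat, forall n : nat,
      (N <= n)%N -> cnorm (u n - l) < e
}.

#[short(type="cstarType")]
HB.structure Definition Cstar (R : realType) :=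
  {A of isCstar R A & GRing.Algebra R[i] A}.

Section CstarTheory.
Variables (R : realType) (A : cstarType R).
Implicit Types x y : A.

Lemma cnorm0 : cnorm (0 : A) = 0.
Proof. by rewrite -(scale0r (0 : A)) cnormZ /cmod normr0 mul0r. Qed.

Lemma cnorm_ge0 x : 0 <= cnorm x.
Proof.
have N1 : cnorm (- x) = cnorm x.
  by rewrite -scaleN1r cnormZ /cmod normrN normr1 mul1r.
have := cnormD x (- x).
by rewrite subrr cnorm0 N1 -mulr2n pmulrn_lge0.
Qed.

End CstarTheory.

Section ProductCstar.
Variables (R : realType) (A B : cstarType R).
Implicit Types x y : (A * B)%type.

Let pstar x : A * B := (star x.1, star x.2).
Let pnorm x : R := Num.max (cnorm x.1) (cnorm x.2).

Let pstarD : {morph pstar : x y / x + y}.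
Proof. by move=> x y; congr pair; exact: starD. Qed.

Let pstarZ (c : R[i]) x : pstar (c *: x) = conjc c *: pstar x.
Proof. by congr pair; exact: starZ. Qed.

Let pstarM x y : pstar (x * y) = pstar y * pstar x.
Proof. by congr pair; exact: starM. Qed.

Let pstarK : involutive pstar.
Proof. by case=> a b; rewrite /pstar /= !starK. Qed.

Let pnorm_eq0 x : pnorm x = 0 -> x = 0.
Proof.
case: x => a b px; congr pair; apply: cnorm_eq0; apply/eqP;
  rewrite eq_le cnorm_ge0 andbT.
- by rewrite -px /pnorm le_max lexx.
- by rewrite -px /pnorm le_max lexx orbT.
Qed.

Let pnormD x y : pnorm (x + y) <= pnorm x + pnorm y.
Proof.
rewrite {1}/pnorm ge_max; apply/andP; split; apply: (le_trans (cnormD _ _));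
  by apply: lerD; rewrite /pnorm le_max lexx ?orbT.
Qed.

Let pnormZ (c : R[i]) x : pnorm (c *: x) = cmod c * pnorm x.
Proof.
have c0 : 0 <= cmod c by rewrite /cmod normc_def /= sqrtr_ge0.
by rewrite /pnorm /= !cnormZ maxr_pMr.
Qed.

Let pnormM x y : pnorm (x * y) <= pnorm x * pnorm y.
Proof.
rewrite {1}/pnorm ge_max; apply/andP; split; apply: (le_trans (cnormM _ _));
  by apply: ler_pM; rewrite ?cnorm_ge0 // /pnorm le_max lexx ?orbT.
Qed.

Let pnorm_star_mul x : pnorm (pstar x * x) = pnorm x ^+ 2.
Proof.
rewrite /pnorm /= !cnorm_star_mul; set a := cnorm _; set b := cnorm _.
have [a0 b0] : 0 <= a /\ 0 <= b by split; exact: cnorm_ge0.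
case: (leP a b) => ab; first by apply/max_idPr; rewrite ler_sqr.
by apply/max_idPl; rewrite ler_sqr // ltW.
Qed.

Let pnorm_complete (u : nat -> (A * B)%type) :
  (forall e, 0 < e -> exists N : nat, forall m n : nat,
     (N <= m)%N -> (N <= n)%N -> pnorm (u m - u n) < e) ->
  exists l, forall e, 0 < e -> exists N : nat, forall n : nat,
    (N <= n)%N -> pnorm (u n - l) < e.
Proof.
move=> cu.
have [a ua] : exists l, forall e, 0 < e -> exists N : nat, forall n : nat,
    (N <= n)%N -> cnorm ((u n).1 - l) < e.
  apply: (@cnorm_complete _ A) => e /cu[N Nu]; exists N => m n Nm Nn.
  by have := Nu _ _ Nm Nn; rewrite /pnorm gt_max => /andP[].
have [b ub] : exists l, forall e, 0 < e -> exists N : nat, forall n : nat,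
    (N <= n)%N -> cnorm ((u n).2 - l) < e.
  apply: (@cnorm_complete _ B) => e /cu[N Nu]; exists N => m n Nm Nn.
  by have := Nu _ _ Nm Nn; rewrite /pnorm gt_max => /andP[].
exists (a, b) => e e0; have [N Na] := ua e e0; have [M Mb] := ub e e0.
exists (maxn N M) => n; rewrite geq_max => /andP[Nn Mn].
by rewrite /pnorm gt_max Na // Mb.
Qed.

(* The direct sum of two C*-algebras. *)
HB.instance Definition _ := isCstar.Build R (A * B)%type
  pstarD pstarZ pstarM pstarK pnorm_eq0 pnormD pnormZ pnormM
  pnorm_star_mul pnorm_complete.

End ProductCstar.

Section Definitions.
Variable R : realType.
Local Notation C := R[i].

Definition lspan (A : cstarType R) (X : set A) : set A :=
  [set a | exists n (c : 'I_n -> C) (x : 'I_n -> A),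
     (forall k, X (x k)) /\ a = \sum_k c k *: x k].

Definition cdense (A : cstarType R) (X : set A) : Prop :=
  forall a e, 0 < e -> exists2 x, X x & cnorm (a - x) < e.

(* Not assumed to be unital. *)
Definition star_hom (A B : cstarType R) (f : A -> B) : Prop :=
  [/\ linear f, {morph f : x y / x * y} & {morph f : x / star x}].

Definition unital_star_hom (A B : cstarType R) (f : A -> B) : Prop :=
  star_hom f /\ f 1 = 1.

(* A list of pairs stands for the element \sum a (x) b of the algebraic tensor
   product of A and B; it is zero there iff every bilinear form kills it. *)
Definition tensor_zero (A B : cstarType R) (s : seq (A * B)) : Prop :=
  forall beta : A -> B -> C,
    (forall a, scalar (beta a)) -> (forall b, scalar (beta^~ b)) ->
    \sum_(p <- s) beta p.1 p.2 = 0.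

Definition tensor_eval (A B T : cstarType R) (i : A -> T) (j : B -> T)
    (s : seq (A * B)) : T :=
  \sum_(p <- s) i p.1 * j p.2.

(* An embedding of the algebraic tensor product of A and B in a C*-algebra T,
   a (x) b being sent to i a * j b.  The C*-norms on the algebraic tensor
   product are the norms induced by such embeddings. *)
Definition tensor_embedding (A B T : cstarType R) (i : A -> T) (j : B -> T)
    : Prop :=
  [/\ unital_star_hom i, unital_star_hom j,
      forall a b, i a * j b = j b * i a
    & forall s, tensor_eval i j s = 0 -> tensor_zero s].

(* T is the completion of the algebraic tensor product for its smallest
   C*-norm. *)
Definition is_min_tensor (A B T : cstarType R) (i : A -> T) (j : B -> T)
    : Prop :=
  [/\ tensor_embedding i j,
      cdense (range (tensor_eval i j))
    & forall (T' : cstarType R) (i' : A -> T') (j' : B -> T'),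
        tensor_embedding i' j' ->
        forall s, cnorm (tensor_eval i j s) <= cnorm (tensor_eval i' j' s)].

(* The minimal tensor product is unique up to a unique isomorphism; a structure
   that involves one carries the chosen model. *)
Record min_tensor (A B : cstarType R) := MinTensor {
  tensor_alg :> cstarType R;
  inl_tensor : A -> tensor_alg;
  inr_tensor : B -> tensor_alg;
  min_tensorP : is_min_tensor inl_tensor inr_tensor
}.

Definition tensor (A B : cstarType R) (T : min_tensor A B) (a : A) (b : B) : T :=
  inl_tensor T a * inr_tensor T b.

(* F is the *-homomorphism with F (a (x) b) = f a * g b; it is unique, since
   *-homomorphisms of C*-algebras are contractive. *)
Definition tensor_hom (A B E : cstarType R) (T : min_tensor A B)
    (f : A -> E) (g : B -> E) (F : T -> E) : Prop :=
  star_hom F /\ forall a b, F (tensor T a b) = f a * g b.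

(* (al (x) id) al = (id (x) De) al, as maps to the triple tensor product
   T = (B (x) Q) (x) Q.  Here F = al (x) id, G = id (x) De, and H is the map
   c (x) d |-> 1 (x) c (x) d. *)
Definition coaction_law (B Q : cstarType R) (BQ : min_tensor B Q)
    (QQ : min_tensor Q Q) (al : B -> BQ) (De : Q -> QQ) : Prop :=
  exists (T : min_tensor BQ Q) (F G : BQ -> T) (H : QQ -> T),
    [/\ tensor_hom (inl_tensor T \o al) (inr_tensor T) F,
        tensor_hom (inl_tensor T \o inr_tensor BQ) (inr_tensor T) H,
        tensor_hom (inl_tensor T \o inl_tensor BQ) (H \o De) G
      & forall b, F (al b) = G (al b)].

(* Compact quantum group structures on a given unital C*-algebra. *)
Record cqg_structure (Q : cstarType R) := CqgStructure {
  cqg_tensor : min_tensor Q Q;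
  cqg_comul : Q -> cqg_tensor;
  cqg_comul_hom : unital_star_hom cqg_comul;
  cqg_coassoc : coaction_law cqg_comul cqg_comul;
  cqg_cancel_l : cdense (lspan
    [set z | exists a b, z = cqg_comul a * tensor cqg_tensor 1 b]);
  cqg_cancel_r : cdense (lspan
    [set z | exists a b, z = cqg_comul a * tensor cqg_tensor b 1])
}.

Record cqg := Cqg {
  cqg_alg :> cstarType R;
  cqg_str : cqg_structure cqg_alg
}.

Definition tensor2 (Q : cqg) : min_tensor Q Q := cqg_tensor (cqg_str Q).
Definition comul (Q : cqg) : Q -> tensor2 Q := @cqg_comul Q (cqg_str Q).

Definition cqg_morphism (P Q : cqg) (f : P -> Q) : Prop :=
  unital_star_hom f /\
  exists ff : tensor2 P -> tensor2 Q,
    tensor_hom (inl_tensor (tensor2 Q) \o f) (inr_tensor (tensor2 Q) \o f) ff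
    /\ forall x, ff (comul x) = comul (f x).

Definition cqg_isomorphic (P Q : cqg) : Prop :=
  exists (f : P -> Q) (f' : Q -> P),
    [/\ cqg_morphism f, cqg_morphism f', cancel f f' & cancel f' f].

Record action (B : cstarType R) (Q : cqg) := Action {
  act_tensor : min_tensor B Q;
  act_map :> B -> act_tensor;
  act_hom : unital_star_hom act_map;
  act_coassoc : coaction_law act_map (@comul Q);
  act_dense : cdense (lspan
    [set z | exists b q, z = act_map b * tensor act_tensor 1 q])
}.

Definition intertwines (B : cstarType R) (P Q : cqg)
    (al : action B P) (be : action B Q) (f : P -> Q) : Prop :=
  exists F : act_tensor al -> act_tensor be,
    tensor_hom (inl_tensor (act_tensor be)) (inr_tensor (act_tensor be) \o f) F
    /\ forall b, F (al b) = be b.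

(* [tau (x) id] preserves tau under the action; L is the slice map, i.e. the
   continuous linear map with L (b (x) q) = tau b *: q. *)
Definition preserves (B : cstarType R) (Q : cqg) (tau : B -> C)
    (al : action B Q) : Prop :=
  exists L : act_tensor al -> Q,
    [/\ linear L,
        exists M : R, forall z, cnorm (L z) <= M * cnorm z,
        forall b q, L (tensor (act_tensor al) b q) = tau b *: q
      & forall b, L (al b) = tau b *: 1].

(* The doubling: a compact quantum group structure on the C*-algebra Q (+) Q.
   The maps F1, F2, F3, F4 are xi (x) xi, eta (x) (eta o th), xi (x) eta and
   eta (x) (xi o th). *)
Definition is_doubling (Q : cqg) (th : Q -> Q)
    (D : cqg_structure (Q * Q)%type) : Prop :=
  let xi (x : Q) : Q * Q := (x, 0) in
  let eta (x : Q) : Q * Q := (0, x) in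
  let l := inl_tensor (cqg_tensor D) in
  let r := inr_tensor (cqg_tensor D) in
  exists F1 F2 F3 F4 : tensor2 Q -> cqg_tensor D,
    [/\ tensor_hom (l \o xi) (r \o xi) F1
          /\ tensor_hom (l \o eta) (r \o (eta \o th)) F2,
        tensor_hom (l \o xi) (r \o eta) F3
          /\ tensor_hom (l \o eta) (r \o (xi \o th)) F4,
        forall x, cqg_comul D (xi x) = F1 (comul x) + F2 (comul x)
      & forall x, cqg_comul D (eta x) = F3 (comul x) + F4 (comul x)].

Section Group.
Variable gT : finGroupType.

Definition unitary_rep (A : cstarType R) (u : gT -> A) : Prop :=
  [/\ u 1%g = 1, forall x y, u (x * y)%g = u x * u y
    & forall x, star (u x) = u x^-1%g].

(* The full group C*-algebra, as a compact quantum group. *)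
Definition is_full_group_cqg (Q : cqg) (lam : gT -> Q) : Prop :=
  [/\ unitary_rep lam,
      forall (A : cstarType R) (u : gT -> A), unitary_rep u ->
        (exists2 f : Q -> A, unital_star_hom f & forall x, f (lam x) = u x)
        /\ (forall f f' : Q -> A, unital_star_hom f -> unital_star_hom f' ->
              (forall x, f (lam x) = u x) -> (forall x, f' (lam x) = u x) ->
              f =1 f')
    & forall x, comul (lam x) = tensor (tensor2 Q) (lam x) (lam x)].

Definition convolution (c f : gT -> C) (x : gT) : C :=
  \sum_y c y * f (y^-1 * x)%g.

Definition l2sq (f : gT -> C) : R := \sum_x cmod (f x) ^+ 2.

(* The norm of \sum_x c x *: lam x is the norm of the left convolution by c,
   as an operator on l^2. *)
Definition is_reduced_group_cstar (B : cstarType R) (lam : gT -> B) : Prop :=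
  [/\ unitary_rep lam, cdense (lspan (range lam))
    & forall c : gT -> C, let N := cnorm (\sum_x c x *: lam x) in
        (forall f, l2sq (convolution c f) <= N ^+ 2 * l2sq f)
        /\ (forall M : R, 0 <= M ->
              (forall f, l2sq (convolution c f) <= M ^+ 2 * l2sq f) -> N <= M)].

Definition is_canonical_trace (B : cstarType R) (lam : gT -> B) (tau : B -> C)
    : Prop :=
  [/\ scalar tau, exists M : R, forall b, cmod (tau b) <= M * cnorm b
    & forall x, tau (lam x) = (x == 1%g)%:R].

(* The word length for a generating set S: (S ^+ n)%g is the set of products
   of n elements of S, and every element has length less than #|gT|. *)
Definition word_length (S : {set gT}) (x : gT) : nat :=
  find (fun n => x \in (S ^+ n)%g) (iota 0 #|gT|).

Definition preserves_length (S : {set gT}) (B : cstarType R) (lam : gT -> B)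
    (Q : cqg) (al : action B Q) : Prop :=
  forall (r : nat) (c : gT -> C), exists q : gT -> Q,
    al (\sum_(x | word_length S x == r) c x *: lam x)
    = \sum_(x | word_length S x == r) tensor (act_tensor al) (lam x) (q x).

Definition isometric_action (S : {set gT}) (B : cstarType R) (lam : gT -> B)
    (tau : B -> C) (Q : cqg) (al : action B Q) : Prop :=
  preserves tau al /\ preserves_length S lam al.

(* Q is the quantum group of the initial object (Q, al). *)
Definition is_quantum_isometry_group (S : {set gT}) (Q : cqg) : Prop :=
  exists (B : cstarType R) (lam : gT -> B) (tau : B -> C) (al : action B Q),
    [/\ is_reduced_group_cstar lam, is_canonical_trace lam tau,
        isometric_action S lam tau al
      & forall (P : cqg) (be : action B P), isometric_action S lam tau be ->
          (exists2 f : Q -> P, cqg_morphism f & intertwines al be f)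
          /\ (forall f f' : Q -> P,
                cqg_morphism f -> intertwines al be f ->
                cqg_morphism f' -> intertwines al be f' -> f =1 f')].

(* D is the doubling of the full group C*-algebra along the automorphism th
   induced by the group automorphism s. *)
Definition is_doubled_group_cqg (s : {perm gT}) (D : cqg) : Prop :=
  exists (Q : cqg) (lam : gT -> Q) (th : Q -> Q)
         (Dstr : cqg_structure (Q * Q)%type),
    [/\ is_full_group_cqg lam,
        cqg_morphism th /\ involutive th,
        forall x, th (lam x) = lam (s x),
        is_doubling th Dstr
      & D = Cqg Dstr].

End Group.
End Definitions.

(* Main.v *)
Require Import Defs.
From HB Require Import structures.
From mathcomp Require Import all_boot all_order all_algebra all_fingroup all_solvable.
From mathcomp Require Import complex.
From mathcomp Require Import boolp classical_sets reals.
From mathcomp Require Import ring lra.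

Set Implicit Arguments.
Unset Strict Implicit.
Unset Printing Implicit Defensive.

Import Order.TTheory GRing.Theory Num.Theory.

Local Open Scope ring_scope.
Local Open Scope complex_scope.

(** Let [Gamma] be the group, [s] its automorphism that inverts [g] and fixes
    [h]. The doubling [D] of the group algebra of [Gamma] consists of two copies
    [X x = xi (lambda_x)] and [Y x = eta (lambda_x)] of the group, and it acts on
    the reduced group algebra by
      lambda_x |-> lambda_x (x) X x + lambda_(s x) (x) Y (s x).
    The theorem says that this action is initial among the isometric ones; an
    initial object being unique up to isomorphism, the rest is formal
    ([universal_action_unique]).

    Let [P] act isometrically, lambda_x |-> sum_y lambda_y (x) u y x. The
    coefficients satisfy a multiplicativity relation in the column index. As the
    trace is preserved, the columns are orthonormal; the matrix also has dense
    range, so it is unitary, and taking adjoints gives the same relation in the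
    row index ([coefficient_matrixP]). Length preservation makes u y x vanish
    when exactly one of x, y is a generator. Put
      A = u h h, B = u h^-1 h, G = u g g, H = u g^-1 g.
    No product of two generators is g or g^-1, so the square of lambda_h, which
    is lambda_(h^-1), gives u g h = u g^-1 h = 0; the relations for g g^-1 = 1
    make G and H normal partial isometries with orthogonal supports adding up to
    1; and the relation h^-1 g h = g^4 forces B = 0 and A^* G A = G^4. The
    support P1 of G therefore commutes with A, and all the coefficients are
    recovered from P1 and from the unitary representation W x = sum_y u y x of
    [Gamma]: the action is
      lambda_x |-> lambda_x (x) W x P1 + lambda_(s x) (x) W x (1 - P1)
    ([coefficient_form]). So X x |-> W x P1, Y x |-> W (s x) (1 - P1) is the only
    homomorphism from [D] that intertwines the actions. That it respects the
    comultiplications has to be checked on generators only; there the coaction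
    law compares elements of (B (x) P) (x) P, where B is the reduced group
    algebra, and the terms of index g and g^-1 are separated by means of a
    character of order 3 ([character_separates]).

    The algebras that do not involve [P] are, up to isomorphism, group algebras
    of finite groups. For these, minimal tensor products exist and
    homomorphisms extend from bases ([min_tensor_of_bases],
    [tensor_hom_of_bases]) because a C*-norm on a group algebra dominates the
    coefficients ([free_coef_le]) and is therefore unique. *)

(** * Complex moduli and C*-algebras *)

Section Cmod.
Variable R : realType.
Implicit Types z w : R[i].

Lemma cmodE z : (cmod z)%:C = `|z|.
Proof. by rewrite /cmod normc_def. Qed.

Lemma cmod_ge0 z : 0 <= cmod z.
Proof. by rewrite -lecR cmodE; exact: normr_ge0. Qed.

Lemma cmodM z w : cmod (z * w) = cmod z * cmod w.
Proof. by apply: (@complexI R); rewrite rmorphM /= !cmodE normrM. Qed.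

Lemma cmod_eq0 z : cmod z = 0 -> z = 0.
Proof. by move=> z0; apply/eqP; rewrite -normr_eq0 -cmodE z0. Qed.

Lemma cmodD z w : cmod (z + w) <= cmod z + cmod w.
Proof. by rewrite -lecR rmorphD /= !cmodE ler_normD. Qed.

Lemma cmod_sum (I : Type) (r : seq I) (F : I -> R[i]) :
  cmod (\sum_(i <- r) F i) <= \sum_(i <- r) cmod (F i).
Proof.
rewrite -lecR cmodE rmorph_sum /=; apply: (le_trans (ler_norm_sum _ _ _)).
by rewrite le_eqVlt; apply/orP; left; apply/eqP; apply: eq_bigr => i _; rewrite cmodE.
Qed.

Lemma cmodR (a : R) : cmod a%:C = `|a|.
Proof. by apply: (@complexI R); rewrite cmodE normc_def /= expr0n addr0 sqrtr_sqr. Qed.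

Lemma cmodJ z : cmod (conjc z) = cmod z.
Proof. by apply: (@complexI R); rewrite !cmodE !normc_def; case: z => a b /=; rewrite sqrrN. Qed.

Lemma cmod_sqr z : z * conjc z = (cmod z ^+ 2)%:C.
Proof. by rewrite rmorphXn /= cmodE sqr_normc. Qed.

End Cmod.

Section Basics.
Variables (R : realType) (A : cstarType R).
Implicit Types x y : A.

Lemma star0 : star (0 : A) = 0.
Proof. by apply: (addrI (star 0)); rewrite -starD !addr0. Qed.

Lemma star1 : star (1 : A) = 1.
Proof. by rewrite -[LHS]mulr1 -{2}[1]starK -starM mulr1 starK. Qed.

Lemma starN x : star (- x) = - star x.
Proof. by apply/eqP; rewrite -addr_eq0 -starD addNr star0. Qed.

Lemma starB x y : star (x - y) = star x - star y.
Proof. by rewrite starD starN. Qed.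

Lemma star_sum (I : Type) (r : seq I) (P : pred I) (F : I -> A) :
  star (\sum_(i <- r | P i) F i) = \sum_(i <- r | P i) star (F i).
Proof. by apply: (big_morph _ starD star0). Qed.

Lemma cnormN x : cnorm (- x) = cnorm x.
Proof. by rewrite -scaleN1r cnormZ /cmod normrN normr1 mul1r. Qed.

Lemma cnormB x y : cnorm (x - y) = cnorm (y - x).
Proof. by rewrite -cnormN opprB. Qed.

Lemma cnorm_sum (I : Type) (r : seq I) (P : pred I) (F : I -> A) :
  cnorm (\sum_(i <- r | P i) F i) <= \sum_(i <- r | P i) cnorm (F i).
Proof.
elim/big_ind2: _ => [|a a' b b' ha hb|//]; first by rewrite cnorm0.
by rewrite (le_trans (cnormD _ _))// lerD.
Qed.

Lemma cnorm_star x : cnorm (star x) = cnorm x.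
Proof.
suff le y : cnorm y <= cnorm (star y).
  by apply/eqP; rewrite eq_le le andbT -{2}[x]starK le.
have [->|y0] := eqVneq (cnorm y) 0; first exact: cnorm_ge0.
have yp : 0 < cnorm y by rewrite lt_def y0 cnorm_ge0.
by rewrite -(ler_pM2r yp) -expr2 -cnorm_star_mul cnormM.
Qed.

Lemma cnorm1 : cnorm (1 : A) = 1.
Proof.
have := cnorm_star_mul (1 : A); rewrite star1 mulr1 => n1.
have [/cnorm_eq0/eqP|n0] := eqVneq (cnorm (1 : A)) 0; first by rewrite oner_eq0.
by apply: (mulfI n0); rewrite -expr2 -n1 mulr1.
Qed.

Lemma cnorm_unitary x : star x * x = 1 -> cnorm x = 1.
Proof.
move=> u; have := cnorm_star_mul x; rewrite u cnorm1 => /esym/eqP.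
by rewrite sqrf_eq1 => /orP[/eqP//|/eqP n1]; have := cnorm_ge0 x; rewrite n1 ler0N1.
Qed.

Lemma cnorm_small0 x : (forall e, 0 < e -> cnorm x <= e) -> x = 0.
Proof.
move=> small; apply: cnorm_eq0; apply/eqP; rewrite eq_le cnorm_ge0 andbT.
by apply/ler_addgt0Pl => e e0; rewrite addr0 small.
Qed.

End Basics.

Section LinearFunctions.
Variables (R : realType) (U V : lmodType R[i]) (f : U -> V).
Hypothesis lf : linear f.

Lemma lin0 : f 0 = 0.
Proof. by have := lf (-1) 0 0; rewrite scaler0 addr0 scaleN1r addNr. Qed.

Lemma linD : {morph f : x y / x + y}.
Proof. by move=> x y; have := lf 1 x y; rewrite !scale1r. Qed.

Lemma linZ c x : f (c *: x) = c *: f x.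
Proof. by have := lf c x 0; rewrite lin0 !addr0. Qed.

Lemma linN x : f (- x) = - f x.
Proof. by rewrite -scaleN1r linZ scaleN1r. Qed.

Lemma linB x y : f (x - y) = f x - f y.
Proof. by rewrite linD linN. Qed.

Lemma lin_sum (I : Type) (r : seq I) (P : pred I) (F : I -> U) :
  f (\sum_(i <- r | P i) F i) = \sum_(i <- r | P i) f (F i).
Proof. by apply: (big_morph _ linD lin0). Qed.

End LinearFunctions.

Lemma bounded_dense0 (R : realType) (A B : cstarType R) (f : A -> B) (X : set A)
    (M : R) :
  linear f -> (forall x, cnorm (f x) <= M * cnorm x) ->
  cdense X -> (forall x, X x -> f x = 0) -> forall x, f x = 0.
Proof.
move=> lf bf xi_lam fX x; apply: cnorm_small0 => e e0.
have M1 : 0 < `|M| + 1 by rewrite ltr_pwDr.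
have [y Xy xy] := xi_lam x (e / (`|M| + 1)) (divr_gt0 e0 M1).
rewrite -[x](subrK y) linD// (fX _ Xy) addr0; apply: (le_trans (bf _)).
apply: (@le_trans _ _ ((`|M| + 1) * cnorm (x - y))).
  by apply: ler_wpM2r; [exact: cnorm_ge0 | rewrite (le_trans (ler_norm M))// lerDl].
by rewrite mulrC -ler_pdivlMr// ltW.
Qed.

Section StarHom.
Variables (R : realType) (A B E : cstarType R).

Lemma star_hom_lin (f : A -> B) : star_hom f -> linear f.
Proof. by case. Qed.

Lemma star_homM (f : A -> B) : star_hom f -> {morph f : x y / x * y}.
Proof. by case. Qed.

Lemma star_homJ (f : A -> B) : star_hom f -> {morph f : x / star x}.
Proof. by case. Qed.

Lemma star_hom_comp (f : B -> E) (k : A -> B) :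
  star_hom f -> star_hom k -> star_hom (f \o k).
Proof.
move=> [fl fm fs] [kl km ks]; split.
- by move=> c x y /=; rewrite kl fl.
- by move=> x y /=; rewrite km fm.
- by move=> x /=; rewrite ks fs.
Qed.

Lemma unital_star_hom_comp (f : B -> E) (k : A -> B) :
  unital_star_hom f -> unital_star_hom k -> unital_star_hom (f \o k).
Proof. by move=> [hf f1] [hk k1]; split; [exact: star_hom_comp|rewrite /= k1]. Qed.

End StarHom.

(** * Unital homomorphisms are contractive *)

Lemma bernoulli_le (R : realType) (d : R) n :
  0 <= d -> 1 + d *+ n <= (1 + d) ^+ n.
Proof.
move=> d0; elim: n => [|n IH]; first by rewrite mulr0n addr0 expr0.
rewrite exprS; apply: (@le_trans _ _ ((1 + d) * (1 + d *+ n))).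
  have : 0 <= d * (d *+ n) by rewrite mulr_ge0 // mulrn_wge0.
  rewrite mulrS; lra.
by apply: ler_wpM2l => //; lra.
Qed.

Lemma expr_unbounded (R : realType) (r M : R) : 1 < r ->
  exists n, forall m, (n <= m)%N -> M < r ^+ m.
Proof.
move=> r1; have d0 : 0 < r - 1 by lra.
exists (Num.truncn (`|M| / (r - 1))).+1 => m nm.
have nm' : (Num.truncn (`|M| / (r - 1))).+1%:R <= m%:R :> R by rewrite ler_nat.
have := truncnS_gt (`|M| / (r - 1)).
rewrite ltr_pdivrMr// => Mlt.
have := @bernoulli_le R (r - 1) m (ltW d0); rewrite [1 + (r - 1)](_ : _ = r); last lra.
move=> le.
apply: lt_le_trans le; apply: le_lt_trans (ler_norm M) _.
apply: (lt_le_trans Mlt); rewrite -[(r - 1) *+ m]mulr_natl.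
have : (Num.truncn (`|M| / (r - 1))).+1%:R * (r - 1) <= m%:R * (r - 1).
  by apply: ler_wpM2r; [exact: ltW|].
lra.
Qed.

Lemma expr_small (R : realType) (r e : R) : 0 <= r < 1 -> 0 < e ->
  exists n, forall m, (n <= m)%N -> r ^+ m < e.
Proof.
move=> /andP[r0 r1] e0; move: r0; rewrite le_eqVlt => /orP[/eqP<-|r0].
  by exists 1%N => -[//|m] _; rewrite expr0n.
have r1' : 1 < r^-1 by rewrite invf_gt1.
have [n H] := expr_unbounded e^-1 r1'.
by exists n => m /H; rewrite exprVn ltf_pV2 // posrE ?exprn_gt0.
Qed.

(** The square root of 1 - x is 1 - y, where y is the fixed point of
    y |-> (x + y^2) / 2; this map contracts the ball of radius (1 + |x|) / 2
    on commuting elements. *)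
Section SquareRoot.
Variables (R : realType) (A : cstarType R) (x : A).
Hypotheses (xs : star x = x) (x1 : cnorm x < 1).

Let Phi (y : A) : A := (2 : R)^-1%:C *: (x + y * y).
Let u n := iter n Phi 0.
Let rho : R := (1 + cnorm x) / 2.

Let x0 : 0 <= cnorm x. Proof. exact: cnorm_ge0. Qed.
Let rho01 : 0 <= rho < 1. Proof. rewrite /rho; apply/andP; split; move: x0 x1; lra. Qed.
Let rho0 : 0 <= rho. Proof. by case/andP: rho01. Qed.

Let cmod_half : cmod ((2 : R)^-1%:C) = 2^-1.
Proof. by rewrite cmodR ger0_norm ?invr_ge0 ?ler0n. Qed.

Let half2 : (2 : R[i]) * (2 : R)^-1%:C = 1.
Proof.
rewrite (_ : 2 = (2 : R)%:C); last by rewrite rmorph_nat.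
by rewrite -rmorphM /= mulfV // pnatr_eq0.
Qed.

Let u_comm z n : z * x = x * z -> z * u n = u n * z.
Proof.
move=> zx; elim: n => [|n IH]; first by rewrite mulr0 mul0r.
rewrite /= /Phi -scalerAr -scalerAl mulrDr mulrDl zx; congr (_ *: (_ + _)).
by rewrite mulrA IH -mulrA IH mulrA.
Qed.

Let uu_comm m n : u m * u n = u n * u m.
Proof. by apply: u_comm; rewrite u_comm. Qed.

Let u_star n : star (u n) = u n.
Proof.
elim: n => [|n IH]; first exact: star0.
by rewrite /= /Phi starZ starD starM IH xs /= oppr0.
Qed.

Let u_ball n : cnorm (u n) <= rho.
Proof.
elim: n => [|n IH]; first by rewrite /= cnorm0.
rewrite /= cnormZ cmod_half.
have := cnormD x (u n * u n); have := cnormM (u n) (u n).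
have : cnorm (u n) * cnorm (u n) <= rho * rho by apply: ler_pM => //; exact: cnorm_ge0.
have : rho * rho <= 1.
  case/andP: rho01 => _ /ltW r1.
  by have := ler_pM rho0 rho0 r1 r1; rewrite mulr1.
move: x0 x1; rewrite /rho; lra.
Qed.

Let Phi_contract y z : y * z = z * y -> cnorm y <= rho -> cnorm z <= rho ->
  cnorm (Phi y - Phi z) <= rho * cnorm (y - z).
Proof.
move=> yz yr zr.
have -> : Phi y - Phi z = (2 : R)^-1%:C *: ((y + z) * (y - z)).
  rewrite /Phi -scalerBr mulrDl !mulrBr yz; congr (_ *: _).
  by rewrite opprD addrACA subrr add0r addrA subrK.
rewrite cnormZ cmod_half.
have := cnormD y z; have := cnormM (y + z) (y - z).
have := cnorm_ge0 (y - z).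
move: (cnorm (y - z)) (cnorm (_ * _)) (cnorm (y + z)) => a b c a0 bca cle.
have : c * a <= (rho + rho) * a by apply: ler_wpM2r => //; lra.
lra.
Qed.

Let u_iter n k : cnorm (u (n + k) - u n) <= rho ^+ n.
Proof.
elim: n => [|n IH].
  rewrite add0n subr0 expr0; apply: (le_trans (u_ball _)); case/andP: rho01 => _; exact: ltW.
rewrite addSn exprS; apply: (le_trans (Phi_contract (uu_comm _ _) (u_ball _) (u_ball _))).
exact: ler_wpM2l.
Qed.

Let u_cauchy e : 0 < e -> exists N : nat, forall m n : nat,
       (N <= m)%N -> (N <= n)%N -> cnorm (u m - u n) < e.
Proof.
move=> e0; have e2 : 0 < e / 2 by lra.
have [N HN] := expr_small rho01 e2; exists N => m n Nm Nn.
have := u_iter N (m - N); have := u_iter N (n - N); rewrite !subnKC//.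
have := HN _ (leqnn N); have := cnormD (u m - u N) (u N - u n).
rewrite addrA subrK (cnormB (u N)); lra.
Qed.

Lemma cstar_sqrt : exists y : A, [/\ star y = y, y * y = 1 - x &
  forall z, z * x = x * z -> z * y = y * z].
Proof.
have [y yl] := cnorm_complete u u_cauchy.
have lim0 (w : A) (K : R) : (forall n, cnorm w <= K * cnorm (u n - y)) -> w = 0.
  move=> H; apply: cnorm_small0 => e e0.
  have K1 : 0 < `|K| + 1 by rewrite ltr_pwDr.
  have [N HN] := yl _ (divr_gt0 e0 K1).
  have := HN _ (leqnn N); rewrite ltr_pdivlMr// => HN'.
  have nn := cnorm_ge0 (u N - y).
  have : K * cnorm (u N - y) <= (`|K| + 1) * cnorm (u N - y).
    by apply: ler_wpM2r => //; have := ler_norm K; lra.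
  have := H N; lra.
have yc z : z * x = x * z -> z * y = y * z.
  move=> zx; apply/eqP; rewrite -subr_eq0; apply/eqP.
  apply: (lim0 _ (2 * cnorm z)) => n.
  have -> : z * y - y * z = (u n - y) * z - z * (u n - y).
    by rewrite mulrBl mulrBr u_comm// opprB addrCA (addrAC (u n * z)) subrr sub0r.
  have := cnormD ((u n - y) * z) (- (z * (u n - y))); rewrite cnormN.
  have := cnormM (u n - y) z; have := cnormM z (u n - y); lra.
have ys : star y = y.
  apply/eqP; rewrite -subr_eq0; apply/eqP; apply: (lim0 _ 2) => n.
  have -> : star y - y = (u n - y) - star (u n - y).
    by rewrite starB u_star opprB [RHS]addrC addrA subrK.
  have := cnormD (u n - y) (- star (u n - y)); rewrite cnormN cnorm_star; lra.
have yr : cnorm y <= rho.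
  apply/ler_addgt0Pr => e e0; have [N HN] := yl _ e0.
  have := HN _ (leqnn N); have := u_ball N.
  have := cnormD (u N) (y - u N); rewrite addrC subrK cnormB; lra.
have yfix : y = Phi y.
  apply/eqP; rewrite -subr_eq0; apply/eqP.
  suff H n : cnorm (y - Phi y) <= cnorm (u n.+1 - y) + cnorm (u n - y).
    apply: cnorm_small0 => e e0; have e2 : 0 < e / 2 by lra.
    have [N HN] := yl _ e2; have := H N.
    have := HN _ (leqnn N); have := HN _ (leqnSn N); lra.
  have := cnormD (y - u n.+1) (u n.+1 - Phi y); rewrite addrA subrK (cnormB y (u n.+1)).
  have : y * u n = u n * y by rewrite u_comm// -yc.
  move=> /esym c; have := Phi_contract c (u_ball n) yr.
  rewrite /= -/(u n); have := cnorm_ge0 (u n - y); case/andP: rho01 => _ r1 a0.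
  have : rho * cnorm (u n - y) <= 1 * cnorm (u n - y) by apply: ler_wpM2r => //; lra.
  lra.
have y2 : y + y = x + y * y.
  by rewrite -mulr2n -scaler_nat {1}yfix scalerA half2 scale1r.
exists (1 - y); split.
- by rewrite starB star1 ys.
- rewrite mulrBl mul1r mulrBr mulr1 opprB -addrA.
  rewrite (_ : - y + (y * y - y) = y * y - (y + y)); last by rewrite opprD addrCA.
  by rewrite y2 opprD (addrCA (y * y)) subrr addr0.
- by move=> z /yc zy; rewrite mulrBl mulrBr mulr1 mul1r zy.
Qed.

End SquareRoot.

(** A self-adjoint element b with |b| < 1 is the real part of the unitary
    b + i sqrt (1 - b^2), and a unital homomorphism maps unitaries to unitaries,
    which have norm 1. *)
Lemma unital_star_hom_contractive (R : realType) (A B : cstarType R) (f : A -> B) :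
  unital_star_hom f -> forall a, cnorm (f a) <= cnorm a.
Proof.
move=> [[fl fm fs] f1].
have selfadj (b : A) : star b = b -> cnorm b < 1 -> cnorm (f b) <= 1.
  move=> bs b1.
  have bb1 : cnorm (b * b) < 1.
    have := cnormM b b; have := cnorm_ge0 b => b0 le; apply: (le_lt_trans le).
    apply: (@le_lt_trans _ _ (cnorm b * 1)); last by rewrite mulr1.
    by apply: ler_wpM2l => //; exact: ltW.
  have bbs : star (b * b) = b * b by rewrite starM bs.
  have [c [cs cc comm]] := cstar_sqrt bbs bb1.
  have bc : b * c = c * b by apply: comm; rewrite mulrA.
  pose v : A := b + 'i%C *: c.
  have sv : star v = b - 'i%C *: c.
    rewrite /v starD starZ bs cs -scaleNr; congr (_ + _ *: _).
    by rewrite /conjc; apply/eqP; rewrite eq_complex /= oppr0 !eqxx.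
  have v1 : star v * v = 1.
    have i2 : ('i%C * 'i%C) *: (c * c) = - (c * c).
      by rewrite -expr2 sqr_i scaleN1r.
    rewrite sv /v mulrBl !mulrDr -!scalerAl -!scalerAr scalerA bc i2 cc.
    by rewrite opprD opprK addrA addrK addrC subrK.
  have nv : cnorm (f v) = 1 by apply: cnorm_unitary; rewrite -fs -fm v1.
  have bE : b = (2 : R)^-1%:C *: (v + star v).
    rewrite sv /v addrACA subrr addr0 -mulr2n -scaler_nat scalerA mulrC.
    rewrite (_ : 2 = (2 : R)%:C); last by rewrite rmorph_nat.
    by rewrite -rmorphM /= mulfV ?scale1r // pnatr_eq0.
  rewrite bE (linZ fl) cnormZ cmodR (linD fl) fs ger0_norm ?invr_ge0 ?ler0n//.
  have := cnormD (f v) (star (f v)); rewrite cnorm_star nv; lra.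
move=> a.
have a0 := cnorm_ge0 a; have fa0 := cnorm_ge0 (f a).
rewrite -(ler_pXn2r (_ : (0 < 2)%N)) ?nnegrE// -!cnorm_star_mul -fs -fm.
set b := star a * a; have bs : star b = b by rewrite /b starM starK.
apply/ler_addgt0Pr => e e0; set r := cnorm b + e.
have r0 : 0 < r by rewrite /r; have := cnorm_ge0 b; lra.
have := @selfadj (r^-1%:C *: b).
rewrite starZ bs /= oppr0 => /(_ erefl).
rewrite cnormZ cmodR (linZ fl) cnormZ cmodR gtr0_norm ?invr_gt0//.
rewrite mulrC ltr_pdivrMr// mul1r mulrC ler_pdivrMr// mul1r; apply.
rewrite /r; lra.
Qed.

(** * Completeness and l^2 *)

Section Complete.
Variable R : realType.

(** The limit is the supremum of the numbers that are eventually below the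
    sequence. *)
Lemma real_complete (u : nat -> R) :
  (forall e, 0 < e -> exists N : nat, forall m n : nat,
     (N <= m)%N -> (N <= n)%N -> `|u m - u n| < e) ->
  exists l, forall e, 0 < e -> exists N : nat, forall n : nat,
    (N <= n)%N -> `|u n - l| < e.
Proof.
move=> cu.
pose E : set R := [set x | exists N, forall n, (N <= n)%N -> x <= u n]%classic.
have near e N : (forall m n, (N <= m)%N -> (N <= n)%N -> `|u m - u n| < e) ->
    E (u N - e) /\ ubound E (u N + e).
  move=> HN; split.
    exists N => n Nn; have := HN _ _ (leqnn N) Nn.
    by rewrite ltr_norml => /andP[_]; lra.
  move=> x [M HM]; have := HM (maxn M N) (leq_maxl _ _).
  have := HN _ _ (leqnn N) (leq_maxr M N); rewrite ltr_norml => /andP[]; lra.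
have supE : has_sup E.
  have [N /near[EN UN]] := cu 1 ltr01.
  by split; [exists (u N - 1) | exists (u N + 1)].
exists (sup E) => e e0; have e2 : 0 < e / 4 by lra.
have [N HN] := cu _ e2; have [EN UN] := near _ _ HN.
exists N => n Nn; have := HN _ _ (leqnn N) Nn.
have := ge_sup (proj1 supE) UN.
have := sup_upper_bound supE EN.
rewrite !ltr_norml => ? ? /andP[? ?]; apply/andP; split; lra.
Qed.

Lemma cmodRe (z : R[i]) : `|complex.Re z| <= cmod z.
Proof.
case: z => a b; rewrite /cmod normc_def /= -sqrtr_sqr ler_wsqrtr//.
by rewrite lerDl sqr_ge0.
Qed.

Lemma cmodIm (z : R[i]) : `|complex.Im z| <= cmod z.
Proof.
case: z => a b; rewrite /cmod normc_def /= -sqrtr_sqr ler_wsqrtr//.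
by rewrite lerDr sqr_ge0.
Qed.

Lemma cmod_le (z : R[i]) : cmod z <= `|complex.Re z| + `|complex.Im z|.
Proof.
have -> : z = (complex.Re z)%:C + 'i * (complex.Im z)%:C by rewrite -complexE.
apply: (le_trans (cmodD _ _)); rewrite cmodM !cmodR.
have -> : cmod 'i = 1 :> R.
  by apply: (@complexI R); rewrite cmodE normc_def /= expr0n expr1n add0r sqrtr1.
rewrite mul1r -complexE; apply: lerD; rewrite ?lexx//; by case: z.
Qed.

Lemma complex_complete (u : nat -> R[i]) :
  (forall e, 0 < e -> exists N : nat, forall m n : nat,
     (N <= m)%N -> (N <= n)%N -> cmod (u m - u n) < e) ->
  exists l, forall e, 0 < e -> exists N : nat, forall n : nat,
    (N <= n)%N -> cmod (u n - l) < e.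
Proof.
move=> cu.
have [a ua] : exists l, forall e, 0 < e -> exists N : nat, forall n : nat,
    (N <= n)%N -> `|complex.Re (u n) - l| < e.
  apply: real_complete => e /cu[N HN]; exists N => m n Nm Nn.
  by rewrite -raddfB; apply: le_lt_trans (cmodRe _) (HN _ _ Nm Nn).
have [b ub] : exists l, forall e, 0 < e -> exists N : nat, forall n : nat,
    (N <= n)%N -> `|complex.Im (u n) - l| < e.
  apply: real_complete => e /cu[N HN]; exists N => m n Nm Nn.
  by rewrite -raddfB; apply: le_lt_trans (cmodIm _) (HN _ _ Nm Nn).
exists (Complex a b) => e e0; have e2 : 0 < e / 2 by lra.
have [N1 H1] := ua _ e2; have [N2 H2] := ub _ e2.
exists (maxn N1 N2) => n; rewrite geq_max => /andP[/H1 h1 /H2 h2].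
apply: (le_lt_trans (cmod_le _)); rewrite !raddfB /=; lra.
Qed.

End Complete.

Section L2.
Variables (R : realType) (I : finType).
Implicit Types a b : I -> R.
Implicit Types f k : I -> R[i].

(** Lagrange's identity. *)
Lemma cauchy_schwarz a b :
  (\sum_i a i * b i) ^+ 2 <= (\sum_i a i ^+ 2) * (\sum_i b i ^+ 2).
Proof.
have : 0 <= \sum_i \sum_j (a i * b j - a j * b i) ^+ 2.
  by apply: sumr_ge0 => i _; apply: sumr_ge0 => j _; exact: sqr_ge0.
have -> : \sum_i \sum_j (a i * b j - a j * b i) ^+ 2 =
    ((\sum_i a i ^+ 2) * (\sum_i b i ^+ 2) - (\sum_i a i * b i) ^+ 2) *+ 2.
  rewrite expr2 !big_distrlr /= -sumrB mulr2n.
  rewrite [X in _ = _ + X](_ : _ = \sum_i \sum_j (a j ^+ 2 * b i ^+ 2 - a i * b i * (a j * b j))).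
    rewrite -big_split /=; apply: eq_bigr => i _.
    by rewrite -sumrB -big_split /=; apply: eq_bigr => j _; ring.
  under eq_bigr do rewrite -sumrB; rewrite exchange_big /=.
  by apply: eq_bigr => i _; apply: eq_bigr => j _; ring.
by rewrite pmulrn_lge0// subr_ge0.
Qed.

Definition l2n f : R := Num.sqrt (\sum_x cmod (f x) ^+ 2).

Lemma l2n_ge0 f : 0 <= l2n f. Proof. exact: sqrtr_ge0. Qed.

Lemma sqr_l2n f : l2n f ^+ 2 = \sum_x cmod (f x) ^+ 2.
Proof. by rewrite sqr_sqrtr// sumr_ge0// => i _; exact: sqr_ge0. Qed.

Lemma l2n_ext f k : f =1 k -> l2n f = l2n k.
Proof. by move=> fk; rewrite /l2n; under eq_bigr do rewrite fk. Qed.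

Lemma l2n_dot f k : cmod (\sum_x f x * conjc (k x)) <= l2n f * l2n k.
Proof.
apply: (le_trans (cmod_sum _ _)).
rewrite -(ler_pXn2r (_ : (0 < 2)%N))// ?nnegrE ?mulr_ge0 ?l2n_ge0//; last first.
  by apply: sumr_ge0 => i _; exact: cmod_ge0.
rewrite exprMn !sqr_l2n; under eq_bigr do rewrite cmodM cmodJ.
exact: cauchy_schwarz.
Qed.

Lemma l2nD f k : l2n (fun x => f x + k x) <= l2n f + l2n k.
Proof.
rewrite -(ler_pXn2r (_ : (0 < 2)%N))// ?nnegrE ?addr_ge0 ?l2n_ge0//.
rewrite sqrrD !sqr_l2n.
have cs : \sum_x cmod (f x) * cmod (k x) <= l2n f * l2n k.
  rewrite -(ler_pXn2r (_ : (0 < 2)%N))// ?nnegrE ?mulr_ge0 ?l2n_ge0//; last first.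
    by apply: sumr_ge0 => i _; rewrite mulr_ge0 ?cmod_ge0.
  by rewrite exprMn !sqr_l2n; exact: cauchy_schwarz.
apply: (@le_trans _ _ (\sum_x cmod (f x) ^+ 2 +
    (\sum_x cmod (f x) * cmod (k x)) *+ 2 + \sum_x cmod (k x) ^+ 2)).
  rewrite -sumrMnl -!big_split /=; apply: ler_sum => x _.
  rewrite -sqrrD ler_pXn2r// ?nnegrE ?addr_ge0 ?cmod_ge0//; exact: cmodD.
by rewrite lerD2r lerD2l lerMn2r cs orbT.
Qed.

Lemma l2nZ c f : l2n (fun x => c * f x) = cmod c * l2n f.
Proof.
rewrite /l2n; under eq_bigr do rewrite cmodM exprMn.
by rewrite -mulr_sumr sqrtrM ?sqr_ge0// sqrtr_sqr ger0_norm ?cmod_ge0.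
Qed.

Lemma l2n0 : l2n (fun=> 0) = 0.
Proof. by rewrite /l2n big1 ?sqrtr0// => i _; rewrite /cmod normr0 expr0n. Qed.

Lemma l2n_sum (J : Type) (r : seq J) (F : J -> I -> R[i]) :
  l2n (fun x => \sum_(j <- r) F j x) <= \sum_(j <- r) l2n (F j).
Proof.
elim: r => [|j r IH].
  by rewrite big_nil (@l2n_ext _ (fun=> 0)) ?l2n0// => x; rewrite big_nil.
rewrite big_cons (@l2n_ext _ (fun x => F j x + \sum_(j <- r) F j x)); last first.
  by move=> x; rewrite big_cons.
by apply: (le_trans (l2nD _ _)); rewrite lerD2l.
Qed.

Lemma l2n_entry f x : cmod (f x) <= l2n f.
Proof.
rewrite -(ler_pXn2r (_ : (0 < 2)%N))// ?nnegrE ?l2n_ge0 ?cmod_ge0//.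
rewrite sqr_l2n (bigD1 x)//= lerDl.
by apply: sumr_ge0 => i _; exact: sqr_ge0.
Qed.

End L2.

(** * The group C*-algebra of a finite group *)

(** A separate name, because the product is the convolution and not the
    pointwise one. *)
Definition galg (R : realType) (G : finGroupType) : Type := {ffun G -> R[i]^o}.

Section GroupAlgebra.
Variables (R : realType) (G : finGroupType).
Local Notation A := (galg R G).
Implicit Types a b c : A.

HB.instance Definition _ := GRing.Lmodule.copy A {ffun G -> R[i]^o}.

Let gone : A := [ffun x => (x == 1%g)%:R].
Let gmul a b : A := [ffun x => convolution (a : G -> R[i]) b x].

Lemma convolutionA (a b f : G -> R[i]) x :
  convolution a (convolution b f) x = convolution (convolution a b) f x.
Proof.
rewrite /convolution; under [RHS]eq_bigr do rewrite mulr_suml.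
rewrite [RHS]exchange_big /=; apply: eq_bigr => y _.
rewrite mulr_sumr [RHS](reindex_inj (mulgI y)) /=.
by apply: eq_bigr => z _; rewrite mulKg invMg mulrA mulgA.
Qed.

Lemma convolution_ext (a b f k : G -> R[i]) : a =1 b -> f =1 k ->
  convolution a f =1 convolution b k.
Proof. by move=> ab fk x; apply: eq_bigr => y _; rewrite ab fk. Qed.

Lemma convolution_delta (f : G -> R[i]) y x :
  convolution (fun z => (z == y)%:R) f x = f (y^-1 * x)%g.
Proof.
rewrite /convolution (bigD1 y)//= eqxx mul1r big1 ?addr0// => z /negPf->.
by rewrite mul0r.
Qed.

Lemma delta_convolution (f : G -> R[i]) y x :
  convolution f (fun z => (z == y)%:R) x = f (x * y^-1)%g.
Proof.
rewrite /convolution (bigD1 (x * y^-1)%g)//= invMg invgK mulgKV eqxx mulr1.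
rewrite big1 ?addr0// => z zxy; have [E|] := eqVneq (z^-1 * x)%g y; last by rewrite mulr0.
by rewrite -E invMg invgK mulKVg eqxx in zxy.
Qed.

Let gmulA : associative gmul.
Proof.
move=> a b c; apply/ffunP => x; rewrite !ffunE.
rewrite (@convolution_ext a a (gmul b c) (convolution (b : G -> R[i]) c))// => [|z].
  rewrite convolutionA; apply: convolution_ext => // z; by rewrite ffunE.
by rewrite ffunE.
Qed.

Let gmul1l : left_id gone gmul.
Proof.
move=> a; apply/ffunP => x; rewrite ffunE.
rewrite (@convolution_ext gone (fun z => (z == 1%g)%:R) a a)// => [|z]; last by rewrite ffunE.
by rewrite convolution_delta invg1 mul1g.
Qed.

Let gmul1r : right_id gone gmul.
Proof.
move=> a; apply/ffunP => x; rewrite ffunE.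
rewrite (@convolution_ext a a gone (fun z => (z == 1%g)%:R))// => [|z]; last by rewrite ffunE.
by rewrite delta_convolution invg1 mulg1.
Qed.

Let gmulDl : left_distributive gmul +%R.
Proof.
move=> a b c; apply/ffunP => x; rewrite !ffunE /convolution -big_split /=.
by apply: eq_bigr => y _; rewrite ffunE mulrDl.
Qed.

Let gmulDr : right_distributive gmul +%R.
Proof.
move=> a b c; apply/ffunP => x; rewrite !ffunE /convolution -big_split /=.
by apply: eq_bigr => y _; rewrite ffunE mulrDr.
Qed.

Let gone_neq0 : gone != 0.
Proof.
apply/eqP => /ffunP/(_ 1%g); rewrite !ffunE eqxx => /eqP; by rewrite oner_eq0.
Qed.

HB.instance Definition _ := GRing.Zmodule_isNzRing.Build A
  gmulA gmul1l gmul1r gmulDl gmulDr gone_neq0.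

Lemma galgM a b x : (a * b) x = convolution (a : G -> R[i]) b x.
Proof. by rewrite [in LHS]/GRing.mul /= ffunE. Qed.

Let galgZ (k : R[i]) a x : (k *: a) x = k * a x.
Proof. by rewrite ffunE. Qed.

Let gscaleAl (k : R[i]) a b : k *: (a * b) = (k *: a) * b.
Proof.
apply/ffunP => x; rewrite galgZ !galgM /convolution mulr_sumr.
by apply: eq_bigr => y _; rewrite galgZ mulrA.
Qed.

HB.instance Definition _ := GRing.Lmodule_isLalgebra.Build R[i] A gscaleAl.

Let gscaleAr (k : R[i]) a b : k *: (a * b) = a * (k *: b).
Proof.
apply/ffunP => x; rewrite galgZ !galgM /convolution mulr_sumr.
by apply: eq_bigr => y _; rewrite galgZ mulrCA.
Qed.

HB.instance Definition _ := GRing.Lalgebra_isAlgebra.Build R[i] A gscaleAr.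

Lemma galg1 x : (1 : A) x = (x == 1%g)%:R.
Proof. by rewrite [in LHS]/GRing.one /= ffunE. Qed.

Let gstar a : A := [ffun x => conjc (a x^-1%g)].

Lemma convolution_adjoint a (f k : G -> R[i]) :
  \sum_x convolution (a : G -> R[i]) f x * conjc (k x) =
  \sum_x f x * conjc (convolution (gstar a : G -> R[i]) k x).
Proof.
rewrite /convolution; under eq_bigr do rewrite mulr_suml.
rewrite exchange_big /=.
transitivity (\sum_y \sum_x a y * f x * conjc (k (y * x)%g)).
  apply: eq_bigr => y _; rewrite (reindex_inj (mulgI y)) /=.
  by apply: eq_bigr => x _; rewrite mulKg.
rewrite exchange_big /=; apply: eq_bigr => x _.
rewrite rmorph_sum mulr_sumr /= (reindex_inj invg_inj) /=.
apply: eq_bigr => y _; rewrite ffunE rmorphM /= conjcK.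
by rewrite mulrCA mulrA.
Qed.

Let gstarD : {morph gstar : x y / x + y}.
Proof. by move=> a b; apply/ffunP => x; rewrite !ffunE rmorphD. Qed.

Let gstarZ (k : R[i]) a : gstar (k *: a) = conjc k *: gstar a.
Proof. by apply/ffunP => x; rewrite !ffunE rmorphM. Qed.

Let gstarK : involutive gstar.
Proof. by move=> a; apply/ffunP => x; rewrite !ffunE invgK conjcK. Qed.

Let gstarM a b : gstar (a * b) = gstar b * gstar a.
Proof.
apply/ffunP => x; rewrite galgM ffunE galgM /convolution rmorph_sum /=.
rewrite (reindex_inj (mulgI x^-1%g)) /=; apply: eq_bigr => y _.
by rewrite !ffunE rmorphM /= mulrC !invMg !invgK -mulgA mulgV mulg1.
Qed.

(** The bounds of the operator of left convolution by the element. *)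
Definition conv_bounds a : set R :=
  [set M | 0 <= M /\
    forall f : G -> R[i], l2n (convolution (a : G -> R[i]) f) <= M * l2n f]%classic.

Definition opnorm a : R := inf (conv_bounds a).

Let conv_bounds_sum a : conv_bounds a (\sum_y cmod (a y)).
Proof.
split; first by apply: sumr_ge0 => y _; exact: cmod_ge0.
move=> f; apply: (le_trans (l2n_sum _ _)); rewrite mulr_suml.
apply: ler_sum => y _; rewrite l2nZ ler_wpM2l ?cmod_ge0//.
rewrite /l2n (reindex_inj (mulgI y)) /=.
by under eq_bigr do rewrite mulKg.
Qed.

Let has_inf_bounds a : has_inf (conv_bounds a).
Proof.
by split; [exists (\sum_y cmod (a y)); exact: conv_bounds_sum | exists 0 => M []].
Qed.

Lemma opnorm_le a (M : R) : 0 <= M ->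
  (forall f : G -> R[i], l2n (convolution (a : G -> R[i]) f) <= M * l2n f) -> opnorm a <= M.
Proof. by move=> M0 H; apply: ge_inf; [case: (has_inf_bounds a)|split]. Qed.

Lemma opnorm_ge0 a : 0 <= opnorm a.
Proof. by apply: lb_le_inf; [case: (has_inf_bounds a)|move=> M []]. Qed.

Lemma opnormP a (f : G -> R[i]) : l2n (convolution (a : G -> R[i]) f) <= opnorm a * l2n f.
Proof.
have := l2n_ge0 f; rewrite le_eqVlt => /orP[/eqP f0|f0].
  by have [_ /(_ f)] := conv_bounds_sum a; rewrite -f0 !mulr0.
rewrite -ler_pdivrMr//; apply: lb_le_inf; first by case: (has_inf_bounds a).
by move=> M [_ H]; rewrite ler_pdivrMr.
Qed.

Lemma opnorm_le_sum a : opnorm a <= \sum_y cmod (a y).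
Proof. by have [? ?] := conv_bounds_sum a; exact: opnorm_le. Qed.

Lemma opnorm_entry a x : cmod (a x) <= opnorm a.
Proof.
have := opnormP a (fun z => (z == 1%g)%:R).
have -> : l2n (fun z : G => (z == 1%g)%:R) = 1 :> R.
  rewrite /l2n (bigD1 1%g)//= eqxx big1 => [|z /negPf->].
    by rewrite addr0 /cmod normr1 expr1n sqrtr1.
  by rewrite /cmod normr0 expr0n.
rewrite mulr1 (@l2n_ext _ _ _ a) => [|z]; last by rewrite delta_convolution invg1 mulg1.
by apply: le_trans; exact: l2n_entry.
Qed.

Let opnorm_eq0 a : opnorm a = 0 -> a = 0.
Proof.
move=> a0; apply/ffunP => x; rewrite ffunE; apply: cmod_eq0; apply/eqP.
by rewrite eq_le cmod_ge0 andbT -a0 opnorm_entry.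
Qed.

Let opnormD a b : opnorm (a + b) <= opnorm a + opnorm b.
Proof.
apply: opnorm_le => [|f]; first by rewrite addr_ge0 ?opnorm_ge0.
rewrite (@l2n_ext _ _ _
  (fun x => convolution (a : G -> R[i]) f x + convolution (b : G -> R[i]) f x)).
  by apply: (le_trans (l2nD _ _)); rewrite mulrDl lerD ?opnormP.
move=> x; rewrite /convolution -big_split; apply: eq_bigr => y _.
by rewrite ffunE mulrDl.
Qed.

Let opnormZ_le (k : R[i]) a : opnorm (k *: a) <= cmod k * opnorm a.
Proof.
apply: opnorm_le => [|f]; first by rewrite mulr_ge0 ?opnorm_ge0 ?cmod_ge0.
rewrite (@l2n_ext _ _ _ (fun x => k * convolution (a : G -> R[i]) f x)).
  by rewrite l2nZ -mulrA ler_wpM2l ?cmod_ge0 ?opnormP.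
move=> x; rewrite /convolution mulr_sumr; apply: eq_bigr => y _.
by rewrite ffunE mulrA.
Qed.

Let opnormZ (k : R[i]) a : opnorm (k *: a) = cmod k * opnorm a.
Proof.
apply/eqP; rewrite eq_le opnormZ_le /=.
have [->|k0] := eqVneq k 0; first by rewrite /cmod normr0 mul0r opnorm_ge0.
have ck : 0 < cmod k.
  by rewrite lt_def cmod_ge0 andbT; apply: contra_neq k0; exact: cmod_eq0.
have := opnormZ_le k^-1 (k *: a); rewrite scalerA mulVf// scale1r.
have : cmod k * cmod k^-1 = 1 by rewrite -cmodM mulfV// /cmod normr1.
move=> kk le; have := ler_wpM2l (ltW ck) le.
by rewrite mulrA kk mul1r.
Qed.

Let opnormM a b : opnorm (a * b) <= opnorm a * opnorm b.
Proof.
apply: opnorm_le => [|f]; first by rewrite mulr_ge0 ?opnorm_ge0.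
rewrite (@l2n_ext _ _ _ (convolution (a : G -> R[i]) (convolution (b : G -> R[i]) f))).
  apply: (le_trans (opnormP _ _)); rewrite -mulrA ler_wpM2l ?opnorm_ge0 ?opnormP//.
by move=> x; rewrite convolutionA; apply: convolution_ext => // z; rewrite galgM.
Qed.

(** The squared length of a f is the inner product of f and a^* a f. *)
Let opnorm_sq_le a : opnorm a ^+ 2 <= opnorm (gstar a * a).
Proof.
have g0 := opnorm_ge0 (gstar a * a).
suff le : opnorm a <= Num.sqrt (opnorm (gstar a * a)).
  have := @ler_pM _ _ _ _ _ (opnorm_ge0 a) (opnorm_ge0 a) le le.
  by rewrite -!expr2 sqr_sqrtr.
apply: opnorm_le => [|f]; first exact: sqrtr_ge0.
rewrite -(ler_pXn2r (_ : (0 < 2)%N))// ?nnegrE ?mulr_ge0 ?sqrtr_ge0 ?l2n_ge0//.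
rewrite exprMn (sqr_sqrtr g0).
rewrite [leLHS](_ : _ = cmod (\sum_x f x *
    conjc (convolution ((gstar a * a) : G -> R[i]) f x))); last first.
  rewrite sqr_l2n; apply: (@complexI R).
  rewrite cmodE.
  transitivity (\sum_x f x *
      conjc (convolution (gstar a : G -> R[i]) (convolution (a : G -> R[i]) f) x)).
    rewrite -convolution_adjoint rmorph_sum.
    by apply: eq_bigr => x _; rewrite cmod_sqr.
  have E : \sum_x f x * conjc (convolution (gstar a : G -> R[i]) (convolution (a : G -> R[i]) f) x)
      = \sum_x f x * conjc (convolution ((gstar a * a) : G -> R[i]) f x).
    apply: eq_bigr => x _; congr (_ * conjc _).
    by rewrite convolutionA; apply: convolution_ext => // z; rewrite galgM.
  rewrite E ger0_norm// -E -convolution_adjoint.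
  by apply: sumr_ge0 => x _; rewrite cmod_sqr lecR sqr_ge0.
apply: (le_trans (l2n_dot _ _)); rewrite mulrC expr2 mulrA ler_wpM2r ?l2n_ge0//.
exact: opnormP.
Qed.

Let opnorm_star_le a : opnorm a <= opnorm (gstar a).
Proof.
have := opnorm_ge0 a; rewrite le_eqVlt => /orP[/eqP<-|a0]; first exact: opnorm_ge0.
by rewrite -(ler_pM2r a0) -expr2 (le_trans (opnorm_sq_le a))// opnormM.
Qed.

Let opnorm_star_mul a : opnorm (gstar a * a) = opnorm a ^+ 2.
Proof.
have E : opnorm (gstar a) = opnorm a.
  by apply/eqP; rewrite eq_le opnorm_star_le andbT -{2}[a]gstarK opnorm_star_le.
by apply/eqP; rewrite eq_le opnorm_sq_le andbT (le_trans (opnormM _ _))// E expr2.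
Qed.

Let opnorm_complete (u : nat -> A) :
  (forall e, 0 < e -> exists N : nat, forall m n : nat,
     (N <= m)%N -> (N <= n)%N -> opnorm (u m - u n) < e) ->
  exists l, forall e, 0 < e -> exists N : nat, forall n : nat,
    (N <= n)%N -> opnorm (u n - l) < e.
Proof.
move=> cu.
have /choice[l ul] x : exists l : R[i], forall e, 0 < e -> exists N : nat, forall n : nat,
    (N <= n)%N -> cmod (u n x - l) < e.
  apply: complex_complete => e /cu[N HN]; exists N => m n Nm Nn.
  by have := opnorm_entry (u m - u n) x; rewrite !ffunE => /le_lt_trans; apply; exact: HN.
exists [ffun x => l x] => e e0.
have c0 : 0 < (#|G|%:R : R) by rewrite ltr0n; apply/card_gt0P; exists 1%g.
have e' : 0 < e / #|G|%:R by rewrite divr_gt0.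
have /choice[N HN] x : exists N : nat, forall n, (N <= n)%N -> cmod (u n x - l x) < e / #|G|%:R.
  exact: ul.
exists (\max_x N x)%N => n Nn; apply: (le_lt_trans (opnorm_le_sum _)).
apply: (@lt_le_trans _ _ (\sum_(x : G) e / #|G|%:R)).
  apply: ltr_sum => [|x _].
    by apply/hasP; exists 1%g => //; rewrite mem_index_enum.
  rewrite !ffunE; apply: HN; apply: leq_trans Nn; exact: leq_bigmax.
by rewrite sumr_const -[leLHS]mulr_natr divfK// gt_eqF.
Qed.

HB.instance Definition _ := isCstar.Build R A
  gstarD gstarZ gstarM gstarK opnorm_eq0 opnormD opnormZ opnormM
  opnorm_star_mul opnorm_complete.

Lemma galg_starE a x : (star a : A) x = conjc (a x^-1%g).
Proof. by rewrite [in LHS]/star /= ffunE. Qed.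

End GroupAlgebra.


(** * Unitary bases indexed by a finite group *)

(** For b self-adjoint, |b|^(2^n) = |b^(2^n)| <= K |f b|^(2^n) for all n. *)
Lemma bounded_below_isometric (R : realType) (A B : cstarType R) (f : A -> B) (K : R) :
  unital_star_hom f -> (forall a, cnorm a <= K * cnorm (f a)) ->
  forall a, cnorm a <= cnorm (f a).
Proof.
move=> [[fl fm fs] f1] fK.
have iter_norm (E : cstarType R) (b : E) k : star b = b ->
    star (iter k (fun x => x * x) b) = iter k (fun x => x * x) b /\
    cnorm (iter k (fun x => x * x) b) = cnorm b ^+ (2 ^ k).
  move=> bs; elim: k => [|k [IHs IHn]]; first by rewrite expn0 expr1.
  split; first by rewrite /= starM IHs.
  by rewrite /= -{1}IHs cnorm_star_mul IHn expnS mulnC exprM.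
have iter_f k b : f (iter k (fun x => x * x) b) = iter k (fun x => x * x) (f b).
  by elim: k => //= k IH; rewrite fm IH.
have selfadj b : star b = b -> cnorm b <= cnorm (f b).
  move=> bs; rewrite leNgt; apply/negP => lt.
  have := cnorm_ge0 (f b); rewrite le_eqVlt => /orP[/eqP f0|f0].
    by have := fK b; rewrite -f0 mulr0; move: lt; rewrite -f0; lra.
  have r1 : 1 < cnorm b / cnorm (f b) by rewrite ltr_pdivlMr// mul1r.
  (* the bound holds for all large exponents, in particular for a power of 2 *)
  have [n /(_ (2 ^ n)%N (ltnW (ltn_expl _ _)))] := expr_unbounded K r1.
  move=> /(_ erefl); rewrite ltNge => /negP; apply.
  rewrite expr_div_n ler_pdivrMr ?exprn_gt0//.
  have fbs : star (f b) = f b by rewrite -fs bs.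
  rewrite -(proj2 (iter_norm A b n bs)) -(proj2 (iter_norm B (f b) n fbs)).
  by rewrite -iter_f.
move=> a; rewrite -(ler_pXn2r (_ : (0 < 2)%N)) ?nnegrE ?cnorm_ge0//.
by rewrite -!cnorm_star_mul -fs -fm selfadj// starM starK.
Qed.

Section GroupBasis.
Variables (R : realType) (G : finGroupType) (A : cstarType R) (v : G -> A).
Implicit Types c d : G -> R[i].

(** A faithful representation of the group algebra, and a representation that
    identifies the algebra with the group algebra. *)
Definition free_rep := unitary_rep v /\
  forall c, \sum_x c x *: v x = 0 -> forall x, c x = 0.

Definition group_basis := free_rep /\ forall a, exists c, a = \sum_x c x *: v x.

Lemma comb_convolution c d : (forall x y, v (x * y)%g = v x * v y) ->
  (\sum_x c x *: v x) * (\sum_x d x *: v x) = \sum_x convolution c d x *: v x.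
Proof.
move=> vM; rewrite big_distrlr /=.
under [RHS]eq_bigr do rewrite /convolution scaler_suml.
rewrite [RHS]exchange_big /=; apply: eq_bigr => y _.
rewrite [RHS](reindex_inj (mulgI y)) /=; apply: eq_bigr => z _.
by rewrite mulKg vM -scalerAl -scalerAr scalerA.
Qed.

Hypothesis vfree : free_rep.

Lemma free_mulE x y : v (x * y)%g = v x * v y. Proof. by case: vfree => -[]. Qed.
Lemma free_starE x : star (v x) = v x^-1%g. Proof. by case: vfree => -[]. Qed.
Lemma free_1 : v 1%g = 1. Proof. by case: vfree => -[]. Qed.

Lemma free_cnorm1 x : cnorm (v x) = 1.
Proof. by apply: cnorm_unitary; rewrite free_starE -free_mulE mulVg free_1. Qed.

Lemma free_cnorm_le c : cnorm (\sum_x c x *: v x) <= \sum_x cmod (c x).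
Proof.
apply: (le_trans (cnorm_sum _ _ _)); apply: ler_sum => x _.
by rewrite cnormZ free_cnorm1 mulr1.
Qed.

(** Left multiplication by the element, on the span of the group, has trace
    [#|G| * c 1], and an eigenvalue of it is at most the norm of the element,
    as an eigenvector shows. This holds for any submultiplicative norm. *)
Lemma free_coef1_le c : cmod (c 1%g) <= cnorm (\sum_x c x *: v x).
Proof.
set a := \sum_x _; pose n := #|G|.
have n0 : (0 < n)%N by apply/card_gt0P; exists 1%g.
pose M : 'M[R[i]]_n := \matrix_(i, j) c (enum_val j * (enum_val i)^-1)%g.
have eig z : root (char_poly M) z -> cmod z <= cnorm a.
  rewrite -eigenvalue_root_char => /eigenvalueP[w wM w0].
  pose d x := w 0 (enum_rank x).
  have E : a * (\sum_x d x *: v x) = z *: \sum_x d x *: v x.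
    rewrite comb_convolution; last exact: free_mulE.
    rewrite scaler_sumr; apply: eq_bigr => x _; rewrite scalerA; congr (_ *: _).
    move/rowP: wM => /(_ (enum_rank x)); rewrite !mxE => <-.
    rewrite /convolution (reindex_inj invg_inj) (reindex_inj (mulIg x^-1%g)) /=.
    rewrite (reindex (@enum_val G G)) /=; last first.
      by apply: onW_bij; exact: enum_val_bij.
    apply: eq_bigr => i _; rewrite mxE enum_rankK mulrC /d.
    by rewrite invgK mulgKV enum_valK invMg invgK.
  have nz : 0 < cnorm (\sum_x d x *: v x).
    rewrite lt_def cnorm_ge0 andbT; apply/eqP => /cnorm_eq0/(proj2 vfree) d0.
    case/negP: w0; apply/eqP/rowP => i; rewrite mxE.
    by have := d0 (enum_val i); rewrite /d enum_valK.
  by rewrite -(ler_pM2r nz) -cnormZ -E cnormM.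
have [r Mr] := closed_field_poly_normal (char_poly M).
move: Mr; rewrite (monicP (char_poly_monic M)) scale1r => Mr.
have sr : size r = n.
  by have := size_char_poly M; rewrite Mr size_prod_XsubC => -[].
have tr : \tr M = \sum_(z <- r) z.
  apply: oppr_inj; rewrite -char_poly_trace// Mr -{1}sr.
  by rewrite coefPn_prod_XsubC// sr -lt0n.
have tr1 : \tr M = n%:R * c 1%g.
  rewrite /mxtrace; under eq_bigr do rewrite mxE mulgV.
  by rewrite sumr_const card_ord mulr_natl.
have n0' : 0 < n%:R :> R by rewrite ltr0n.
rewrite -(ler_pM2l n0').
have -> : n%:R * cmod (c 1%g) = cmod (\sum_(z <- r) z).
  rewrite -tr tr1 cmodM; congr (_ * _); rewrite -[n%:R in RHS](rmorph_nat (real_complex R)).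
  by rewrite cmodR ger0_norm.
apply: (le_trans (cmod_sum _ _)).
rewrite -[in leRHS]sr mulr_natl -iter_addr_0 -count_predT -big_const_seq.
rewrite [leLHS]big_seq [leRHS]big_seq; apply: ler_sum => z zr.
by apply: eig; rewrite Mr root_prod_XsubC.
Qed.

Lemma free_coef_le c x : cmod (c x) <= cnorm (\sum_y c y *: v y).
Proof.
have := free_coef1_le (fun y => c (y * x)%g); rewrite mul1g => /le_trans; apply.
rewrite -[leRHS]mulr1 -(free_cnorm1 x^-1%g).
apply: le_trans (cnormM _ _); rewrite mulr_suml [in leRHS](reindex_inj (mulIg x)) /=.
by under [in leRHS]eq_bigr do rewrite -scalerAl -free_mulE mulgK.
Qed.

Lemma free_inj c d : \sum_x c x *: v x = \sum_x d x *: v x -> c =1 d.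
Proof.
move=> cd x; apply/eqP; rewrite -subr_eq0; apply/eqP.
apply: ((proj2 vfree) (fun x => c x - d x)).
by under eq_bigr do rewrite scalerBl; rewrite sumrB cd subrr.
Qed.

(** The coefficients depend continuously on the element, so that the span is
    complete. *)
Lemma free_closed a :
  (forall e, 0 < e -> exists c, cnorm (a - \sum_x c x *: v x) < e) ->
  exists c, a = \sum_x c x *: v x.
Proof.
move=> near.
have h01 : 0 <= (2^-1 : R) < 1 by apply/andP; split; lra.
have /choice[c cE] n : exists c, cnorm (a - \sum_x c x *: v x) < 2^-1 ^+ n.
  by apply: near; rewrite exprn_gt0// invr_gt0 ltr0n.
have cE' e : 0 < e -> exists N, forall n, (N <= n)%N -> cnorm (a - \sum_x c n x *: v x) < e.
  move=> e0; have [N HN] := expr_small h01 e0; exists N => n /HN.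
  exact/lt_trans/cE.
have /choice[l lE] x : exists l : R[i], forall e, 0 < e -> exists N : nat, forall n : nat,
    (N <= n)%N -> cmod (c n x - l) < e.
  apply: complex_complete => e e0; have e2 : 0 < e / 2 by lra.
  have [N HN] := cE' _ e2; exists N => m n /HN Nm /HN Nn.
  have := free_coef_le (fun x => c m x - c n x) x.
  have -> : \sum_y (c m y - c n y) *: v y =
      (a - \sum_x c n x *: v x) - (a - \sum_x c m x *: v x).
    rewrite opprB addrAC addrCA subrr addr0 -sumrB.
    by apply: eq_bigr => y _; rewrite scalerBl.
  have := cnormD (a - \sum_x c n x *: v x) (- (a - \sum_x c m x *: v x)).
  rewrite cnormN; lra.
exists l; apply/eqP; rewrite -subr_eq0; apply/eqP; apply: cnorm_small0 => e e0.
have c0 : 0 < (#|G|.+1%:R : R) by rewrite ltr0n.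
have e' : 0 < e / #|G|.+1%:R by rewrite divr_gt0.
have /choice[N HN] x : exists N : nat, forall n, (N <= n)%N -> cmod (c n x - l x) < e / #|G|.+1%:R.
  exact: lE.
have [N' HN'] := cE' _ e'.
pose n := maxn N' (\max_x N x)%N.
have -> : a - \sum_x l x *: v x = (a - \sum_x c n x *: v x) + \sum_x (c n x - l x) *: v x.
  under [\sum_x (_ - _) *: _]eq_bigr do rewrite scalerBl.
  by rewrite sumrB addrA subrK.
apply: (le_trans (cnormD _ _)).
have := HN' n (leq_maxl _ _).
have := free_cnorm_le (fun x => c n x - l x).
have : \sum_x cmod (c n x - l x) <= e / #|G|.+1%:R * #|G|%:R.
  rewrite mulr_natr -sumr_const; apply: ler_sum => x _; apply/ltW/HN.
  apply: leq_trans (leq_maxr _ _).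
  exact: leq_bigmax.
have : e = e / #|G|.+1%:R * (#|G|%:R + 1) by rewrite natr1 divfK// gt_eqF.
rewrite mulrDr mulr1.
move: (e / _) (cnorm (a - _)) (cnorm (\sum_x _)) (\sum_x cmod _) => t p q s; lra.
Qed.

End GroupBasis.

Section Coordinates.
Variables (R : realType) (G : finGroupType) (A : cstarType R) (v : G -> A).
Hypothesis vb : group_basis v.

Lemma gbasis_free : free_rep v. Proof. by case: vb. Qed.

Lemma basis_coord : exists k : A -> G -> R[i],
  [/\ forall a, a = \sum_x k a x *: v x,
      forall x, scalar (k^~ x),
      forall x y, k (v y) x = (x == y)%:R
    & forall a x, cmod (k a x) <= cnorm a].
Proof.
have [k kE] := choice (proj2 vb); exists k; split=> //.
- move=> x c a b /=; apply: (free_inj gbasis_free (d := fun x => c * k a x + k b x)).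
  rewrite -kE {1}[a]kE {1}[b]kE scaler_sumr -big_split /=.
  by apply: eq_bigr => y _; rewrite scalerDl scalerA.
- move=> x y; apply: (free_inj gbasis_free (d := fun x => (x == y)%:R)).
  rewrite -kE (bigD1 y)//= eqxx scale1r big1 ?addr0// => z /negPf->.
  by rewrite scale0r.
- by move=> a x; rewrite {2}[a]kE; exact: (free_coef_le gbasis_free).
Qed.

Lemma basis_linear_ext (V : lmodType R[i]) (w : G -> V) :
  exists F : A -> V, linear F /\ forall x, F (v x) = w x.
Proof.
have [k [kE kl kv _]] := basis_coord.
exists (fun a => \sum_x k a x *: w x); split.
  move=> c a b; rewrite scaler_sumr -big_split /=; apply: eq_bigr => x _.
  by rewrite kl scalerDl scalerA.
move=> x; rewrite (bigD1 x)//= kv eqxx scale1r big1 ?addr0// => y yx.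
by rewrite kv (negPf yx) scale0r.
Qed.

Lemma basis_star_hom_ext (E : cstarType R) (w : G -> E) :
  (forall x y, w (x * y)%g = w x * w y) -> (forall x, star (w x) = w x^-1%g) ->
  exists F : A -> E, star_hom F /\ forall x, F (v x) = w x.
Proof.
move=> wM ws; have [F [Fl Fv]] := basis_linear_ext w; exists F; split=> //.
have Fc c : F (\sum_x c x *: v x) = \sum_x c x *: w x.
  by rewrite (lin_sum Fl); apply: eq_bigr => x _; rewrite (linZ Fl) Fv.
have vM := free_mulE gbasis_free; have vs := free_starE gbasis_free.
split=> //.
- move=> a b; have [c ->] := (proj2 vb) a; have [d ->] := (proj2 vb) b.
  by rewrite comb_convolution// !Fc comb_convolution.
- move=> a; have [c ->] := (proj2 vb) a; rewrite Fc !star_sum (lin_sum Fl).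
  by apply: eq_bigr => x _; rewrite !starZ (linZ Fl) vs Fv ws.
Qed.

Lemma basis_linear_eq (V : lmodType R[i]) (F F' : A -> V) :
  linear F -> linear F' -> (forall x, F (v x) = F' (v x)) -> F =1 F'.
Proof.
move=> Fl Fl' FF a; have [c ->] := (proj2 vb) a.
rewrite (lin_sum Fl) (lin_sum Fl'); apply: eq_bigr => x _.
by rewrite (linZ Fl) (linZ Fl') FF.
Qed.

Lemma basis_linear_bounded (B : cstarType R) (F : A -> B) :
  linear F -> exists M : R, forall a, cnorm (F a) <= M * cnorm a.
Proof.
move=> Fl; have [k [kE _ _ kn]] := basis_coord.
exists (\sum_x cnorm (F (v x))) => a; rewrite {1}[a]kE (lin_sum Fl) mulr_suml.
apply: (le_trans (cnorm_sum _ _ _)); apply: ler_sum => x _.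
by rewrite (linZ Fl) cnormZ mulrC ler_wpM2l ?cnorm_ge0.
Qed.

End Coordinates.

Definition gdelta (R : realType) (G : finGroupType) (x : G) : galg R G :=
  [ffun y => (y == x)%:R].

Lemma gdeltaE (R : realType) (G : finGroupType) (x y : G) :
  gdelta R x y = (y == x)%:R.
Proof. by rewrite ffunE. Qed.

Lemma galg_sumE (R : realType) (G : finGroupType) (c : G -> R[i]) x :
  (\sum_y c y *: gdelta R y) x = c x.
Proof.
rewrite sum_ffunE (bigD1 x)//= ffunE gdeltaE eqxx [_ *: _]mulr1.
rewrite big1 ?addr0// => y yx.
by rewrite ffunE gdeltaE eq_sym (negPf yx) [_ *: _]mulr0.
Qed.

Lemma gdelta_basis (R : realType) (G : finGroupType) : group_basis (@gdelta R G).
Proof.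
split; last first.
  by move=> a; exists a; apply/ffunP => x; rewrite galg_sumE.
split; last by move=> c c0 x; rewrite -(galg_sumE c x) c0 ffunE.
split.
- by apply/ffunP => x; rewrite galg1.
- move=> x y; apply/ffunP => z; rewrite galgM gdeltaE.
  rewrite (@convolution_ext _ _ _ (fun w => (w == x)%:R) _ (gdelta R y))// => [|w].
    by rewrite convolution_delta gdeltaE -(inj_eq (mulgI x^-1%g)) mulKg.
  by rewrite gdeltaE.
- move=> x; apply/ffunP => z; rewrite galg_starE !gdeltaE.
  by rewrite -(inj_eq invg_inj) invgK; case: eqP; rewrite ?conjc1 ?conjc0.
Qed.

(** The norm is at most [#|G|] times that of any faithful representation, since
    the coefficients are; the factor disappears by [bounded_below_isometric]. *)
Lemma galg_cnorm_le (R : realType) (G : finGroupType) (A : cstarType R)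
    (v : G -> A) (c : G -> R[i]) :
  free_rep v ->
  cnorm (\sum_x c x *: gdelta R x) <= cnorm (\sum_x c x *: v x).
Proof.
move=> vf; have db := @gdelta_basis R G.
have vM := free_mulE vf; have vs := free_starE vf.
have [F [Fh Fv]] := basis_star_hom_ext db vM vs.
have Fu : unital_star_hom F.
  by split=> //; rewrite -(free_1 (gbasis_free db)) Fv free_1.
have Fc d : F (\sum_x d x *: gdelta R x) = \sum_x d x *: v x.
  have Fl := star_hom_lin Fh.
  by rewrite (lin_sum Fl); apply: eq_bigr => x _; rewrite (linZ Fl) Fv.
rewrite -Fc; apply: (bounded_below_isometric (K := #|G|%:R) Fu) => a.
have [d ->] := proj2 db a; rewrite Fc.
apply: (le_trans (free_cnorm_le (gbasis_free db) _)).
rewrite mulr_natl -sumr_const; apply: ler_sum => x _; exact: free_coef_le.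
Qed.

(** The finite-dimensional algebras that occur are all of this form, which is
    stable under direct sums of an algebra with itself and tensor products. *)
Definition group_like (R : realType) (A : cstarType R) : Prop :=
  exists (G : finGroupType) (v : G -> A), group_basis v.

(** The group algebra of Z/2 is C^2, so Q (+) Q has a basis indexed by the
    product of the group with Z/2. *)
Lemma group_like_prod (R : realType) (Q : cstarType R) :
  group_like Q -> group_like (Q * Q)%type.
Proof.
move=> [G [v vb]]; have vf := gbasis_free vb.
pose sg (e : 'Z_2) : R[i] := (-1) ^+ e.
exists (G * 'Z_2)%type, (fun p => (v p.1, sg p.2 *: v p.1)).
have sumE (c : G * 'Z_2 -> R[i]) : \sum_p c p *: (v p.1, sg p.2 *: v p.1) =
   (\sum_x (c (x, 0) + c (x, 1)) *: v x, \sum_x (c (x, 0) - c (x, 1)) *: v x).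
  transitivity (\sum_x \sum_(e : 'Z_2) c (x, e) *: (v x, sg e *: v x)).
    by rewrite pair_bigA /=; apply: eq_bigr => -[x e].
  rewrite [LHS]surjective_pairing !raddf_sum /=; congr pair; apply: eq_bigr => x _.
    by rewrite raddf_sum big_ord_recl big_ord1 /= -scalerDl (_ : lift _ _ = 1)//; exact: val_inj.
  rewrite raddf_sum big_ord_recl big_ord1 /= /sg expr0 scale1r expr1 scaleN1r scalerN.
  by rewrite -scalerBl (_ : lift _ _ = 1)//; exact: val_inj.
split; [split; first split|].
- by rewrite free_1// /sg expr0 scale1r.
- move=> [x e] [y f]; congr pair; rewrite /= (free_mulE vf)//.
  rewrite -scalerAl -scalerAr scalerA; congr (_ *: _).
  rewrite /sg -exprD -[RHS]signr_odd -[LHS]signr_odd.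
  by case: e f => [[|[|//]] ei] [[|[|//]] fi].
- move=> [x e]; congr pair; rewrite /= ?starZ (free_starE vf)//; congr (_ *: _).
  rewrite /sg rmorphXn rmorphN1 -[LHS]signr_odd -[RHS]signr_odd.
  by case: e => [[|[|//]] ei].
- move=> c; rewrite sumE => -[/(proj2 vf) cp /(proj2 vf) cm] [x e].
  have c0 : c (x, 0) = 0.
    have : (c (x, 0) + c (x, 1)) + (c (x, 0) - c (x, 1)) = 0 by rewrite cp cm addr0.
    rewrite addrACA subrr addr0 -mulr2n -mulr_natl => /eqP.
    by rewrite mulf_eq0 pnatr_eq0 => /eqP.
  have c1 : c (x, 1) = 0 by have := cp x; rewrite /= c0 add0r.
  by case: e => [[|[|//]] ei]; [rewrite -[RHS]c0|rewrite -[RHS]c1];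
    congr c; congr pair; exact: val_inj.
- move=> [a b]; have [al ->] := proj2 vb a; have [be ->] := proj2 vb b.
  exists (fun p => 2^-1 * (al p.1 + sg p.2 * be p.1)).
  rewrite sumE; congr pair; apply: eq_bigr => x _; congr (_ *: _);
    rewrite /sg /= expr0 expr1; by field.
Qed.

(** * Minimal tensor products *)

Section TensorTheory.
Variables (R : realType) (A B : cstarType R) (T : min_tensor A B).
Local Notation l := (inl_tensor T).
Local Notation r := (inr_tensor T).

Lemma inl_hom : unital_star_hom l. Proof. by case: (min_tensorP T) => -[]. Qed.
Lemma inr_hom : unital_star_hom r. Proof. by case: (min_tensorP T) => -[]. Qed.
Lemma inl_inrC a b : l a * r b = r b * l a.
Proof. by case: (min_tensorP T) => -[]. Qed.
Lemma inl1 : l 1 = 1. Proof. by case: inl_hom. Qed.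
Lemma inr1 : r 1 = 1. Proof. by case: inr_hom. Qed.

Lemma inlE a : l a = tensor T a 1. Proof. by rewrite /tensor inr1 mulr1. Qed.
Lemma inrE b : r b = tensor T 1 b. Proof. by rewrite /tensor inl1 mul1r. Qed.

Lemma tensor11 : tensor T 1 1 = 1. Proof. by rewrite -inlE inl1. Qed.

Lemma tensorM a b a' b' :
  tensor T a b * tensor T a' b' = tensor T (a * a') (b * b').
Proof.
rewrite /tensor (star_homM (proj1 inl_hom)) (star_homM (proj1 inr_hom)).
by rewrite mulrA -(mulrA (l a)) -inl_inrC !mulrA.
Qed.

Lemma tensor_star a b : star (tensor T a b) = tensor T (star a) (star b).
Proof.
rewrite /tensor starM inl_inrC.
by rewrite -(star_homJ (proj1 inl_hom)) -(star_homJ (proj1 inr_hom)).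
Qed.

Lemma tensor_linl b : linear (tensor T ^~ b).
Proof.
move=> c x y; have lz := star_hom_lin (proj1 inl_hom).
by rewrite /tensor lz mulrDl scalerAl.
Qed.

Lemma tensor_linr a : linear (tensor T a).
Proof.
move=> c x y; have lz := star_hom_lin (proj1 inr_hom).
by rewrite /tensor lz mulrDr scalerAr.
Qed.

Lemma tensor0l b : tensor T 0 b = 0. Proof. exact: lin0 (tensor_linl b). Qed.
Lemma tensor0r a : tensor T a 0 = 0. Proof. exact: lin0 (tensor_linr a). Qed.
Lemma tensorDl a a' b : tensor T (a + a') b = tensor T a b + tensor T a' b.
Proof. exact: linD (tensor_linl b) _ _. Qed.
Lemma tensorDr a b b' : tensor T a (b + b') = tensor T a b + tensor T a b'.
Proof. exact: linD (tensor_linr a) _ _. Qed.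
Lemma tensorZl c a b : tensor T (c *: a) b = c *: tensor T a b.
Proof. exact: linZ (tensor_linl b) _ _. Qed.
Lemma tensorZr c a b : tensor T a (c *: b) = c *: tensor T a b.
Proof. exact: linZ (tensor_linr a) _ _. Qed.

End TensorTheory.

Section TensorHom.
Variables (R : realType) (A B E : cstarType R) (T : min_tensor A B).
Variables (f : A -> E) (g : B -> E) (F : T -> E).
Hypothesis Fh : tensor_hom f g F.

Lemma tensor_hom_tensor a b : F (tensor T a b) = f a * g b.
Proof. by case: Fh. Qed.

Lemma tensor_hom_lin : linear F. Proof. by case: Fh => /star_hom_lin. Qed.

Lemma tensor_hom_unital : f 1 = 1 -> g 1 = 1 -> unital_star_hom F.
Proof.
case: Fh => Fs FE f1 g1; split=> //.
by rewrite -(tensor11 T) FE f1 g1 mulr1.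
Qed.

End TensorHom.

Section BasisPair.
Variables (R : realType) (G G' : finGroupType) (A B : cstarType R).
Variables (v : G -> A) (v' : G' -> B).
Hypotheses (vb : group_basis v) (vb' : group_basis v').

(** The scalars are the coordinates of the element of the algebraic tensor
    product that the list of pairs stands for. *)
Lemma bilinear_expand (s : seq (A * B)) : exists c : G * G' -> R[i],
  forall (V : lmodType R[i]) (f : A -> B -> V),
    (forall a, linear (f a)) -> (forall b, linear (f ^~ b)) ->
    \sum_(p <- s) f p.1 p.2 = \sum_q c q *: f (v q.1) (v' q.2).
Proof.
have [k [kE _ _ _]] := basis_coord vb; have [k' [kE' _ _ _]] := basis_coord vb'.
exists (fun q => \sum_(p <- s) k p.1 q.1 * k' p.2 q.2) => V f fr fl.
under [RHS]eq_bigr do rewrite scaler_suml; rewrite exchange_big /=.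
apply: eq_bigr => -[a b] _ /=.
rewrite {1}[a]kE {1}[b]kE' (lin_sum (fl _)).
rewrite -(pair_bigA _ (fun x y => (k a x * k' b y) *: f (v x) (v' y))) /=.
apply: eq_bigr => x _; rewrite (linZ (fl _)) (lin_sum (fr _)) scaler_sumr.
by apply: eq_bigr => y _; rewrite (linZ (fr _)) scalerA.
Qed.

Lemma bilinear_eq (V : lmodType R[i]) (f g : A -> B -> V) :
  (forall a, linear (f a)) -> (forall b, linear (f ^~ b)) ->
  (forall a, linear (g a)) -> (forall b, linear (g ^~ b)) ->
  (forall x y, f (v x) (v' y) = g (v x) (v' y)) -> forall a b, f a b = g a b.
Proof.
move=> fr fl gr gl fg a b; have [c cE] := bilinear_expand [:: (a, b)].
have := cE V f fr fl; have := cE V g gr gl; rewrite !big_seq1 /= => -> ->.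
by apply: eq_bigr => q _; rewrite fg.
Qed.

Lemma tensor_eval_expand s : exists2 c : G * G' -> R[i],
  forall (T : cstarType R) (i : A -> T) (j : B -> T),
    unital_star_hom i -> unital_star_hom j ->
    tensor_eval i j s = \sum_q c q *: (i (v q.1) * j (v' q.2)) &
  (forall q, c q = 0) -> tensor_zero s.
Proof.
have [c cE] := bilinear_expand s; exists c.
  move=> T i j [/star_hom_lin il _] [/star_hom_lin jl _].
  apply: (cE _ (fun a b => i a * j b)).
    by move=> a t x y; rewrite jl mulrDr scalerAr.
  by move=> b t x y; rewrite il mulrDl scalerAl.
move=> c0 beta br bl; rewrite (cE R[i]^o beta)// big1// => q _.
by rewrite c0 scale0r.
Qed.

Section Embedding.
Variables (T : cstarType R) (i : A -> T) (j : B -> T).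
Hypotheses (ih : unital_star_hom i) (jh : unital_star_hom j).
Hypothesis ijC : forall a b, i a * j b = j b * i a.

Lemma embedding_unitary_rep : unitary_rep (fun q : G * G' => i (v q.1) * j (v' q.2)).
Proof.
have [vf vf'] := (gbasis_free vb, gbasis_free vb').
have [[_ im iS] i1] := ih; have [[_ jm jS] j1] := jh; split=> /=.
- by rewrite !free_1// i1 j1 mulr1.
- move=> x y; rewrite !free_mulE// im jm -!mulrA; congr (_ * _).
  by rewrite !mulrA ijC.
- by move=> x; rewrite starM ijC -iS -jS !free_starE.
Qed.

Lemma embedding_free : (forall s, tensor_eval i j s = 0 -> tensor_zero s) ->
  free_rep (fun q : G * G' => i (v q.1) * j (v' q.2)).
Proof.
move=> inj; split; first exact: embedding_unitary_rep.
move=> c c0 q.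
have [k [_ kl kv _]] := basis_coord vb; have [k' [_ kl' kv' _]] := basis_coord vb'.
pose s := [seq (c p *: v p.1, v' p.2) | p <- index_enum (G * G')%type].
have /inj s0 : tensor_eval i j s = 0.
  rewrite /tensor_eval big_map -[RHS]c0; apply: eq_bigr => p _ /=.
  by rewrite (linZ (star_hom_lin (proj1 ih))) scalerAl.
have := s0 (fun a b => k a q.1 * k' b q.2).
rewrite big_map /= (bigD1 q)//= (linZ (kl _)) kv kv' !eqxx mulr1 [_ *: _]mulr1.
rewrite big1 => [|p pq]; [rewrite addr0; apply|].
- by move=> a t x y /=; rewrite kl' mulrDr mulrCA.
- by move=> b t x y /=; rewrite kl mulrDl mulrA.
- rewrite (linZ (kl _)) kv kv'; move: pq; rewrite -pair_eqE /pair_eq negb_and.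
  by rewrite !(eq_sym (q.1)) !(eq_sym (q.2)) => /orP[] /negPf->;
    rewrite ?mulr0// [_ *: _]mulr0 mul0r.
Qed.

End Embedding.

(** The algebraic tensor product has finite dimension, so it is closed in the
    minimal one. *)
Lemma tensor_basis (T : min_tensor A B) :
  group_basis (fun q : G * G' => tensor T (v q.1) (v' q.2)).
Proof.
have [[hi hj ijC inj] dT _] := min_tensorP T.
have fr : free_rep (fun q : G * G' => tensor T (v q.1) (v' q.2)).
  exact: embedding_free.
split=> // a; apply: free_closed => // e /(dT a)[_ [s _ <-] lt].
have [c cE _] := tensor_eval_expand s.
by exists c; rewrite -cE.
Qed.

(** The group algebra of the product group; its norm is minimal because every
    embedding of the algebraic tensor product gives a free representation of
    the product group. *)
Lemma min_tensor_of_bases : inhabited (min_tensor A B).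
Proof.
have [vf vf'] := (gbasis_free vb, gbasis_free vb').
pose d := @gdelta R (G * G')%type.
have db : group_basis d := gdelta_basis _ _; have df := gbasis_free db.
have [i [ih iv]] := @basis_star_hom_ext _ _ _ _ vb _ (fun x => d (x, 1%g))
  (fun x y => ltac:(by rewrite -(free_mulE df) /= ; congr d; congr pair; rewrite /= mulg1))
  (fun x => ltac:(by rewrite (free_starE df); congr d; congr pair; rewrite /= invg1)).
have [j [jh jv]] := @basis_star_hom_ext _ _ _ _ vb' _ (fun y => d (1%g, y))
  (fun x y => ltac:(by rewrite -(free_mulE df) /= ; congr d; congr pair; rewrite /= mulg1))
  (fun x => ltac:(by rewrite (free_starE df); congr d; congr pair; rewrite /= invg1)).
have iu : unital_star_hom i by split=> //; rewrite -(free_1 vf) iv -(free_1 df).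
have ju : unital_star_hom j by split=> //; rewrite -(free_1 vf') jv -(free_1 df).
have ij x y : i (v x) * j (v' y) = d (x, y).
  by rewrite iv jv -(free_mulE df); congr d; congr pair; rewrite /= ?mulg1 ?mul1g.
have ji x y : j (v' y) * i (v x) = d (x, y).
  by rewrite iv jv -(free_mulE df); congr d; congr pair; rewrite /= ?mulg1 ?mul1g.
have [il jl] := (star_hom_lin ih, star_hom_lin jh).
have ijC a b : i a * j b = j b * i a.
  apply: (@bilinear_eq _ (fun a b => i a * j b) (fun a b => j b * i a)).
  - by move=> t c x y; rewrite jl mulrDr scalerAr.
  - by move=> t c x y; rewrite il mulrDl scalerAl.
  - by move=> t c x y; rewrite jl mulrDl scalerAl.
  - by move=> t c x y; rewrite il mulrDr scalerAr.
  - by move=> x y; rewrite ij ji.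
suff H : is_min_tensor i j by exact: inhabits (MinTensor H).
split.
- split=> // s; have [c cE c0] := tensor_eval_expand s.
  rewrite (cE _ _ _ iu ju); under eq_bigr do rewrite ij -surjective_pairing.
  by move=> /(proj2 df); exact: c0.
- move=> a e e0; exists a; last by rewrite subrr cnorm0.
  have [c ->] := proj2 db a.
  exists [seq (c p *: v p.1, v' p.2) | p <- index_enum (G * G')%type] => //.
  rewrite /tensor_eval big_map; apply: eq_bigr => -[x y] _ /=.
  by rewrite (linZ il) -scalerAl ij.
- move=> T' i' j' [ih' jh' ijC' inj'] s.
  have [c cE _] := tensor_eval_expand s.
  rewrite (cE _ _ _ iu ju) (cE _ _ _ ih' jh'); under eq_bigr do rewrite ij -surjective_pairing.
  exact: galg_cnorm_le (embedding_free ih' jh' ijC' inj').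
Qed.

Variable T : min_tensor A B.

Lemma tensor_linear_eq_basis (V : lmodType R[i]) (F F' : T -> V) :
  linear F -> linear F' -> (forall a b, F (tensor T a b) = F' (tensor T a b)) ->
  F =1 F'.
Proof.
by move=> Fl Fl' FF; apply: (basis_linear_eq (tensor_basis T)) => // q; exact: FF.
Qed.

Lemma tensor_hom_of_bases (E : cstarType R) (f : A -> E) (g : B -> E) :
  star_hom f -> star_hom g -> (forall a b, f a * g b = g b * f a) ->
  exists F : T -> E, tensor_hom f g F.
Proof.
move=> [fl fm fs] [gl gm gs] fg.
have [vf vf'] := (gbasis_free vb, gbasis_free vb').
pose w (q : G * G') := f (v q.1) * g (v' q.2).
have wM x y : w (x * y)%g = w x * w y.
  by rewrite /w /= !free_mulE// fm gm mulrA -(mulrA (f _)) fg !mulrA.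
have ws x : star (w x) = w x^-1%g.
  by rewrite /w /= -!free_starE// starM -fs -gs fg.
have [F [Fh Fv]] := basis_star_hom_ext (tensor_basis T) wM ws.
exists F; split=> //; have Fl := star_hom_lin Fh.
apply: bilinear_eq => //=.
- by move=> a t x y; rewrite tensor_linr Fl.
- by move=> b t x y; rewrite tensor_linl Fl.
- by move=> a t x y; rewrite gl mulrDr scalerAr.
- by move=> b t x y; rewrite fl mulrDl scalerAl.
- by move=> x y; rewrite (Fv (x, y)).
Qed.

Lemma slice_of_bases (tau : A -> R[i]) : scalar tau ->
  exists L : T -> B, [/\ linear L, exists M : R, forall z, cnorm (L z) <= M * cnorm z &
    forall a b, L (tensor T a b) = tau a *: b].
Proof.
move=> tl.
have [L [Ll Lv]] := basis_linear_ext (tensor_basis T) (fun q => tau (v q.1) *: v' q.2).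
exists L; split=> //; first exact: (basis_linear_bounded (tensor_basis T)).
apply: bilinear_eq => //=.
- by move=> a t x y; rewrite tensor_linr Ll.
- by move=> b t x y; rewrite tensor_linl Ll.
- by move=> a t x y; rewrite scalerDr !scalerA mulrC.
- by move=> b t x y; rewrite tl scalerDl scalerA.
- by move=> x y; rewrite (Lv (x, y)).
Qed.


End BasisPair.

Section GroupLike.
Variables (R : realType) (A B : cstarType R).
Hypotheses (hA : group_like A) (hB : group_like B).

Lemma group_like_min_tensor : inhabited (min_tensor A B).
Proof. by case: hA => G [v vb]; case: hB => G' [v' vb']; exact: min_tensor_of_bases vb vb'. Qed.

Variable T : min_tensor A B.

Lemma group_like_tensor : group_like T.
Proof.
case: hA => G [v vb]; case: hB => G' [v' vb'].
by exists (G * G')%type, (fun q => tensor T (v q.1) (v' q.2)); exact: tensor_basis.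
Qed.

Lemma tensor_linear_eq (V : lmodType R[i]) (F F' : T -> V) :
  linear F -> linear F' -> (forall a b, F (tensor T a b) = F' (tensor T a b)) ->
  F =1 F'.
Proof.
case: hA => G [v vb]; case: hB => G' [v' vb']; exact: tensor_linear_eq_basis vb vb' _ _ _ _.
Qed.

Lemma tensor_hom_ex (E : cstarType R) (f : A -> E) (g : B -> E) :
  star_hom f -> star_hom g -> (forall a b, f a * g b = g b * f a) ->
  exists F : T -> E, tensor_hom f g F.
Proof.
case: hA => G [v vb]; case: hB => G' [v' vb']; exact: tensor_hom_of_bases vb vb' _ _ _ _.
Qed.

Lemma slice_ex (tau : A -> R[i]) : scalar tau ->
  exists L : T -> B, [/\ linear L, exists M : R, forall z, cnorm (L z) <= M * cnorm z &
    forall a b, L (tensor T a b) = tau a *: b].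
Proof.
case: hA => G [v vb]; case: hB => G' [v' vb']; exact: slice_of_bases vb vb' _ _.
Qed.

End GroupLike.

(** When the algebras are group algebras the homomorphisms in the coaction law
    exist, so that only their equality has to be checked. *)
Lemma coaction_lawP (R : realType) (B Q : cstarType R) (BQ : min_tensor B Q)
    (QQ : min_tensor Q Q) (al : B -> BQ) (De : Q -> QQ) :
  group_like B -> group_like Q -> unital_star_hom al -> unital_star_hom De ->
  (forall (T : min_tensor BQ Q) (F G : BQ -> T) (H : QQ -> T),
    tensor_hom (inl_tensor T \o al) (inr_tensor T) F ->
    tensor_hom (inl_tensor T \o inr_tensor BQ) (inr_tensor T) H ->
    tensor_hom (inl_tensor T \o inl_tensor BQ) (H \o De) G ->
    forall b, F (al b) = G (al b)) ->
  coaction_law al De.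
Proof.
move=> gB gQ alu Deu HH.
have gBQ := group_like_tensor gB gQ BQ.
have [T] := group_like_min_tensor gBQ gQ.
have [lu ru] := (inl_hom T, inr_hom T).
have [F hF] := tensor_hom_ex gB gQ BQ (star_hom_comp (proj1 lu) (proj1 alu)) (proj1 ru)
  (fun a b => inl_inrC T _ _).
have [H hH] := tensor_hom_ex gQ gQ QQ (star_hom_comp (proj1 lu) (proj1 (inr_hom BQ))) (proj1 ru)
  (fun a b => inl_inrC T _ _).
have lHC b z : inl_tensor T (inl_tensor BQ b) * H z = H z * inl_tensor T (inl_tensor BQ b).
  have Hl := tensor_hom_lin hH; move: z; apply: (tensor_linear_eq gQ gQ).
  - by move=> t x y; rewrite Hl mulrDr scalerAr.
  - by move=> t x y; rewrite Hl mulrDl scalerAl.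
  move=> c d; rewrite (tensor_hom_tensor hH) /= mulrA -[RHS]mulrA -[in RHS](inl_inrC T).
  rewrite mulrA -!(star_homM (proj1 lu)).
  by rewrite (inl_inrC BQ).
have [G hG] := tensor_hom_ex gB gQ BQ (star_hom_comp (proj1 lu) (proj1 (inl_hom BQ)))
  (star_hom_comp (proj1 hH) (proj1 Deu)) (fun b q => lHC b (De q)).
by exists T, F, G, H; split=> //; exact: (HH T F G H).
Qed.

(** * The doubled group algebra *)

Section Span.
Variables (R : realType) (A : cstarType R) (X : set A).

Lemma lspan_incl a : X a -> lspan X a.
Proof.
by move=> Xa; exists 1%N, (fun=> 1), (fun=> a); split=> //; rewrite big_ord1 scale1r.
Qed.

Lemma lspan0 : lspan X 0.
Proof.
exists 0%N, (fun=> 0), (fun=> 0); split; first by case.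
by rewrite big_ord0.
Qed.

Lemma lspanD a b : lspan X a -> lspan X b -> lspan X (a + b).
Proof.
move=> [n [c [x [Xx ->]]]] [m [d [y [Xy ->]]]].
exists (n + m)%N, (fun k => match fintype.split k with inl i => c i | inr j => d j end),
  (fun k => match fintype.split k with inl i => x i | inr j => y j end).
split; first by move=> k; case: (fintype.split k).
rewrite big_split_ord /=; congr (_ + _); apply: eq_bigr => i _.
  by rewrite (unsplitK (inl i)).
by rewrite (unsplitK (inr i)).
Qed.

Lemma lspanZ c a : lspan X a -> lspan X (c *: a).
Proof.
move=> [n [d [x [Xx ->]]]]; exists n, (fun k => c * d k), x; split=> //.
by rewrite scaler_sumr; apply: eq_bigr => i _; rewrite scalerA.
Qed.

Lemma lspan_sum (I : Type) (r : seq I) (F : I -> A) :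
  (forall i, lspan X (F i)) -> lspan X (\sum_(i <- r) F i).
Proof.
move=> XF; elim/big_rec: _ => [|i a _ Xa]; first exact: lspan0.
exact: lspanD.
Qed.

End Span.

Lemma dense_of_tensors (R : realType) (A B : cstarType R) (T : min_tensor A B)
    (X : set T) :
  (forall a b, lspan X (tensor T a b)) -> cdense (lspan X).
Proof.
move=> XT a e e0; have [_ dT _] := min_tensorP T.
have [_ [s _ <-] lt] := dT a e e0; exists (tensor_eval (inl_tensor T) (inr_tensor T) s) => //.
by apply: lspan_sum => -[x y]; exact: XT.
Qed.

Section FullGroupAlgebra.
Variables (R : realType) (gT : finGroupType).

(** The group algebra has the universal property too, and the universal
    homomorphisms in the two directions are inverse to each other. *)
Lemma full_group_basis (Q : cqg R) (lam : gT -> Q) :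
  is_full_group_cqg lam -> group_basis lam.
Proof.
move=> [lu univ _]; pose d := @gdelta R gT.
have db : group_basis d := gdelta_basis _ _; have df := gbasis_free db.
have [[f [fh f1] fl] _] := univ _ d (proj1 df).
have [l1 lM ls] := lu.
have [F [Fh Fd]] := basis_star_hom_ext db lM (fun x => ls x).
have Fu : unital_star_hom F by split=> //; rewrite -(free_1 df) Fd.
have FK q : F (f q) = q.
  have [_ /(_ (F \o f) id)] := univ Q lam lu; apply=> //.
    by apply: unital_star_hom_comp.
  by move=> x /=; rewrite fl Fd.
have fc c : f (\sum_x c x *: lam x) = \sum_x c x *: d x.
  by rewrite (lin_sum (star_hom_lin fh)); apply: eq_bigr => x _;
    rewrite (linZ (star_hom_lin fh)) fl.
split; first split=> //.
  by move=> c c0; apply: (proj2 df); rewrite -fc c0 (lin0 (star_hom_lin fh)).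
move=> q; have [c cE] := proj2 db (f q); exists c.
rewrite -[LHS]FK cE (lin_sum (star_hom_lin Fh)); apply: eq_bigr => x _.
by rewrite (linZ (star_hom_lin Fh)) Fd.
Qed.

Lemma group_basis_universal (Q : cstarType R) (lam : gT -> Q) (A : cstarType R)
    (u : gT -> A) : group_basis lam -> unitary_rep u ->
  (exists2 f : Q -> A, unital_star_hom f & forall x, f (lam x) = u x)
  /\ (forall f f' : Q -> A, unital_star_hom f -> unital_star_hom f' ->
        (forall x, f (lam x) = u x) -> (forall x, f' (lam x) = u x) -> f =1 f').
Proof.
move=> lb [u1 uM us]; split.
  have [f [fh fl]] := basis_star_hom_ext lb uM us; exists f => //.
  by split=> //; rewrite -(free_1 (gbasis_free lb)) fl u1.
move=> f f' [[fl _ _] _] [[fl' _ _] _] E E'.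
by apply: (basis_linear_eq lb) => // x; rewrite E E'.
Qed.

Lemma group_cqg_ex : exists (Q : cqg R) (lam : gT -> Q), is_full_group_cqg lam.
Proof.
pose A : cstarType R := galg R gT; pose d : gT -> A := @gdelta R gT.
have db : group_basis d := gdelta_basis _ _; have df := gbasis_free db.
have gA : group_like A by exists gT, d.
have [T] := group_like_min_tensor gA gA.
pose w x := tensor T (d x) (d x).
have wM x y : w (x * y)%g = w x * w y by rewrite /w tensorM free_mulE.
have ws x : star (w x) = w x^-1%g by rewrite /w tensor_star free_starE.
have [De [Deh Ded]] := basis_star_hom_ext db wM ws.
have Deu : unital_star_hom De.
  by split=> //; rewrite -(free_1 df) Ded /w free_1// tensor11.
have Del := star_hom_lin Deh.
have coass : coaction_law De De.
  apply: (coaction_lawP gA gA) => // T3 F G H hF hH hG.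
  have [Fl Gl] := (tensor_hom_lin hF, tensor_hom_lin hG).
  apply: (basis_linear_eq db).
  - by move=> c x y; rewrite Del Fl.
  - by move=> c x y; rewrite Del Gl.
  move=> x; rewrite Ded (tensor_hom_tensor hF) (tensor_hom_tensor hG) /= Ded.
  rewrite (tensor_hom_tensor hH) /= mulrA.
  by rewrite -(star_homM (proj1 (inl_hom T3))).
have expand a : exists c : gT -> R[i], a = \sum_x c x *: d x := proj2 db a.
have dl : cdense (lspan [set z | exists a b, z = De a * tensor T 1 b]%classic).
  apply: dense_of_tensors => a b; have [c ->] := expand a.
  rewrite (lin_sum (tensor_linl T b)); apply: lspan_sum => x.
  rewrite tensorZl; apply: lspanZ; apply: lspan_incl.
  exists (d x), (d x^-1%g * b); rewrite Ded /w tensorM mulr1 mulrA.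
  by rewrite -free_mulE// mulgV free_1// mul1r.
have dr : cdense (lspan [set z | exists a b, z = De a * tensor T b 1]%classic).
  apply: dense_of_tensors => b a; have [c ->] := expand a.
  rewrite (lin_sum (tensor_linr T b)); apply: lspan_sum => x.
  rewrite tensorZr; apply: lspanZ; apply: lspan_incl.
  exists (d x), (d x^-1%g * b); rewrite Ded /w tensorM mulr1 mulrA.
  by rewrite -free_mulE// mulgV free_1// mul1r.
exists (Cqg (CqgStructure Deu coass dl dr)), d; split.
- exact: (proj1 df).
- by move=> E u; exact: group_basis_universal.
- exact: Ded.
Qed.

End FullGroupAlgebra.

Section DoubledAlgebra.
Variables (R : realType) (gT : finGroupType) (Q : cstarType R) (lam : gT -> Q).
Hypothesis lb : group_basis lam.
Let lf := gbasis_free lb.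

(** The images of the group elements under xi and eta. *)
Definition xi_lam (x : gT) : (Q * Q)%type := (lam x, 0).
Definition eta_lam (x : gT) : (Q * Q)%type := (0, lam x).

Lemma xi_xi x y : xi_lam x * xi_lam y = xi_lam (x * y)%g.
Proof. by congr pair; rewrite /= ?mulr0// free_mulE. Qed.
Lemma eta_eta x y : eta_lam x * eta_lam y = eta_lam (x * y)%g.
Proof. by congr pair; rewrite /= ?mulr0// free_mulE. Qed.
Lemma xi_eta0 x y : xi_lam x * eta_lam y = 0.
Proof. by congr pair; rewrite /= ?mulr0 ?mul0r. Qed.
Lemma eta_xi0 x y : eta_lam x * xi_lam y = 0.
Proof. by congr pair; rewrite /= ?mulr0 ?mul0r. Qed.
Lemma xi_star x : star (xi_lam x) = xi_lam x^-1%g.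
Proof. by congr pair; rewrite /= ?star0// free_starE. Qed.
Lemma eta_star x : star (eta_lam x) = eta_lam x^-1%g.
Proof. by congr pair; rewrite /= ?star0// free_starE. Qed.
Lemma xi_eta1 : xi_lam 1%g + eta_lam 1%g = 1.
Proof. by congr pair; rewrite /= ?addr0 ?add0r free_1. Qed.

Lemma double_expand (d : (Q * Q)%type) : exists c c' : gT -> R[i],
  d = \sum_x (c x *: xi_lam x + c' x *: eta_lam x).
Proof.
case: d => a b; have [c ->] := proj2 lb a; have [c' ->] := proj2 lb b.
exists c, c'; rewrite [RHS]surjective_pairing !raddf_sum; congr pair;
  by apply: eq_bigr => x _; rewrite /= scaler0 ?addr0 ?add0r.
Qed.

Lemma double_linear_eq (V : lmodType R[i]) (F F' : (Q * Q)%type -> V) :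
  linear F -> linear F' -> (forall x, F (xi_lam x) = F' (xi_lam x)) ->
  (forall x, F (eta_lam x) = F' (eta_lam x)) -> F =1 F'.
Proof.
move=> Fl Fl' FX FY d; have [c [c' ->]] := double_expand d.
rewrite (lin_sum Fl) (lin_sum Fl'); apply: eq_bigr => x _.
by rewrite (linD Fl) (linD Fl') !(linZ Fl) !(linZ Fl') FX FY.
Qed.

Lemma double_hom_ex (E : cstarType R) (p q : gT -> E) :
  (forall x y, p (x * y)%g = p x * p y) -> (forall x y, q (x * y)%g = q x * q y) ->
  (forall x y, p x * q y = 0) -> (forall x y, q x * p y = 0) ->
  (forall x, star (p x) = p x^-1%g) -> (forall x, star (q x) = q x^-1%g) ->
  p 1%g + q 1%g = 1 ->
  exists F : (Q * Q)%type -> E, [/\ unital_star_hom F, forall x, F (xi_lam x) = p x &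
    forall x, F (eta_lam x) = q x].
Proof.
move=> pM qM pq qp ps qs pq1.
have [f [[fl fm fs] fE]] := basis_star_hom_ext lb pM ps.
have [k [[kl km ks] kE]] := basis_star_hom_ext lb qM qs.
have fk a b : f a * k b = 0.
  apply: (bilinear_eq lb lb (f := fun a b => f a * k b) (g := fun _ _ => 0)).
  - by move=> x c y z; rewrite kl mulrDr scalerAr.
  - by move=> x c y z; rewrite fl mulrDl scalerAl.
  - by move=> x c y z; rewrite scaler0 addr0.
  - by move=> x c y z; rewrite scaler0 addr0.
  - by move=> x y; rewrite fE kE pq.
have kf a b : k a * f b = 0.
  apply: (bilinear_eq lb lb (f := fun a b => k a * f b) (g := fun _ _ => 0)).
  - by move=> x c y z; rewrite fl mulrDr scalerAr.
  - by move=> x c y z; rewrite kl mulrDl scalerAl.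
  - by move=> x c y z; rewrite scaler0 addr0.
  - by move=> x c y z; rewrite scaler0 addr0.
  - by move=> x y; rewrite fE kE qp.
exists (fun d => f d.1 + k d.2); split.
- split; last by rewrite /= -(free_1 lf) fE kE.
  split.
  + by move=> c x y; rewrite /= fl kl scalerDr addrACA.
  + by move=> x y; rewrite /= fm km mulrDl !mulrDr fk kf addr0 add0r.
  + by move=> x; rewrite /= fs ks starD.
- by move=> x; rewrite /= fE (lin0 kl) addr0.
- by move=> x; rewrite /= kE (lin0 fl) add0r.
Qed.

End DoubledAlgebra.

Section DoubledCqg.
Variables (R : realType) (gT : finGroupType) (s : {perm gT}).
Hypotheses (sM : forall x y, s (x * y)%g = (s x * s y)%g).
Hypotheses (ss : forall x, s (s x) = x).

Lemma inv_aut1 : s 1%g = 1%g.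
Proof. by apply: (mulgI (s 1%g)); rewrite -sM !mulg1. Qed.

Lemma inv_autV x : s x^-1%g = (s x)^-1%g.
Proof. by apply: (mulgI (s x)); rewrite -sM !mulgV inv_aut1. Qed.

Section Comultiplication.
Variables (Q : cstarType R) (lam : gT -> Q) (lb : group_basis lam).
Let lf := gbasis_free lb.
Variable T : min_tensor (Q * Q)%type (Q * Q)%type.
Local Notation X := (xi_lam lam).
Local Notation Y := (eta_lam lam).
Local Notation D := (Q * Q)%type.

Lemma double_comul_ex : exists De : D -> T, [/\ unital_star_hom De,
  forall x, De (X x) = tensor T (X x) (X x) + tensor T (Y x) (Y (s x)) &
  forall x, De (Y x) = tensor T (X x) (Y x) + tensor T (Y x) (X (s x))].
Proof.
apply: (double_hom_ex lb) => [x y|x y|x y|x y|x|x|].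
- rewrite mulrDl !mulrDr !tensorM sM.
  by rewrite !xi_xi// !eta_eta// !xi_eta0 !eta_xi0 !tensor0l ?tensor0r addr0 add0r.
- rewrite mulrDl !mulrDr !tensorM sM.
  by rewrite !xi_xi// !eta_eta// !xi_eta0 !eta_xi0 !tensor0l ?tensor0r addr0 add0r.
- rewrite mulrDl !mulrDr !tensorM.
  by rewrite !xi_eta0 !eta_xi0 !tensor0l !tensor0r !addr0.
- rewrite mulrDl !mulrDr !tensorM.
  by rewrite !xi_eta0 !eta_xi0 !tensor0l !tensor0r !addr0.
- by rewrite starD !tensor_star !xi_star// !eta_star// inv_autV.
- by rewrite starD !tensor_star !xi_star// !eta_star// inv_autV.
- by rewrite inv_aut1 addrACA [X in _ + X]addrC -!tensorDr xi_eta1// -tensorDl xi_eta1// tensor11.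
Qed.

Variables (De : D -> T) (Deu : unital_star_hom De).
Hypothesis DeX : forall x, De (X x) = tensor T (X x) (X x) + tensor T (Y x) (Y (s x)).
Hypothesis DeY : forall x, De (Y x) = tensor T (X x) (Y x) + tensor T (Y x) (X (s x)).
Let Del : linear De := star_hom_lin (proj1 Deu).

(** Both sides of the coaction law are sums of the same four elementary
    tensors. *)
Lemma double_coassoc : coaction_law De De.
Proof.
have gD : group_like D by apply: group_like_prod; exists gT, lam.
apply: (coaction_lawP gD gD) => // T3 F G H hF hH hG.
have [Fl Gl] := (tensor_hom_lin hF, tensor_hom_lin hG).
have Hl := tensor_hom_lin hH.
have ll := star_hom_lin (proj1 (inl_hom T3)).
pose t3 a b c := inl_tensor T3 (inl_tensor T a) * inl_tensor T3 (inr_tensor T b) * inr_tensor T3 c.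
have FE a b c : inl_tensor T3 (tensor T a b) * inr_tensor T3 c = t3 a b c.
  by rewrite /t3 -(star_homM (proj1 (inl_hom T3))).
have GE a b c : inl_tensor T3 (inl_tensor T a) * H (tensor T b c) = t3 a b c.
  by rewrite (tensor_hom_tensor hH) /= mulrA.
apply: (double_linear_eq lb).
- by move=> c x y; rewrite Del Fl.
- by move=> c x y; rewrite Del Gl.
- move=> x; rewrite DeX (linD Fl) (linD Gl) !(tensor_hom_tensor hF) !(tensor_hom_tensor hG) /=.
  rewrite !DeX !DeY !(linD ll) !(linD Hl) !mulrDl !mulrDr !FE !GE ss.
  by rewrite addrACA [X in _ + X]addrC.
- move=> x; rewrite DeY (linD Fl) (linD Gl) !(tensor_hom_tensor hF) !(tensor_hom_tensor hG) /=.
  rewrite !DeX !DeY !(linD ll) !(linD Hl) !mulrDl !mulrDr !FE !GE ss.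
  by rewrite addrACA [X in _ + X]addrC.
Qed.

Lemma double_cancel_l :
  cdense (lspan [set z | exists a b, z = De a * tensor T 1 b]%classic).
Proof.
set Z := (X in lspan X).
have ZX x b : lspan Z (tensor T (X x) b).
  rewrite -[b]mul1r -(xi_eta1 lb) mulrDl tensorDr; apply: lspanD; apply: lspan_incl.
    exists (X x), (X x^-1%g * b); rewrite DeX mulrDl !tensorM !mulr1 !mulrA.
    by rewrite xi_xi// eta_xi0 mul0r tensor0r addr0 mulgV.
  exists (Y x), (Y x^-1%g * b); rewrite DeY mulrDl !tensorM !mulr1 !mulrA.
  by rewrite eta_eta// xi_eta0 mul0r tensor0r addr0 mulgV.
have ZY x b : lspan Z (tensor T (Y x) b).
  rewrite -[b]mul1r -(xi_eta1 lb) mulrDl tensorDr; apply: lspanD; apply: lspan_incl.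
    exists (Y x), (X (s x)^-1%g * b); rewrite DeY mulrDl !tensorM !mulr1 !mulrA.
    by rewrite xi_xi// eta_xi0 mul0r tensor0r add0r mulgV.
  exists (X x), (Y (s x)^-1%g * b); rewrite DeX mulrDl !tensorM !mulr1 !mulrA.
  by rewrite eta_eta// xi_eta0 mul0r tensor0r add0r mulgV.
apply: dense_of_tensors => d b; have [c [c' ->]] := double_expand lb d.
rewrite (lin_sum (tensor_linl T b)); apply: lspan_sum => x.
by rewrite tensorDl !tensorZl; apply: lspanD; exact: lspanZ.
Qed.

Lemma double_cancel_r :
  cdense (lspan [set z | exists a b, z = De a * tensor T b 1]%classic).
Proof.
set Z := (X in lspan X).
have ZX x b : lspan Z (tensor T b (X x)).
  rewrite -[b]mul1r -(xi_eta1 lb) mulrDl tensorDl; apply: lspanD; apply: lspan_incl.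
    exists (X x), (X x^-1%g * b); rewrite DeX mulrDl !tensorM !mulr1 !mulrA.
    by rewrite xi_xi// eta_xi0 mul0r tensor0l addr0 mulgV.
  exists (Y (s x)), (Y (s x)^-1%g * b); rewrite DeY mulrDl !tensorM !mulr1 !mulrA.
  by rewrite eta_eta// xi_eta0 mul0r tensor0l add0r mulgV ss.
have ZY x b : lspan Z (tensor T b (Y x)).
  rewrite -[b]mul1r -(xi_eta1 lb) mulrDl tensorDl; apply: lspanD; apply: lspan_incl.
    exists (Y x), (X x^-1%g * b); rewrite DeY mulrDl !tensorM !mulr1 !mulrA.
    by rewrite xi_xi// eta_xi0 mul0r tensor0l addr0 mulgV.
  exists (X (s x)), (Y (s x)^-1%g * b); rewrite DeX mulrDl !tensorM !mulr1 !mulrA.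
  by rewrite eta_eta// xi_eta0 mul0r tensor0l add0r mulgV ss.
apply: dense_of_tensors => b d; have [c [c' ->]] := double_expand lb d.
rewrite (lin_sum (tensor_linr T b)); apply: lspan_sum => x.
by rewrite tensorDr !tensorZr; apply: lspanD; exact: lspanZ.
Qed.

End Comultiplication.

Lemma doubled_group_cqg_ex : exists D : cqg R, is_doubled_group_cqg s D.
Proof.
have [Q [lam lfull]] := group_cqg_ex R gT.
have lb := full_group_basis lfull; have lf := gbasis_free lb.
have gQ : group_like Q by exists gT, lam.
have gD := group_like_prod gQ.
have [T] := group_like_min_tensor gD gD.
have [De [Deu DeX DeY]] := double_comul_ex lb T.
pose Dstr := CqgStructure Deu (double_coassoc lb Deu DeX DeY)
  (double_cancel_l lb DeX DeY) (double_cancel_r lb DeX DeY).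
have slM x y : lam (s (x * y)%g) = lam (s x) * lam (s y) by rewrite sM free_mulE.
have sls x : star (lam (s x)) = lam (s x^-1%g) by rewrite free_starE// inv_autV.
have [th [thh thl]] := basis_star_hom_ext lb slM sls.
have thlin := star_hom_lin thh.
have thu : unital_star_hom th by split=> //; rewrite -(free_1 lf) thl inv_aut1.
have lQ := inl_hom (tensor2 Q); have rQ := inr_hom (tensor2 Q).
have [_ _ comulQ] := lfull.
exists (Cqg Dstr), Q, lam, th, Dstr; split=> //.
- split; last first.
    move=> a; apply: (basis_linear_eq lb (F := th \o th) (F' := id)) => // [c x y|x] /=.
      by rewrite !thlin.
    by rewrite !thl ss.
  split=> //.
  have [ff hff] := tensor_hom_ex gQ gQ (tensor2 Q) (star_hom_comp (proj1 lQ) thh)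
    (star_hom_comp (proj1 rQ) thh) (fun a b => inl_inrC (tensor2 Q) _ _).
  exists ff; split=> // a.
  have ffl := tensor_hom_lin hff.
  have cl := star_hom_lin (proj1 (cqg_comul_hom (cqg_str Q))).
  apply: (basis_linear_eq lb (F := ff \o @comul R Q) (F' := @comul R Q \o th))
    => [c x y|c x y|x] /=.
  + by rewrite /comul cl ffl.
  + by rewrite thlin /comul cl.
  + by rewrite thl !comulQ (tensor_hom_tensor hff) /= thl.
- pose xi (x : Q) : Q * Q := (x, 0); pose eta (x : Q) : Q * Q := (0, x).
  have xih : star_hom xi.
    by split=> [c x y|x y|x]; congr pair; rewrite /= ?mulr0 ?scaler0 ?addr0 ?star0.
  have etah : star_hom eta.
    by split=> [c x y|x y|x]; congr pair; rewrite /= ?mulr0 ?scaler0 ?addr0 ?star0.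
  have [lh rh] := (proj1 (inl_hom T), proj1 (inr_hom T)).
  have ex f g (fh : star_hom f) (gh : star_hom g) :
      exists F, tensor_hom (inl_tensor T \o f) (inr_tensor T \o g) F
    := tensor_hom_ex gQ gQ (tensor2 Q) (star_hom_comp lh fh) (star_hom_comp rh gh)
      (fun a b => inl_inrC T _ _).
  have [F1 h1] := ex xi xi xih xih.
  have [F2 h2] := ex eta (eta \o th) etah (star_hom_comp etah thh).
  have [F3 h3] := ex xi eta xih etah.
  have [F4 h4] := ex eta (xi \o th) etah (star_hom_comp xih thh).
  have Fl := (tensor_hom_lin h1, tensor_hom_lin h2, tensor_hom_lin h3, tensor_hom_lin h4).
  have cl := star_hom_lin (proj1 (cqg_comul_hom (cqg_str Q))).
  have Del := star_hom_lin (proj1 Deu).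
  exists F1, F2, F3, F4; split=> // a.
  + apply: (basis_linear_eq lb (F := De \o xi)
      (F' := fun x => F1 (comul x) + F2 (comul x))) => [c x y|c x y|x] /=.
    * by rewrite (star_hom_lin xih) Del.
    * by rewrite /comul cl !Fl scalerDr addrACA.
    * by rewrite comulQ DeX (tensor_hom_tensor h1) (tensor_hom_tensor h2) /= thl.
  + apply: (basis_linear_eq lb (F := De \o eta)
      (F' := fun x => F3 (comul x) + F4 (comul x))) => [c x y|c x y|x] /=.
    * by rewrite (star_hom_lin etah) Del.
    * by rewrite /comul cl !Fl scalerDr addrACA.
    * by rewrite comulQ DeY (tensor_hom_tensor h3) (tensor_hom_tensor h4) /= thl.
Qed.

(** What is used of a doubled group algebra: two orthogonal copies of the group
    whose units add up to 1, and the values of the comultiplication. *)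
Record doubled_by (D : cqg R) (X Y : gT -> D) : Prop := DoubledBy {
  dbl_group_like : group_like D;
  dblXX : forall x y, X x * X y = X (x * y)%g;
  dblYY : forall x y, Y x * Y y = Y (x * y)%g;
  dblXY : forall x y, X x * Y y = 0;
  dblYX : forall x y, Y x * X y = 0;
  dblXs : forall x, star (X x) = X x^-1%g;
  dblYs : forall x, star (Y x) = Y x^-1%g;
  dbl1 : X 1%g + Y 1%g = 1;
  dbl_linear_eq : forall (V : lmodType R[i]) (F F' : D -> V),
    linear F -> linear F' -> (forall x, F (X x) = F' (X x)) ->
    (forall x, F (Y x) = F' (Y x)) -> F =1 F';
  dbl_hom_ex : forall (E : cstarType R) (p q : gT -> E),
    (forall x y, p (x * y)%g = p x * p y) -> (forall x y, q (x * y)%g = q x * q y) ->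
    (forall x y, p x * q y = 0) -> (forall x y, q x * p y = 0) ->
    (forall x, star (p x) = p x^-1%g) -> (forall x, star (q x) = q x^-1%g) ->
    p 1%g + q 1%g = 1 ->
    exists F : D -> E, [/\ unital_star_hom F, forall x, F (X x) = p x &
      forall x, F (Y x) = q x];
  dbl_comulX : forall x, comul (X x) =
    tensor (tensor2 D) (X x) (X x) + tensor (tensor2 D) (Y x) (Y (s x));
  dbl_comulY : forall x, comul (Y x) =
    tensor (tensor2 D) (X x) (Y x) + tensor (tensor2 D) (Y x) (X (s x))
}.

Lemma is_doubled_group_cqgP (D : cqg R) :
  is_doubled_group_cqg s D -> exists X Y : gT -> D, doubled_by X Y.
Proof.
move=> [Q [lam [th [Dstr [lfull _ thl [F1 [F2 [F3 [F4 [[h1 h2] [h3 h4] DX DY]]]]] ->]]]]].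
have lb := full_group_basis lfull; have [_ _ comulQ] := lfull.
exists (xi_lam lam), (eta_lam lam); split.
- by apply: group_like_prod; exists gT, lam.
- exact: xi_xi.
- exact: eta_eta.
- exact: xi_eta0.
- exact: eta_xi0.
- exact: xi_star.
- exact: eta_star.
- exact: xi_eta1.
- exact: double_linear_eq.
- exact: double_hom_ex.
- move=> x; rewrite /comul /= DX comulQ (tensor_hom_tensor h1) (tensor_hom_tensor h2) /=.
  by rewrite thl.
- move=> x; rewrite /comul /= DY comulQ (tensor_hom_tensor h3) (tensor_hom_tensor h4) /=.
  by rewrite thl.
Qed.

End DoubledCqg.

(** * The action of the doubled group algebra *)

Section Reduced.
Variables (R : realType) (gT : finGroupType).

Lemma l2sqE (f : gT -> R[i]) : l2sq f = l2n f ^+ 2.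
Proof. by rewrite sqr_l2n. Qed.

Lemma reduced_group_basis (B : cstarType R) (lam : gT -> B) :
  is_reduced_group_cstar lam -> group_basis lam.
Proof.
move=> [lu ld lN].
have lf : free_rep lam.
  split=> // c c0 x; have [le _] := lN c.
  have := le (fun z => (z == 1%g)%:R).
  rewrite c0 cnorm0 expr0n mul0r l2sqE (@l2n_ext _ _ _ c); last first.
    by move=> z; rewrite delta_convolution invg1 mulg1.
  rewrite le_eqVlt ltNge sqr_ge0 orbF sqrf_eq0 => /eqP n0.
  apply: cmod_eq0; apply/eqP; rewrite eq_le cmod_ge0 andbT -n0; exact: l2n_entry.
split=> // a; apply: (free_closed lf) => e /(ld a)[_ [n [c [x [xl ->]]]] lt].
have /choice[y yE] k : exists y, x k = lam y by have [y _ <-] := xl k; exists y.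
exists (fun z => \sum_k (y k == z)%:R * c k).
suff <- : \sum_k c k *: x k = \sum_z (\sum_k (y k == z)%:R * c k) *: lam z by [].
under [RHS]eq_bigr do rewrite scaler_suml; rewrite exchange_big /=.
apply: eq_bigr => k _; rewrite (bigD1 (y k))//= eqxx mul1r yE big1 ?addr0// => z.
by rewrite eq_sym => /negPf->; rewrite mul0r scale0r.
Qed.

Lemma reduced_group_ex : exists (B : cstarType R) (lam : gT -> B) (tau : B -> R[i]),
  is_reduced_group_cstar lam /\ is_canonical_trace lam tau.
Proof.
exists (galg R gT : cstarType R), (@gdelta R gT), (fun a : galg R gT => a 1%g).
have db := @gdelta_basis R gT; split.
- split; first exact: (proj1 (gbasis_free db)).
  + move=> a e e0; exists a; last by rewrite subrr cnorm0.
    have [c ->] := proj2 db a; apply: lspan_sum => x; apply: lspanZ.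
    by apply: lspan_incl; exists x.
  + move=> c N; have NE : N = opnorm (\sum_x c x *: gdelta R x) by [].
    have cE f : l2n (convolution c f) = l2n (convolution (\sum_x c x *: gdelta R x : galg R gT) f).
      by apply: l2n_ext => x; apply: convolution_ext => // z; rewrite galg_sumE.
    have N0 : 0 <= N by exact: opnorm_ge0.
    split.
      move=> f; rewrite !l2sqE -exprMn ler_pXn2r// ?nnegrE ?mulr_ge0 ?l2n_ge0//.
      by rewrite cE; exact: opnormP.
    move=> M M0 H; rewrite NE; apply: opnorm_le => // f; rewrite -cE.
    have := H f; rewrite !l2sqE -exprMn ler_pXn2r// ?nnegrE ?mulr_ge0 ?l2n_ge0//.
- split.
  + by move=> c a b; rewrite !ffunE.
  + by exists 1 => a; rewrite mul1r; exact: opnorm_entry.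
  + by move=> x; rewrite gdeltaE eq_sym.
Qed.

End Reduced.

Section WordLength.
Variables (gT : finGroupType) (S : {set gT}) (s : gT -> gT).
Hypotheses (sM : forall x y, s (x * y)%g = (s x * s y)%g).
Hypotheses (ss : forall x, s (s x) = x) (sS : forall x, x \in S -> s x \in S).

(** An automorphism that preserves the generating set preserves its powers. *)
Lemma word_length_aut x : word_length S (s x) = word_length S x.
Proof.
have s1 : s 1%g = 1%g by apply: (mulgI (s 1%g)); rewrite -sM !mulg1.
have sub n y : y \in (S ^+ n)%g -> s y \in (S ^+ n)%g.
  elim: n y => [|n IH] y; first by rewrite expg0 => /set1P->; rewrite s1; apply/set1P.
  rewrite expgS => /mulsgP[a b aS bS ->]; rewrite sM.
  by apply/mulsgP; exists (s a) (s b) => //; [exact: sS | exact: IH].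
apply: eq_find => n; apply/idP/idP => [/sub|]; last exact: sub.
by rewrite ss.
Qed.

End WordLength.

Section DualAction.
Variables (R : realType) (gT : finGroupType) (s : {perm gT}).
Hypotheses (sM : forall x y, s (x * y)%g = (s x * s y)%g).
Hypotheses (ss : forall x, s (s x) = x).
Variables (D : cqg R) (X Y : gT -> D) (dbl : doubled_by s X Y).
Variables (B : cstarType R) (mu : gT -> B) (mb : group_basis mu).

Let mf := gbasis_free mb.

Lemma dual_action_ex : exists al : Defs.action B D, forall x,
  al (mu x) = tensor (act_tensor al) (mu x) (X x) + tensor (act_tensor al) (mu (s x)) (Y (s x)).
Proof.
have gB : group_like B by exists gT, mu.
have gD := dbl_group_like dbl.
have [U] := group_like_min_tensor gB gD.
pose w x := tensor U (mu x) (X x) + tensor U (mu (s x)) (Y (s x)).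
have wM x y : w (x * y)%g = w x * w y.
  rewrite /w mulrDl !mulrDr !tensorM sM (dblXY dbl) (dblYX dbl).
  by rewrite !tensor0r addr0 add0r -!(free_mulE mf) (dblXX dbl) (dblYY dbl).
have ws x : star (w x) = w x^-1%g.
  rewrite /w starD !tensor_star !(free_starE mf) (inv_autV sM).
  by rewrite (dblXs dbl) (dblYs dbl).
have [al [alh alE]] := basis_star_hom_ext mb wM ws.
have alu : unital_star_hom al.
  split=> //; rewrite -(free_1 mf) alE /w (inv_aut1 sM) -tensorDr.
  by rewrite (dbl1 dbl) (free_1 mf) tensor11.
have alin := star_hom_lin alh.
have Deu : unital_star_hom (@comul R D) := cqg_comul_hom (cqg_str D).
have coass : coaction_law al (@comul R D).
  apply: (coaction_lawP gB gD) => // T3 F G H hF hH hG.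
  have [Fl Gl] := (tensor_hom_lin hF, tensor_hom_lin hG).
  have Hl := tensor_hom_lin hH.
  have ll := star_hom_lin (proj1 (inl_hom T3)).
  pose t3 a b c :=
    inl_tensor T3 (inl_tensor U a) * inl_tensor T3 (inr_tensor U b) * inr_tensor T3 c.
  have FE a b c : inl_tensor T3 (tensor U a b) * inr_tensor T3 c = t3 a b c.
    by rewrite /t3 -(star_homM (proj1 (inl_hom T3))).
  have GE a b c : inl_tensor T3 (inl_tensor U a) * H (tensor (tensor2 D) b c) = t3 a b c.
    by rewrite (tensor_hom_tensor hH) /= mulrA.
  apply: (basis_linear_eq mb).
  - by move=> c x y; rewrite alin Fl.
  - by move=> c x y; rewrite alin Gl.
  move=> x; rewrite alE /w (linD Fl) (linD Gl) !(tensor_hom_tensor hF) !(tensor_hom_tensor hG) /=.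
  rewrite !alE /w !(dbl_comulX dbl) !(dbl_comulY dbl) !(linD ll) !(linD Hl).
  rewrite !mulrDl !mulrDr !FE !GE ss.
  by rewrite [X in _ + X = _]addrC addrACA [X in _ + X = _]addrC.
have dens : cdense (lspan [set z | exists b q, z = al b * tensor U 1 q]%classic).
  set Z := (X in lspan X).
  have Zt x q : lspan Z (tensor U (mu x) q).
    rewrite -[q]mul1r -(dbl1 dbl) mulrDl tensorDr; apply: lspanD; apply: lspan_incl.
      exists (mu x), (X x^-1%g * q); rewrite alE /w mulrDl !tensorM !mulr1 !mulrA.
      rewrite (dblXX dbl) (dblYX dbl).
      by rewrite mul0r tensor0r addr0 mulgV.
    exists (mu (s x)), (Y x^-1%g * q); rewrite alE /w mulrDl !tensorM !mulr1 !mulrA ss.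
    rewrite (dblYY dbl) (dblXY dbl).
    by rewrite mul0r tensor0r add0r mulgV.
  apply: dense_of_tensors => b q; have [c ->] := proj2 mb b.
  rewrite (lin_sum (tensor_linl U q)); apply: lspan_sum => x.
  by rewrite tensorZl; exact: lspanZ.
by exists (Defs.Action alu coass dens).
Qed.

Variables (S : {set gT}) (tau : B -> R[i]) (al : Defs.action B D).
Hypothesis tauP : is_canonical_trace mu tau.
Hypothesis sS : forall x, x \in S -> s x \in S.
Hypothesis alE : forall x,
  al (mu x) = tensor (act_tensor al) (mu x) (X x) + tensor (act_tensor al) (mu (s x)) (Y (s x)).

Lemma dual_action_isometric : isometric_action S mu tau al.
Proof.
have gB : group_like B by exists gT, mu.
have gD := dbl_group_like dbl.
have alin := star_hom_lin (proj1 (act_hom al)).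
have [taul _ tauE] := tauP.
split.
  have [L [Ll Lb LE]] := slice_ex gB gD (act_tensor al) taul.
  exists L; split=> // b.
  apply: (basis_linear_eq mb (F := L \o al) (F' := fun b => tau b *: (1 : D)))
    => [c x y|c x y|x] /=.
  - by rewrite alin Ll.
  - by rewrite taul scalerDl scalerA.
  rewrite alE (linD Ll) !LE !tauE -(inj_eq (@perm_inj _ s)) (inv_aut1 sM).
  have [sx|sx] := eqVneq (s x) 1%g; last by rewrite !scale0r addr0.
  by rewrite sx -[x in X x]ss sx (inv_aut1 sM) !scale1r (dbl1 dbl).
move=> r c; exists (fun x => c x *: X x + c (s x) *: Y x).
rewrite (lin_sum alin).
under eq_bigr do rewrite (linZ alin) alE scalerDr.
under [RHS]eq_bigr do rewrite tensorDr.
rewrite !big_split /=; congr (_ + _).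
  by apply: eq_bigr => x _; rewrite tensorZr.
rewrite (reindex_inj (@perm_inj _ s)) /=.
apply: eq_big => x; first by rewrite (word_length_aut sM).
by move=> _; rewrite ss tensorZr.
Qed.

End DualAction.

(** * The coefficients of an isometric action *)

(** The relations between the coefficients [u y x] of an action that preserves
    the trace, [y] and [x] being the row and the column. The relations are
    symmetric in rows and columns. *)
Record coefficient_matrix (R : realType) (gT : finGroupType) (S : {set gT})
    (P : cstarType R) (u : gT -> gT -> P) : Prop := CoefficientMatrix {
  cm_colM : forall z x x', u z (x * x')%g = \sum_y u y x * u (y^-1 * z)%g x';
  cm_rowM : forall z x x', u (x * x')%g z = \sum_y u x y * u x' (y^-1 * z)%g;
  cm_star : forall y x, star (u y x) = u y^-1%g x^-1%g;
  cm_row1 : forall x, u 1%g x = (x == 1%g)%:R;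
  cm_col1 : forall y, u y 1%g = (y == 1%g)%:R;
  cm_length : forall y x, word_length S y != word_length S x -> u y x = 0
}.

Section Coefficients.
Variables (R : realType) (gT : finGroupType) (S : {set gT}).
Variables (B : cstarType R) (mu : gT -> B) (mb : group_basis mu).
Variables (tau : B -> R[i]) (tauP : is_canonical_trace mu tau).
Variables (P : cqg R) (be : Defs.action B P).
Local Notation T := (act_tensor be).
Local Notation "a '(x)' b" := (tensor T a b) (at level 40).

Let mf := gbasis_free mb.
Let mM := free_mulE mf.

Hypothesis be_iso : isometric_action S mu tau be.

(** The coefficient of index y of z is obtained by applying the slice map of
    the trace to (lambda_(y^-1) (x) 1) z. *)
Lemma coefficient_maps : exists E : gT -> T -> P, [/\ forall y, linear (E y),
  forall y, exists M : R, forall z, cnorm (E y z) <= M * cnorm z &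
  forall y x q, E y (mu x (x) q) = (y == x)%:R *: q].
Proof.
have [[L [Ll [M LM] LE _]] _] := be_iso; have [_ _ tauE] := tauP.
exists (fun y z => L (mu y^-1%g (x) 1 * z)); split.
- by move=> y c a b; rewrite mulrDr -scalerAr Ll.
- move=> y; exists (`|M| * cnorm (mu y^-1%g (x) 1)) => z.
  apply: (le_trans (LM _)); rewrite -(mulrA `|M|).
  apply: (@le_trans _ _ (`|M| * cnorm (mu y^-1%g (x) 1 * z))).
    by rewrite ler_wpM2r ?cnorm_ge0 ?ler_norm.
  by rewrite ler_wpM2l ?cnormM.
- move=> y x q; rewrite tensorM -mM mul1r LE tauE.
  by rewrite -(inj_eq (mulgI y)) mulKVg mulg1 eq_sym.
Qed.

Section Matrix.
Variable E : gT -> T -> P.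
Hypothesis El : forall y, linear (E y).
Hypothesis Eb : forall y, exists M : R, forall z, cnorm (E y z) <= M * cnorm z.
Hypothesis EE : forall y x q, E y (mu x (x) q) = (y == x)%:R *: q.

Lemma coef_sum y (a : gT -> P) : E y (\sum_x mu x (x) a x) = a y.
Proof.
rewrite (lin_sum (@El y)) (bigD1 y)//= EE eqxx scale1r big1 ?addr0// => x xy.
by rewrite EE eq_sym (negPf xy) scale0r.
Qed.

Let u y x := E y (be (mu x)).

Let beu : unital_star_hom be := act_hom be.

Lemma action_expand x : be (mu x) = \sum_y mu y (x) u y x.
Proof.
have [_ /(_ (word_length S x) (fun z => (z == x)%:R))[q]] := be_iso.
rewrite (bigD1 x)//= eqxx scale1r big1 ?addr0 => [qE|z /andP[_ /negPf->]]; last by rewrite scale0r.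
rewrite /u; set a := fun y => if word_length S y == word_length S x then q y else 0.
have aE : be (mu x) = \sum_y mu y (x) a y.
  rewrite qE big_mkcond /=; apply: eq_bigr => y _; rewrite /a.
  by case: ifP => // _; rewrite tensor0r.
by rewrite {1}aE; apply: eq_bigr => y _; rewrite aE coef_sum.
Qed.

Let u_colM z x x' : u z (x * x')%g = \sum_y u y x * u (y^-1 * z)%g x'.
Proof.
rewrite [LHS]/u mM (star_homM (proj1 beu)) 2!action_expand big_distrlr /=.
transitivity (E z (\sum_w mu w (x) (\sum_y u y x * u (y^-1 * w)%g x'))); last first.
  by rewrite (coef_sum _ (fun w => \sum_y u y x * u (y^-1 * w)%g x')).
congr (E z _); under [RHS]eq_bigr do rewrite (lin_sum (tensor_linr T _)).
rewrite [RHS]exchange_big /=; apply: eq_bigr => y _.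
rewrite [RHS](reindex_inj (mulgI y)) /=; apply: eq_bigr => w _.
by rewrite tensorM -mM mulKg.
Qed.

Let u_star y x : star (u y x) = u y^-1%g x^-1%g.
Proof.
rewrite [RHS]/u -(free_starE mf) (star_homJ (proj1 beu)) action_expand star_sum.
rewrite (reindex_inj invg_inj) /=; under eq_bigr do rewrite tensor_star (free_starE mf) invgK.
by rewrite (coef_sum _ (fun y => star (u y^-1%g x))) invgK.
Qed.

Let u_col1 y : u y 1%g = (y == 1%g)%:R.
Proof.
rewrite /u (free_1 mf) (proj2 beu) -(tensor11 T) -(free_1 mf) EE.
by case: eqP; rewrite ?scale1r ?scale0r.
Qed.

Let u_row1 x : u 1%g x = (x == 1%g)%:R.
Proof.
have [[L [Ll _ LE LB]] _] := be_iso; have [_ _ tauE] := tauP.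
have := LB (mu x); rewrite {1}action_expand (lin_sum Ll) (bigD1 1%g)//= LE tauE eqxx scale1r.
rewrite big1 ?addr0 => [->|y /negPf y1]; last by rewrite LE tauE y1 scale0r.
by rewrite tauE; case: eqP; rewrite ?scale1r ?scale0r.
Qed.

Let u_length y x : word_length S y != word_length S x -> u y x = 0.
Proof.
move=> yx; have [_ /(_ (word_length S x) (fun z => (z == x)%:R))[q]] := be_iso.
rewrite (bigD1 x)//= eqxx scale1r big1 ?addr0 => [qE|z /andP[_ /negPf->]]; last by rewrite scale0r.
rewrite /u qE (lin_sum (@El y)) big1// => z zx; rewrite EE.
by case: eqP => [yz|_]; [rewrite yz zx in yx | rewrite scale0r].
Qed.

Let u_col_orth x x' : \sum_y star (u y x) * u y x' = (x == x')%:R.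
Proof.
transitivity (u 1%g (x^-1 * x')%g).
  rewrite u_colM [RHS](reindex_inj invg_inj); apply: eq_bigr => y _.
  by rewrite u_star invgK mulg1.
by rewrite u_row1 -(inj_eq (mulgI x)) mulKVg mulg1 eq_sym.
Qed.

(** The columns being orthonormal, u u^* is the identity on the range of the
    matrix, and this range is dense by the density condition on an action. *)
Let u_row_orth y y' : \sum_x u y x * star (u y' x) = (y == y')%:R.
Proof.
pose p w := \sum_x u y x * star (u w x).
pose Phi z := (\sum_w p w * E w z) - E y z.
have Phil : linear Phi.
  move=> c a b; rewrite /Phi scalerBr addrACA -opprD -El; congr (_ - _).
  rewrite scaler_sumr -big_split /=; apply: eq_bigr => w _.
  by rewrite El mulrDr scalerAr.
have [M MP] := choice Eb.
have Phib z : cnorm (Phi z) <= ((\sum_w cnorm (p w) * `|M w|) + `|M y|) * cnorm z.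
  rewrite mulrDl; apply: (le_trans (cnormD _ _)); rewrite cnormN.
  have EM w : cnorm (E w z) <= `|M w| * cnorm z.
    by apply: (le_trans (MP w z)); rewrite ler_wpM2r ?cnorm_ge0 ?ler_norm.
  apply: lerD => //; rewrite mulr_suml; apply: (le_trans (cnorm_sum _ _ _)).
  apply: ler_sum => w _; apply: (le_trans (cnormM _ _)).
  by rewrite -mulrA ler_wpM2l ?cnorm_ge0.
have Egen w x q : E w (be (mu x) * (1 (x) q)) = u w x * q.
  rewrite action_expand mulr_suml; under eq_bigr do rewrite tensorM mulr1.
  by rewrite (coef_sum _ (fun w => u w x * q)).
have Phi0 x q : Phi (be (mu x) * (1 (x) q)) = 0.
  rewrite /Phi Egen; apply/eqP; rewrite subr_eq0; apply/eqP.
  under eq_bigr do rewrite Egen mulr_suml; rewrite exchange_big /=.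
  rewrite (bigD1 x)//= [X in _ + X]big1 ?addr0.
    under eq_bigr do rewrite -mulrA [X in _ * X]mulrA.
    by rewrite -mulr_sumr -mulr_suml u_col_orth eqxx mul1r.
  move=> x' x'x; under eq_bigr do rewrite -mulrA [X in _ * X]mulrA.
  by rewrite -mulr_sumr -mulr_suml u_col_orth (negPf x'x) mul0r mulr0.
have Phi_all0 z : Phi z = 0.
  apply: (bounded_dense0 Phil Phib (act_dense (a := be))) => _ [n [c [t [tP ->]]]].
  rewrite (lin_sum Phil) big1// => k _; rewrite (linZ Phil).
  have [b [q ->]] := tP k; have [d ->] := proj2 mb b.
  rewrite (lin_sum (star_hom_lin (proj1 beu))) mulr_suml (lin_sum Phil) big1 ?scaler0// => x _.
  by rewrite (linZ (star_hom_lin (proj1 beu))) -scalerAl (linZ Phil) Phi0 scaler0.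
have := Phi_all0 (mu y' (x) 1); rewrite /Phi EE (bigD1 y')//= EE eqxx scale1r mulr1 big1 ?addr0.
  move/eqP; rewrite subr_eq0 => /eqP py; rewrite -[LHS]/(p y') py.
  by case: eqP; rewrite ?scale1r ?scale0r.
by move=> w /negPf wy; rewrite EE wy scale0r mulr0.
Qed.

(** The column relations say that the matrix commutes with the multiplication
    of the group algebra; it is unitary, so that it commutes with the adjoint of
    the multiplication, the comultiplication dual to it. *)
Let u_rowM z x x' : u (x * x')%g z = \sum_y u x y * u x' (y^-1 * z)%g.
Proof.
have inner w y a : \sum_b u y a * u (y^-1 * w)%g b * (star (u x' b) * star (u x a)) =
    (x' == y^-1 * w)%g%:R *: (u y a * star (u x a)).
  transitivity (u y a * (\sum_b u (y^-1 * w)%g b * star (u x' b)) * star (u x a)).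
    by rewrite mulr_sumr mulr_suml; apply: eq_bigr => b _; rewrite !mulrA.
  rewrite u_row_orth eq_sym.
  by case: eqP; rewrite ?mulr1 ?mulr0 ?mul0r ?scale1r ?scale0r.
have step w : \sum_a \sum_b u w (a * b)%g * (star (u x' b) * star (u x a)) =
    (w == x * x')%g%:R.
  under eq_bigr do under eq_bigr do rewrite u_colM mulr_suml.
  under eq_bigr do rewrite exchange_big /=.
  rewrite exchange_big /= (bigD1 x)//= [X in _ + X]big1 ?addr0 => [|y yx].
    under eq_bigr do rewrite inner.
    rewrite -scaler_sumr u_row_orth eqxx -(inj_eq (mulgI x)) mulKVg eq_sym.
    by case: eqP; rewrite ?scale1r ?scale0r.
  under eq_bigr do rewrite inner.
  by rewrite -scaler_sumr u_row_orth (negPf yx) scaler0.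
apply: (can_inj (@starK R P)).
transitivity (\sum_a \sum_b (z == a * b)%g%:R * (star (u x' b) * star (u x a))).
  transitivity (\sum_w star (u w z) * (w == x * x')%g%:R).
    rewrite (bigD1 (x * x')%g)//= eqxx mulr1 big1 ?addr0// => w /negPf->.
    by rewrite mulr0.
  under eq_bigr do rewrite -step mulr_sumr.
  rewrite exchange_big /=; apply: eq_bigr => a _.
  under eq_bigr do rewrite mulr_sumr.
  rewrite exchange_big /=; apply: eq_bigr => b _.
  under eq_bigr do rewrite mulrA.
  by rewrite -mulr_suml u_col_orth.
rewrite star_sum; apply: eq_bigr => a _; rewrite starM (bigD1 (a^-1 * z)%g)//= mulKVg eqxx mul1r.
rewrite big1 ?addr0// => b; rewrite -(inj_eq (mulgI a)) mulKVg eq_sym => /negPf->.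
by rewrite mul0r.
Qed.

Lemma coefficient_matrixP : coefficient_matrix S u.
Proof. by split. Qed.

End Matrix.

End Coefficients.

(** * The presented group *)

Section Presentation.
Local Open Scope group_scope.
Variables (gT : finGroupType) (g h : gT).
Hypothesis gen : <<[set h; g]>> = [set: gT].

Lemma generated_ind (Pr : gT -> Prop) :
  Pr 1 -> Pr g -> Pr h -> (forall x y, Pr x -> Pr y -> Pr (x * y)) -> forall x, Pr x.
Proof.
move=> P1 Pg Ph PM x; pose A := [set x | `[<Pr x>]].
have AE y : (y \in A) = `[<Pr y>] by rewrite /A finset.in_set.
have gA : group_set A.
  apply/group_setP; split; first by rewrite AE; apply/asboolP.
  by move=> a b; rewrite !AE => /asboolP Pa /asboolP Pb; apply/asboolP; exact: PM.
have : [set: gT] \subset Group gA.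
  rewrite -gen gen_subG; apply/fintype.subsetP => y /set2P[] ->; rewrite [_ \in _]AE; exact/asboolP.
by move/fintype.subsetP/(_ x (finset.in_setT x)); rewrite [_ \in _]AE => /asboolP.
Qed.

Hypotheses (rel_g : g ^+ 9 = 1) (rel_h : h ^+ 3 = 1) (rel_gh : h^-1 * g * h = g ^+ 4).
Hypothesis pres : [set: gT] \isog
              Grp (y : x : x ^+ 9, y ^+ 3, y^-1 * x * y = x ^+ 4).

(** The pairs [(g, x)] and [(h, y)] generate a group that satisfies the
    relations, so it is no larger than the presented group, onto which it
    projects; it is then the graph of a homomorphism. *)
Lemma presentation_hom (rT : finGroupType) (x y : rT) :
  x ^+ 9 = 1 -> y ^+ 3 = 1 -> y^-1 * x * y = x ^+ 4 ->
  exists f : gT -> rT, [/\ forall a b, f (a * b) = f a * f b, f g = x & f h = y].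
Proof.
move=> xr yr xyr.
pose K : {group gT * rT} := <<[set (h, y); (g, x)]>>%G.
have KG : K \homg [set: gT].
  rewrite pres; apply/existsP; exists ((h, y), (g, x)).
  rewrite /=.
  have expE (a : gT) (b : rT) n : (a, b) ^+ n = (a ^+ n, b ^+ n).
    by elim: n => // n IH; rewrite !expgS IH.
  have p9 : (g, x) ^+ 9 = 1 by rewrite expE rel_g xr.
  have p3 : (h, y) ^+ 3 = 1 by rewrite expE rel_h yr.
  have p4 : (h, y)^-1 * (g, x) * (h, y) = (g, x) ^+ 4.
    by rewrite expE; congr pair; [exact: rel_gh | exact: xyr].
  by rewrite p9 p3 p4 joing_idl joing_idr.
have cK : (#|K| <= #|gT|)%N.
  have [f <-] := homgP KG; rewrite (leq_trans (leq_imset_card _ _))//.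
  by rewrite finset.setIT max_card.
have im : (fst @: K)%SET = [set: gT].
  apply/setP => a; rewrite finset.in_setT.
  apply: (generated_ind (Pr := fun a => a \in (fst @: K)%SET)).
  - by apply/imsetP; exists 1 => //; exact: group1.
  - by apply/imsetP; exists (g, x) => //; rewrite mem_gen// !inE eqxx orbT.
  - by apply/imsetP; exists (h, y) => //; rewrite mem_gen// !inE eqxx.
  - move=> b c /imsetP[p pK ->] /imsetP[q qK ->]; apply/imsetP.
    by exists (p * q) => //; exact: groupM.
have inj : {in K &, injective fst}.
  apply/imset_injP; rewrite eqn_leq leq_imset_card (leq_trans cK)//.
  by rewrite im cardsT.
have ex a : exists b, (a, b) \in K.
  have : a \in (fst @: K)%SET by rewrite im finset.in_setT.
  by case/imsetP => -[a' b] zK /= ->; exists b.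
have [f fK] := choice ex.
have fE a b : (a, b) \in K -> f a = b.
  by move=> abK; have := inj _ _ (fK a) abK erefl => -[].
exists f; split.
- by move=> a b; apply: fE; have := groupM (fK a) (fK b).
- by apply: fE; rewrite mem_gen// !inE eqxx orbT.
- by apply: fE; rewrite mem_gen// !inE eqxx.
Qed.

Lemma exists_involution : exists s : {perm gT}, [/\ s \in Aut [set: gT],
  s g = g^-1, s h = h & forall x, s (s x) = x].
Proof.
have r4 : h^-1 * g^-1 * h = g^-1 ^+ 4.
  by rewrite expgVn -rel_gh !invMg invgK mulgA.
have r9 : g^-1 ^+ 9 = 1 by rewrite expgVn rel_g invg1.
have [f [fM fg fh]] := presentation_hom r9 rel_h r4.
have f1 : f 1 = 1 by apply: (mulgI (f 1)); rewrite -fM !mulg1.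
have fV a : f a^-1 = (f a)^-1 by apply: (mulgI (f a)); rewrite -fM !mulgV f1.
have ff a : f (f a) = a.
  apply: (generated_ind (Pr := fun a => f (f a) = a)).
  - by rewrite !f1.
  - by rewrite fg fV fg invgK.
  - by rewrite !fh.
  - by move=> x y fx fy; rewrite !fM fx fy.
exists (perm (can_inj ff)); split; rewrite ?permE//.
  rewrite inE; apply/andP; split; first by apply/fintype.subsetP => x; rewrite inE.
  by apply/morphicP => x y _ _; rewrite !permE.
by move=> x; rewrite !permE.
Qed.

(** An affine action on the integers modulo 9, in which [g] is the translation
    by 1 and [h] the multiplication by 4. *)
Lemma g3_neq1 : g ^+ 3 != 1.
Proof.
have inj1 : injective (fun i : 'Z_9 => (i + 1)%R) by exact: addIr.
(* 7 is the inverse of 4 modulo 9 *)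
have inj4 : injective (fun i : 'Z_9 => (4%:R * i)%R).
  by apply: (can_inj (g := fun i : 'Z_9 => (7%:R * i)%R)) => i; rewrite mulrA -natrM
    (_ : (7 * 4)%:R = 1%R :> 'Z_9) ?mul1r//; exact: val_inj.
pose x := perm inj1; pose y := perm inj4.
have iterx n i : (x ^+ n) i = (i + n%:R)%R.
  by rewrite permX; elim: n => [|n IH]; rewrite ?addr0// iterS IH permE -addrA natr1.
have xr : x ^+ 9 = 1.
  apply/permP => i; rewrite iterx perm1 (_ : 9%:R = 0%R :> 'Z_9) ?addr0//; exact: val_inj.
have yr : y ^+ 3 = 1.
  apply/permP => i; rewrite permX perm1 /= !permE !mulrA -!natrM.
  by rewrite (_ : _%:R = 1%R :> 'Z_9) ?mul1r//; exact: val_inj.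
have xyr : y^-1 * x * y = x ^+ 4.
  apply: (mulgI y); rewrite -(mulgA y^-1) mulKVg; apply/permP => i.
  by rewrite permM [RHS]permM iterx !permE mulrDr mulr1.
have [f [fM fg _]] := presentation_hom xr yr xyr.
have f1 : f 1 = 1 by apply: (mulgI (f 1)); rewrite -fM !mulg1.
have fX n a : f (a ^+ n) = f a ^+ n.
  by elim: n => // n IH; rewrite !expgS fM IH.
apply/eqP => /(congr1 f); rewrite fX fg f1 => /permP/(_ 0%R).
by rewrite iterx perm1 add0r => /(congr1 val).
Qed.

(** The two coordinates of the abelianization, which is (Z/3)^2. *)
Lemma characters : exists a b : gT -> 'Z_3, [/\
  forall x y, a (x * y) = (a x + a y)%R, forall x y, b (x * y) = (b x + b y)%R &
  [/\ a g = 1%R, a h = 0%R, b g = 0%R & b h = 1%R]].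
Proof.
have c1 : (1%R : 'Z_3) ^+ 9 = 1 by exact: val_inj.
have c2 : (1%R : 'Z_3) ^+ 3 = 1 by exact: val_inj.
have c3 : (0%R : 'Z_3) ^+ 3 = 1 by exact: val_inj.
have c4 : (0%R : 'Z_3) ^+ 9 = 1 by exact: val_inj.
have c5 : (0%R : 'Z_3)^-1 * (1%R : 'Z_3) * (0%R : 'Z_3) = (1%R : 'Z_3) ^+ 4 by exact: val_inj.
have c6 : (1%R : 'Z_3)^-1 * (0%R : 'Z_3) * (1%R : 'Z_3) = (0%R : 'Z_3) ^+ 4 by exact: val_inj.
have [a [aM ag ah]] := presentation_hom c1 c3 c5.
have [b [bM bg bh]] := presentation_hom c4 c2 c6.
by exists a, b.
Qed.

End Presentation.

(** * The relations between the coefficients *)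

Section CoefficientForm.
Variables (R : realType) (gT : finGroupType) (g h : gT).
Hypothesis gen : <<[set h; g]>>%g = [set: gT]%SET.
Hypotheses (rel_h : (h ^+ 3)%g = 1%g) (rel_gh : (h^-1 * g * h)%g = (g ^+ 4)%g).
Hypothesis g3 : (g ^+ 3)%g != 1%g.
Variables (a b : gT -> 'Z_3).
Hypotheses (aM : forall x y, a (x * y)%g = a x + a y).
Hypotheses (bM : forall x y, b (x * y)%g = b x + b y).
Hypotheses (ag : a g = 1) (ah : a h = 0) (bg : b g = 0) (bh : b h = 1).
Local Notation S := ([set h; h^-1; g; g^-1]%g : {set gT}).

Let a1 : a 1%g = 0.
Proof. by apply: (addrI (a 1%g)); rewrite -aM mulg1 addr0. Qed.
Let b1 : b 1%g = 0.
Proof. by apply: (addrI (b 1%g)); rewrite -bM mulg1 addr0. Qed.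
Let aV x : a x^-1%g = - a x.
Proof. by apply: (addrI (a x)); rewrite -aM mulgV a1 subrr. Qed.
Let bV x : b x^-1%g = - b x.
Proof. by apply: (addrI (b x)); rewrite -bM mulgV b1 subrr. Qed.
Let aX x n : a (x ^+ n)%g = a x *+ n.
Proof. by elim: n => [|n IH]; rewrite ?a1// expgS aM IH mulrS. Qed.
Let bX x n : b (x ^+ n)%g = b x *+ n.
Proof. by elim: n => [|n IH]; rewrite ?b1// expgS bM IH mulrS. Qed.

(* Refutes an equation between words that one of the characters separates. *)
Ltac separate E := first
  [ by move: (congr1 a E); rewrite ?(aM, aV, aX, a1, ag, ah); move/(congr1 val); vm_compute
  | by move: (congr1 b E); rewrite ?(bM, bV, bX, b1, bg, bh); move/(congr1 val); vm_compute ].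
Ltac distinct := apply/eqP; let E := fresh in intro E; separate E.

Let S_form y : y \in S -> [\/ y = h, y = h^-1%g, y = g | y = g^-1%g].
Proof.
by rewrite !inE -!orbA => /or4P[] /eqP->; [constructor 1|constructor 2|constructor 3|constructor 4].
Qed.

Let hS : h \in S. Proof. by rewrite !inE eqxx. Qed.
Let hVS : h^-1%g \in S. Proof. by rewrite !inE eqxx ?orbT. Qed.
Let gS : g \in S. Proof. by rewrite !inE eqxx ?orbT. Qed.
Let gVS : g^-1%g \in S. Proof. by rewrite !inE eqxx ?orbT. Qed.

Ltac notinS := apply/negP => /S_form[]; let E := fresh in intro E; separate E.

Let oneS : 1%g \notin S. Proof. by notinS. Qed.
Let gggS : (g * (g * g))%g \notin S. Proof. by notinS. Qed.

Let ggS : (g * g)%g \notin S.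
Proof.
apply/negP => /S_form[] E; try separate E.
by case/eqP: g3; rewrite !expgS expg0 mulg1 E mulgV.
Qed.

Let gVgVS : (g^-1 * g^-1)%g \notin S.
Proof.
apply/negP => /S_form[] E; try separate E.
by case/eqP: g3; rewrite !expgS expg0 mulg1 -{1}E mulgA mulgKV mulVg.
Qed.

Let comm_neq : (g * h)%g != (h * g)%g.
Proof.
apply: contraNneq g3 => E; apply/eqP.
have : (g ^+ 4)%g = g by rewrite -rel_gh -mulgA E mulKg.
by rewrite expgSr => /(canRL (mulgK g)); rewrite mulgV.
Qed.

Let h2 : (h * h)%g = h^-1%g.
Proof. by apply: (mulgI h); rewrite mulgV -rel_h !expgS expg0 mulg1. Qed.

Let comm_neq' : (h^-1 * g)%g != (g * h^-1)%g.
Proof.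
apply: contraNneq comm_neq => E.
by rewrite -(inj_eq (mulgI h^-1%g)) -(inj_eq (mulIg h^-1%g)) mulKg -!mulgA mulgV mulg1 E.
Qed.

Variables (P : cstarType R) (u : gT -> gT -> P).
Hypothesis cm : coefficient_matrix S u.

Let u_out x y : x \in S -> y \notin S -> u y x = 0 /\ u x y = 0.
Proof.
move=> xS yS.
have x1 : x != 1%g by apply: contraNneq oneS => <-.
suff ne : word_length S y != word_length S x.
  by split; apply: (cm_length cm) => //; rewrite eq_sym.
rewrite /word_length.
have : (1 < #|gT|)%N.
  by apply/card_gt1P; exists x, 1%g; split.
case: #|gT| => [|[|n]] // _; rewrite /= !expg0 !expg1 !finset.in_set1 (negPf x1) xS (negPf yS).
by case: ifP.
Qed.

Let sum2 (F : gT -> P) p q : p != q -> (forall y, y != p -> y != q -> F y = 0) ->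
  \sum_y F y = F p + F q.
Proof.
move=> pq F0; rewrite (bigD1 p)//= (bigD1 q) 1?eq_sym//= big1 ?addr0// => y /andP[yp yq].
exact: F0.
Qed.

(* No product of two generators is g or its inverse. *)
Let u_gh0 : [/\ u g h = 0, u g^-1%g h = 0, u h g = 0 & u h g^-1%g = 0] /\
  [/\ u g h^-1%g = 0, u g^-1%g h^-1%g = 0, u h^-1%g g = 0 & u h^-1%g g^-1%g = 0].
Proof.
have out z : z = g \/ z = g^-1%g -> forall y, y \in S -> (y^-1 * z)%g \notin S.
  move=> [] -> y /S_form[] ->; rewrite ?invgK ?mulVg ?mulgV//; try by notinS.
have col z : z = g \/ z = g^-1%g -> u z h^-1%g = 0.
  move=> zg; rewrite -h2 (cm_colM cm) big1// => y _.
  have [yS|yS] := boolP (y \in S); last by rewrite (proj1 (u_out hS yS)) mul0r.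
  by rewrite (proj1 (u_out hS (out z zg y yS))) mulr0.
have row z : z = g \/ z = g^-1%g -> u h^-1%g z = 0.
  move=> zg; rewrite -h2 (cm_rowM cm) big1// => y _.
  have [yS|yS] := boolP (y \in S); last by rewrite (proj2 (u_out hS yS)) mul0r.
  by rewrite (proj2 (u_out hS (out z zg y yS))) mulr0.
have flip y x : u y^-1%g x^-1%g = 0 -> u y x = 0.
  by rewrite -(cm_star cm) => E; rewrite -[LHS]starK E star0.
split; split; try (apply: col; by [left|right]); try (apply: row; by [left|right]).
- by apply: flip; apply: col; right.
- by apply: flip; rewrite invgK; apply: col; left.
- by apply: flip; apply: row; right.
- by apply: flip; rewrite invgK; apply: row; left.
Qed.

Let col_g y : y != g -> y != g^-1%g -> u y g = 0 /\ u y g^-1%g = 0.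
Proof.
move=> yg ygV; have [[_ _ E1 E2] [_ _ E3 E4]] := u_gh0.
have [/S_form[] E|yS] := boolP (y \in S); try by rewrite E.
- by rewrite E eqxx in yg.
- by rewrite E eqxx in ygV.
- by rewrite (proj1 (u_out gS yS)) (proj1 (u_out gVS yS)).
Qed.

Let row_g y : y != g -> y != g^-1%g -> u g y = 0 /\ u g^-1%g y = 0.
Proof.
move=> yg ygV; have [[E1 E2 _ _] [E3 E4 _ _]] := u_gh0.
have [/S_form[] E|yS] := boolP (y \in S); try by rewrite E.
- by rewrite E eqxx in yg.
- by rewrite E eqxx in ygV.
- by rewrite (proj2 (u_out gS yS)) (proj2 (u_out gVS yS)).
Qed.

Let col_h y : y != h -> y != h^-1%g -> u y h = 0 /\ u y h^-1%g = 0.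
Proof.
move=> yh yhV; have [[E1 E2 _ _] [E3 E4 _ _]] := u_gh0.
have [/S_form[] E|yS] := boolP (y \in S); try by rewrite E.
- by rewrite E eqxx in yh.
- by rewrite E eqxx in yhV.
- by rewrite (proj1 (u_out hS yS)) (proj1 (u_out hVS yS)).
Qed.

Let A := u h h.
Let B := u h^-1%g h.
Let G := u g g.
Let H := u g^-1%g g.

Let uhh : u h^-1%g h^-1%g = star A. Proof. by rewrite (cm_star cm). Qed.
Let uhB : u h h^-1%g = star B. Proof. by rewrite (cm_star cm) invgK. Qed.
Let ugg : u g^-1%g g^-1%g = star G. Proof. by rewrite (cm_star cm). Qed.
Let ugH : u g g^-1%g = star H. Proof. by rewrite (cm_star cm) invgK. Qed.

Let ggV : g != g^-1%g. Proof. distinct. Qed.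
Let hhV : h != h^-1%g. Proof. distinct. Qed.

Let sum_col_g F : \sum_y u y g * F y = G * F g + H * F g^-1%g.
Proof. by rewrite (sum2 ggV)// => y y1 y2; rewrite (proj1 (col_g y1 y2)) mul0r. Qed.
Let sum_col_gV F : \sum_y u y g^-1%g * F y = star H * F g + star G * F g^-1%g.
Proof.
rewrite (sum2 ggV) ?ugg ?ugH// => y y1 y2.
by rewrite (proj2 (col_g y1 y2)) mul0r.
Qed.
Let sum_row_g F : \sum_y u g y * F y = G * F g + star H * F g^-1%g.
Proof.
rewrite (sum2 ggV) ?ugH// => y y1 y2.
by rewrite (proj1 (row_g y1 y2)) mul0r.
Qed.
Let sum_row_gV F : \sum_y u g^-1%g y * F y = H * F g + star G * F g^-1%g.
Proof.
rewrite (sum2 ggV) ?ugg// => y y1 y2.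
by rewrite (proj2 (row_g y1 y2)) mul0r.
Qed.
Let sum_col_h F : \sum_y u y h * F y = A * F h + B * F h^-1%g.
Proof. by rewrite (sum2 hhV)// => y y1 y2; rewrite (proj1 (col_h y1 y2)) mul0r. Qed.
Let sum_col_hV F : \sum_y u y h^-1%g * F y = star B * F h + star A * F h^-1%g.
Proof.
rewrite (sum2 hhV) ?uhh ?uhB// => y y1 y2.
by rewrite (proj2 (col_h y1 y2)) mul0r.
Qed.

Let gg1 : (g * g)%g != 1%g. Proof. distinct. Qed.

Let one0 z : z != 1%g -> u 1%g z = 0.
Proof. by move=> /negPf z1; rewrite (cm_row1 cm) z1. Qed.
Let zero1 z : z != 1%g -> u z 1%g = 0.
Proof. by move=> /negPf z1; rewrite (cm_col1 cm) z1. Qed.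
Let one1 : u 1%g 1%g = 1. Proof. by rewrite (cm_row1 cm) eqxx. Qed.

Let HsH : star H * H + star G * G = 1.
Proof.
have := cm_colM cm 1%g g^-1%g g; rewrite mulVg one1 sum_col_gV.
by rewrite !mulg1 invgK.
Qed.
Let GGs : G * star G + H * star H = 1.
Proof.
have := cm_colM cm 1%g g g^-1%g; rewrite mulgV one1 sum_col_g.
by rewrite !mulg1 invgK ugg ugH.
Qed.
Let GGsHsH : G * star G + star H * H = 1.
Proof.
have := cm_rowM cm 1%g g g^-1%g; rewrite mulgV one1 sum_row_g.
by rewrite !mulg1 invgK ugg.
Qed.
Let GH : G * H = 0.
Proof.
have := cm_rowM cm (g * g)%g g g^-1%g; rewrite mulgV one0// sum_row_g mulKg invgK.
by rewrite (proj2 (u_out gVS gggS)) mulr0 addr0.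
Qed.
Let HG : H * G = 0.
Proof.
have := cm_rowM cm (g * g)%g g^-1%g g; rewrite mulVg one0// sum_row_gV mulKg invgK.
by rewrite (proj2 (u_out gS gggS)) mulr0 addr0.
Qed.
Let GHs : G * star H = 0.
Proof.
have := cm_colM cm (g * g)%g g g^-1%g; rewrite mulgV zero1// sum_col_g mulKg invgK ugH.
by rewrite (proj1 (u_out gVS gggS)) mulr0 addr0.
Qed.
Let HsG : star H * G = 0.
Proof.
have := cm_colM cm (g * g)%g g^-1%g g; rewrite mulVg zero1// sum_col_gV mulKg invgK.
by rewrite (proj1 (u_out gS gggS)) mulr0 addr0.
Qed.
Let GsH : star G * H = 0.
Proof. by rewrite -[LHS]starK starM starK HsG star0. Qed.

Let P1 := G * star G.
Let P1_star : star P1 = P1. Proof. by rewrite /P1 starM starK. Qed.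
Let GsG : star G * G = P1.
Proof. by apply: (addrI (star H * H)); rewrite HsH addrC GGsHsH. Qed.
Let GP1 : G * P1 = G.
Proof. by rewrite -[RHS]mulr1 -GGs mulrDr (mulrA G H) GH mul0r addr0. Qed.
Let P1G : P1 * G = G.
Proof. by rewrite -mulrA GsG GP1. Qed.
Let P1P1 : P1 * P1 = P1. Proof. by rewrite {2}/P1 mulrA P1G. Qed.
Let P1H : P1 * H = 0. Proof. by rewrite -mulrA GsH mulr0. Qed.
Let HP1 : H * P1 = 0. Proof. by rewrite mulrA HG mul0r. Qed.

Let AAs : A * star A + B * star B = 1.
Proof.
have := cm_colM cm 1%g h h^-1%g; rewrite mulgV one1 sum_col_h.
by rewrite !mulg1 invgK uhh uhB.
Qed.

(* The column of g^2 is supported on g^2 and g^-2, and that of g^4 on g^4 and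
   g^-4: the index 1, which the product would also allow, is excluded because
   the row of 1 is trivial. *)
Let u_col_gg z : z != (g * g)%g -> z != (g^-1 * g^-1)%g -> u z (g * g)%g = 0.
Proof.
move=> z1 z2; have [->|z3] := eqVneq z 1%g; first exact: one0.
rewrite (cm_colM cm) sum_col_g invgK.
have ne x y : (x * z)%g != y -> forall w : P, w * 0 = 0 by move=> _ w; rewrite mulr0.
rewrite (proj1 (@col_g (g^-1 * z)%g _ _)) ?(proj1 (@col_g (g * z)%g _ _)) ?mulr0 ?addr0//.
- by rewrite -(inj_eq (mulgI g^-1%g)) mulKg mulVg.
- by rewrite -(inj_eq (mulgI g^-1%g)) mulKg.
- by rewrite -(inj_eq (mulgI g)) mulKVg.
- by rewrite -(inj_eq (mulgI g)) mulKVg mulgV.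
Qed.

Let g4 : (g ^+ 4)%g = (g * g * (g * g))%g.
Proof. by rewrite !expgS expg0 mulg1 !mulgA. Qed.

Let u_col_g4 z : z != (g ^+ 4)%g -> z != (g ^- 4)%g -> u z (g ^+ 4)%g = 0.
Proof.
move=> z1 z2; have [->|z3] := eqVneq z 1%g; first by apply: one0; distinct.
rewrite g4 (cm_colM cm) big1// => y _.
have [y1|y1] := eqVneq y (g * g)%g.
  rewrite (@u_col_gg (y^-1 * z)%g) ?mulr0// y1.
    by rewrite -(inj_eq (mulgI (g * g)%g)) mulKVg -g4.
  rewrite -(inj_eq (mulgI (g * g)%g)) mulKVg.
  by rewrite -invMg mulgV.
have [y2|y2] := eqVneq y (g^-1 * g^-1)%g; last by rewrite u_col_gg// mul0r.
rewrite (@u_col_gg (y^-1 * z)%g) ?mulr0// y2.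
  by rewrite -(inj_eq (mulgI (g^-1 * g^-1)%g)) mulKVg -invMg mulVg.
by rewrite -(inj_eq (mulgI (g^-1 * g^-1)%g)) mulKVg -invMg -invMg -g4.
Qed.

Let u_h0 z : a z != 0 -> u z h = 0.
Proof.
move=> az; apply: (proj1 (@col_h z _ _)); apply: contraNneq az => ->.
  by rewrite ah.
by rewrite aV ah oppr0.
Qed.

(* The relation g^4 = h^-1 g h expresses the column of g^4 in two ways. *)
Let conj_expand z : u z (g ^+ 4)%g =
  star B * (G * u (g^-1 * (h^-1 * z))%g h + H * u (g * (h^-1 * z))%g h) +
  star A * (G * u (g^-1 * (h * z))%g h + H * u (g * (h * z))%g h).
Proof.
rewrite -rel_gh -mulgA (cm_colM cm) sum_col_hV invgK.
by rewrite !(cm_colM cm _ g h) !sum_col_g invgK.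
Qed.

Ltac a_neq0 := by rewrite ?(aM, aV, aX, a1, ag, ah); apply/eqP => /(congr1 val); vm_compute.

Let special1 : (h * g * h^-1)%g != (g ^+ 4)%g.
Proof.
apply: contraNneq comm_neq' => E; apply/eqP.
have -> : (h^-1 * g)%g = (h * (h * g * h^-1) * h)%g by rewrite !mulgA h2 mulgKV.
by rewrite E -rel_gh -(mulgA h^-1%g) mulKVg -mulgA h2.
Qed.

Let special2 : (g^-1 * (h * (h * g * h^-1)))%g != h.
Proof.
apply: contraNneq comm_neq' => E; apply/eqP.
have <- : (g * (g^-1 * (h * (h * g * h^-1))) * h)%g = (h^-1 * g)%g.
  by rewrite mulKVg !mulgA h2 mulgKV.
by rewrite E -mulgA h2.
Qed.

Let special3 : (g * (h * (h * g^-1 * h^-1)))%g != h.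
Proof.
apply: contraNneq comm_neq' => E; apply/eqP.
have <- : (g * (h * (h * g^-1 * h^-1)) * h * g)%g = (g * h^-1)%g.
  by rewrite !mulgA -(mulgA g h h) h2 mulgKV mulgKV.
by rewrite E h2.
Qed.

(** At the index a b h^-1, with a in {h, h^-1} and b in {g, g^-1}, the
    expansion has a single term, u a h^-1 * u b g * B, and the column of g^4
    vanishes. As A A^* + B B^* = 1 and G^* G + H^* H = 1, this gives B = 0. *)
Let B0 : B = 0.
Proof.
have BGB : star B * (G * B) = 0.
  have := conj_expand (h * g * h^-1)%g.
  rewrite u_col_g4 //; last by distinct.
  rewrite (_ : (g^-1 * (h^-1 * (h * g * h^-1)))%g = h^-1%g);
    last by rewrite -(mulgA h) !mulKg.
  rewrite (proj1 (@col_h _ special2 _)); last by distinct.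
  rewrite [u (g * (h^-1 * _))%g h]u_h0; last by a_neq0.
  rewrite [u (g * (h * _))%g h]u_h0; last by a_neq0.
  by rewrite !mulr0 !addr0 mulr0 addr0.
have BHB : star B * (H * B) = 0.
  have := conj_expand (h * g^-1 * h^-1)%g.
  rewrite u_col_g4 //; first last.
  - by rewrite -(inj_eq invg_inj) invgK !invMg !invgK mulgA special1.
  - by distinct.
  rewrite (_ : (g * (h^-1 * (h * g^-1 * h^-1)))%g = h^-1%g);
    last by rewrite -(mulgA h) mulKg mulKVg.
  rewrite (proj1 (@col_h _ special3 _)); last by distinct.
  rewrite [u (g^-1 * (h^-1 * _))%g h]u_h0; last by a_neq0.
  rewrite [u (g^-1 * (h * _))%g h]u_h0; last by a_neq0.
  by rewrite !mulr0 !add0r mulr0 addr0.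
have AGB : star A * (G * B) = 0.
  have := conj_expand (h^-1 * g * h^-1)%g.
  rewrite u_col_g4; [|by distinct|by distinct].
  rewrite (_ : (g^-1 * (h * (h^-1 * g * h^-1)))%g = h^-1%g);
    last by rewrite -(mulgA h^-1%g) mulKVg mulKg.
  rewrite (proj1 (@col_h (g^-1 * (h^-1 * (h^-1 * g * h^-1)))%g _ _)); [|by distinct|by distinct].
  rewrite [u (g * (h^-1 * _))%g h]u_h0; last by a_neq0.
  rewrite [u (g * (h * _))%g h]u_h0; last by a_neq0.
  by rewrite !mulr0 !addr0 mulr0 add0r.
have AHB : star A * (H * B) = 0.
  have := conj_expand (h^-1 * g^-1 * h^-1)%g.
  rewrite u_col_g4; [|by distinct|by distinct].
  rewrite (_ : (g * (h * (h^-1 * g^-1 * h^-1)))%g = h^-1%g);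
    last by rewrite -(mulgA h^-1%g) mulKVg mulKVg.
  rewrite (proj1 (@col_h (g * (h^-1 * (h^-1 * g^-1 * h^-1)))%g _ _)); [|by distinct|by distinct].
  rewrite [u (g^-1 * (h^-1 * _))%g h]u_h0; last by a_neq0.
  rewrite [u (g^-1 * (h * _))%g h]u_h0; last by a_neq0.
  by rewrite !mulr0 !add0r mulr0 add0r.
have GB : G * B = 0 by rewrite -[LHS]mul1r -AAs mulrDl -!mulrA AGB BGB !mulr0 addr0.
have HB : H * B = 0 by rewrite -[LHS]mul1r -AAs mulrDl -!mulrA AHB BHB !mulr0 addr0.
by rewrite -[LHS]mul1r -HsH mulrDl -!mulrA GB HB !mulr0 addr0.
Qed.

Let AAs1 : A * star A = 1. Proof. by rewrite -AAs B0 mul0r addr0. Qed.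

Let u_g4_g4 : u (g ^+ 4)%g (g ^+ 4)%g = G * G * (G * G).
Proof.
have gg : u (g * g)%g (g * g)%g = G * G.
  rewrite (cm_colM cm) sum_col_g mulKg invgK.
  by rewrite (proj1 (u_out gS gggS)) mulr0 addr0.
have n2 : (g * g)%g != (g^-1 * g^-1)%g by distinct.
rewrite {2}g4 (cm_colM cm) (sum2 n2) => [|y y1 y2]; last by rewrite u_col_gg// mul0r.
rewrite [X in _ + X](_ : _ = 0) ?addr0.
  by rewrite g4 mulKg gg.
by rewrite (@u_col_gg ((g^-1 * g^-1)^-1 * _)%g) ?mulr0//; distinct.
Qed.

(* The same expansion at the index g^4 itself. *)
Let conjA : star A * (G * A) = G * G * (G * G).
Proof.
rewrite -u_g4_g4 conj_expand B0 star0 mul0r add0r -{1 2}rel_gh.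
rewrite -!(mulgA h^-1%g) mulKVg mulKg.
rewrite [X in H * X](u_h0 (z := _)) ?mulr0 ?addr0//.
by a_neq0.
Qed.

Let P1A : P1 * A = A * P1.
Proof.
(* The range projections of the two sides of A^* G A = G^4. *)
have E : star A * P1 * A = P1.
  have -> : star A * P1 * A = (star A * (G * A)) * star (star A * (G * A)).
    rewrite !starM starK !mulrA -(mulrA _ A (star A)) AAs1 mulr1.
    by rewrite /P1 ?mulrA.
  rewrite conjA !starM.
  have GGG : G * G * star G = G by rewrite -mulrA GP1.
  have GGs' x : x * G * G * star G = x * G by rewrite -!mulrA (mulrA G G) GGG.
  by rewrite !mulrA !GGs' GGG.
by rewrite -{2}E !mulrA AAs1 mul1r.
Qed.

Let W x := \sum_y u y x.

Let WM x y : W (x * y)%g = W x * W y.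
Proof.
rewrite /W; under eq_bigr do rewrite (cm_colM cm).
rewrite exchange_big mulr_suml /=; apply: eq_bigr => z _.
by rewrite -mulr_sumr [in RHS](reindex_inj (mulgI z^-1%g)).
Qed.

Let Wu : unitary_rep W.
Proof.
split=> //.
- rewrite /W (bigD1 1%g)//= one1 big1 ?addr0// => y; exact: zero1.
- move=> x; rewrite /W star_sum (reindex_inj invg_inj); apply: eq_bigr => y _.
  by rewrite (cm_star cm) invgK.
Qed.

Let Wg : W g = G + H.
Proof.
rewrite /W (sum2 ggV) // => y y1 y2; exact: (proj1 (col_g y1 y2)).
Qed.
Let Wh : W h = A.
Proof.
rewrite /W (sum2 hhV) -/A -/B ?B0 ?addr0// => y y1 y2; exact: (proj1 (col_h y1 y2)).
Qed.

Let WP x : W x * P1 = P1 * W x.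
Proof.
apply: (generated_ind gen (Pr := fun x => W x * P1 = P1 * W x)).
- by have [-> _ _] := Wu; rewrite mul1r mulr1.
- by rewrite Wg mulrDl mulrDr GP1 HP1 P1G P1H.
- by rewrite Wh P1A.
- by move=> y z yP zP; rewrite WM -(mulrA (W y)) zP (mulrA (W y)) yP mulrA.
Qed.

Variable s : gT -> gT.
Hypotheses (sM : forall x y, s (x * y)%g = (s x * s y)%g).
Hypotheses (sg : s g = g^-1%g) (sh : s h = h).

(** [W] is the sum of the rows of the matrix, that is, the action followed by
    the trivial character of the group on the first factor; [P1] is the support
    of u g g. The formula holds at g and h, and it is multiplicative in x
    because [P1] commutes with [W]. *)
Lemma coefficient_form : exists (W : gT -> P) (P1 : P),
  [/\ unitary_rep W, star P1 = P1, P1 * P1 = P1, forall x, W x * P1 = P1 * W x &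
   forall y x, u y x = (y == x)%:R *: (W x * P1) + (y == s x)%:R *: (W x * (1 - P1))].
Proof.
exists W, P1; split=> // y x; move: y.
have [W1 _ _] := Wu.
apply: (generated_ind gen (Pr := fun x => forall y, u y x =
  (y == x)%:R *: (W x * P1) + (y == s x)%:R *: (W x * (1 - P1)))).
- have s1 : s 1%g = 1%g by apply: (mulgI (s 1%g)); rewrite -sM !mulg1.
  move=> y; rewrite s1 W1 !mul1r -scalerDr addrC subrK (cm_col1 cm).
  by case: eqP; rewrite ?scale1r ?scale0r.
- move=> y; rewrite sg Wg mulrBr mulr1 mulrDl GP1 HP1 addr0 [G + H]addrC addrK.
  have [->|y1] := eqVneq y g; first by rewrite (negPf ggV) scale1r scale0r addr0.
  have [->|y2] := eqVneq y g^-1%g; first by rewrite scale1r scale0r add0r.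
  by rewrite !scale0r addr0; exact: (proj1 (col_g y1 y2)).
- move=> y; rewrite sh Wh -scalerDr -mulrDr addrC subrK mulr1.
  have [->|y1] := eqVneq y h; first by rewrite scale1r.
  have [->|y2] := eqVneq y h^-1%g; first by rewrite scale0r -/B B0.
  by rewrite scale0r; exact: (proj1 (col_h y1 y2)).
- move=> x1 x2 H1 H2 y; rewrite (cm_colM cm).
  under eq_bigr do rewrite H1 H2.
  pose p w := W w * P1; pose q w := W w * (1 - P1).
  have P1c : (1 - P1) * P1 = 0 by rewrite mulrBl mul1r P1P1 subrr.
  have cP1 : P1 * (1 - P1) = 0 by rewrite mulrBr mulr1 P1P1 subrr.
  have cc : (1 - P1) * (1 - P1) = 1 - P1 by rewrite mulrBr mulr1 P1c subr0.
  have Wc w : W w * (1 - P1) = (1 - P1) * W w by rewrite mulrBr mulrBl mulr1 mul1r WP.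
  have pp : p x1 * p x2 = W (x1 * x2)%g * P1.
    by rewrite /p -mulrA (mulrA P1) -WP -(mulrA (W x2)) P1P1 mulrA -WM.
  have qq : q x1 * q x2 = W (x1 * x2)%g * (1 - P1).
    by rewrite /q -mulrA (mulrA (1 - P1)) -Wc -(mulrA (W x2)) cc mulrA -WM.
  have pq : p x1 * q x2 = 0.
    by rewrite /p /q -mulrA (mulrA P1) -WP -(mulrA (W x2)) cP1 !mulr0.
  have qp : q x1 * p x2 = 0.
    by rewrite /p /q -mulrA (mulrA (1 - P1)) -Wc -(mulrA (W x2)) P1c !mulr0.
  rewrite -/(p x1) -/(p x2) -/(q x1) -/(q x2).
  under eq_bigr do rewrite mulrDl !mulrDr -!scalerAl -!scalerAr pp qq pq qp !scaler0 addr0 add0r.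
  rewrite big_split /= (bigD1 x1)//= eqxx scale1r big1 ?addr0; last first.
    by move=> z /negPf->; rewrite scale0r.
  rewrite (bigD1 (s x1))//= eqxx scale1r big1 ?addr0; last first.
    by move=> z /negPf->; rewrite scale0r.
  rewrite -(inj_eq (mulgI x1)) mulKVg -[in X in _ + X](inj_eq (mulgI (s x1))) mulKVg -sM.
  by [].
Qed.

End CoefficientForm.

(** * The comultiplication on the coefficients *)

Section Character.
Variable R : realType.

Lemma cube_root_ex : exists w : R[i], [/\ w ^+ 3 = 1, w != 1 & conjc w * w = 1].
Proof.
pose r : R := Num.sqrt 3.
have rr : r * r = 3 by rewrite -expr2 sqr_sqrtr.
have tt : r / 2 * (r / 2) = 3 / 4 by rewrite mulrACA rr; field.
exists (Complex (- 2^-1) (r / 2)); move: (r / 2) tt => t tt; split.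
- rewrite !exprS expr0 mulr1; apply/eqP; rewrite eq_complex /=; apply/andP; split; apply/eqP.
    have -> : - 2^-1 * (- 2^-1 * - 2^-1 - t * t) - t * (- 2^-1 * t + t * - 2^-1)
      = - 2^-1 ^+ 3 + 3 * 2^-1 * (t * t) by field.
    by rewrite tt; field.
  have -> : - 2^-1 * (- 2^-1 * t + t * - 2^-1) + t * (- 2^-1 * - 2^-1 - t * t)
    = t * (3 / 4 - t * t) by field.
  by rewrite tt subrr mulr0.
- by rewrite eq_complex /= negb_and; apply/orP; left; apply/eqP; lra.
- apply/eqP; rewrite eq_complex /=; apply/andP; split; apply/eqP; last by field.
  have -> : - 2^-1 * - 2^-1 - - t * t = 1 / 4 + t * t by field.
  by rewrite tt; field.
Qed.

Lemma complex_character (gT : finGroupType) (a : gT -> 'Z_3) (g : gT) :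
  (forall x y, a (x * y)%g = a x + a y) -> a g = 1 ->
  exists chi : gT -> R[i], [/\ forall x y, chi (x * y)%g = chi x * chi y,
    forall x, conjc (chi x) * chi x = 1 & chi g != chi g^-1%g].
Proof.
move=> aM ag; have [w [w3 w1 ww]] := cube_root_ex.
have chiM x y : w ^+ (a (x * y)%g) = w ^+ a x * w ^+ a y.
  by rewrite aM -exprD -(expr_mod (a x + a y)%N w3).
exists (fun x => w ^+ a x); split=> //.
  by move=> x; rewrite rmorphXn -exprMn ww expr1n.
have a1 : a 1%g = 0 by apply: (addrI (a 1%g)); rewrite -aM mulg1 addr0.
have aV : a g^-1%g = - 1 by apply: (addrI 1); rewrite -{1}ag -aM mulgV a1 subrr.
rewrite ag aV (_ : nat_of_ord 1 = 1%N)// (_ : nat_of_ord (- 1) = 2%N)//.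
apply: contra_neq w1 => E.
by rewrite -w3 exprS -E expr1 -[LHS]/(w ^+ 1) E.
Qed.

End Character.

Lemma unitary_character1 (R : realType) (gT : finGroupType) (chi : gT -> R[i]) :
  (forall x y, chi (x * y)%g = chi x * chi y) ->
  (forall x, conjc (chi x) * chi x = 1) -> chi 1%g = 1.
Proof.
move=> chiM chiJ; have n0 : chi 1%g != 0.
  by apply/eqP => c0; have := chiJ 1%g; rewrite c0 mulr0 => /eqP; rewrite eq_sym oner_eq0.
by apply: (mulfI n0); rewrite -chiM mulg1 mulr1.
Qed.

Section DoubledGenerators.
Variables (R : realType) (gT : finGroupType) (g h : gT).
Hypothesis gen : <<[set h; g]>>%g = [set: gT]%SET.
Variables (s : {perm gT}) (D : cqg R) (X Y : gT -> D) (dbl : doubled_by s X Y).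

(** The three elements generate the algebra: X 1 = X g * star (X g), and X 1
    cuts X h out of X h + Y h. *)
Lemma doubled_hom_eq (E : cstarType R) (f f' : D -> E) :
  unital_star_hom f -> unital_star_hom f' ->
  f (X g) = f' (X g) -> f (Y g^-1%g) = f' (Y g^-1%g) ->
  f (X h + Y h) = f' (X h + Y h) -> f =1 f'.
Proof.
move=> [[fl fm fs] f1] [[fl' fm' fs'] f1'] EX EY EXY.
have EX1 : f (X 1%g) = f' (X 1%g).
  by rewrite -(mulgV g) -(dblXX dbl) -(dblXs dbl) fm fm' fs fs' EX.
have EY1 : f (Y 1%g) = f' (Y 1%g).
  have -> : Y 1%g = 1 - X 1%g by rewrite -(dbl1 dbl) (addrC (X _)) addrK.
  by rewrite (linB fl) (linB fl') f1 f1' EX1.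
have EYg : f (Y g) = f' (Y g).
  by rewrite -[g]invgK -(dblYs dbl) fs fs' EY.
have EXh : f (X h) = f' (X h).
  have -> : X h = (X h + Y h) * X 1%g.
    by rewrite mulrDl (dblXX dbl) (dblYX dbl) addr0 mulg1.
  by rewrite fm fm' EXY EX1.
have EYh : f (Y h) = f' (Y h).
  have -> : Y h = (X h + Y h) * Y 1%g.
    by rewrite mulrDl (dblYY dbl) (dblXY dbl) add0r mulg1.
  by rewrite fm fm' EXY EY1.
apply: (dbl_linear_eq dbl) => //.
  apply: (generated_ind gen) => // x y Ex Ey.
  by rewrite -(dblXX dbl) fm fm' Ex Ey.
apply: (generated_ind gen) => // x y Ex Ey.
by rewrite -(dblYY dbl) fm fm' Ex Ey.
Qed.

End DoubledGenerators.

(** The setting of the coaction law: [T] is (B (x) P) (x) P, the maps [E] read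
    off the coefficients in the group basis of B, and [H] is the embedding of
    P (x) P in the second and third factors. As P is arbitrary, an element of
    P (x) P is only a limit of elementary tensors. *)
Section TripleTensor.
Variables (R : realType) (gT : finGroupType) (B P : cstarType R).
Variables (mu : gT -> B) (mb : group_basis mu).
Variables (U : min_tensor B P).
Variable E : gT -> U -> P.
Hypothesis El : forall y, linear (E y).
Hypothesis Eb : forall y, exists M : R, forall z, cnorm (E y z) <= M * cnorm z.
Hypothesis EE : forall y x q, E y (tensor U (mu x) q) = (y == x)%:R *: q.

Let mf := gbasis_free mb.

Lemma coef_expand z : z = \sum_y tensor U (mu y) (E y z).
Proof.
apply/esym/eqP; rewrite -subr_eq0; apply/eqP.
pose Phi z := (\sum_y tensor U (mu y) (E y z)) - z.
have Phil : linear Phi.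
  move=> c x y; rewrite /Phi scalerBr addrACA -opprD; congr (_ - _).
  rewrite scaler_sumr -big_split /=; apply: eq_bigr => w _.
  by rewrite El tensor_linr.
have [M MP] := choice Eb.
have Phib x : cnorm (Phi x) <= ((\sum_y cnorm (inl_tensor U (mu y)) * M y) + 1) * cnorm x.
  rewrite mulrDl mul1r; apply: (le_trans (cnormD _ _)); rewrite cnormN lerD2r.
  rewrite mulr_suml; apply: (le_trans (cnorm_sum _ _ _)); apply: ler_sum => y _.
  apply: (le_trans (cnormM _ _)); rewrite -mulrA ler_wpM2l ?cnorm_ge0//.
  by apply: (le_trans (unital_star_hom_contractive (inr_hom U) _)).
have [_ dU _] := min_tensorP U.
apply: (bounded_dense0 Phil Phib dU) => _ [t _ <-].
rewrite /tensor_eval (lin_sum Phil) big1// => -[x q] _ /=.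
have [c ->] := proj2 mb x; rewrite (lin_sum (star_hom_lin (proj1 (inl_hom U)))) mulr_suml.
rewrite (lin_sum Phil) big1// => w _.
rewrite (linZ (star_hom_lin (proj1 (inl_hom U)))) -scalerAl (linZ Phil) /Phi.
rewrite -/(tensor U (mu w) q) (bigD1 w)//= EE eqxx scale1r big1 ?addr0 ?subrr ?scaler0//.
by move=> v /negPf vw; rewrite EE vw scale0r tensor0r.
Qed.

(** A character of the group acts on the first factor by an automorphism. *)
Section Twist.
Variable chi : gT -> R[i].
Hypotheses (chiM : forall x y, chi (x * y)%g = chi x * chi y).
Hypotheses (chiJ : forall x, conjc (chi x) * chi x = 1).

Definition twist z : U := \sum_y chi y *: tensor U (mu y) (E y z).

Lemma twist_linear : linear twist.
Proof.
move=> c x y; rewrite /twist scaler_sumr -big_split /=; apply: eq_bigr => w _.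
by rewrite El tensor_linr scalerDr !scalerA mulrC.
Qed.

Lemma twist_tensor x q : twist (tensor U (mu x) q) = chi x *: tensor U (mu x) q.
Proof.
rewrite /twist (bigD1 x)//= EE eqxx scale1r big1 ?addr0// => y /negPf yx.
by rewrite EE yx scale0r tensor0r scaler0.
Qed.

Let chi1 : chi 1%g = 1 := unitary_character1 chiM chiJ.

Let chiV x : chi x^-1%g = conjc (chi x).
Proof.
have n0 : chi x != 0.
  by apply/eqP => c0; have := chiJ x; rewrite c0 mulr0 => /eqP; rewrite eq_sym oner_eq0.
by apply: (mulIf n0); rewrite chiJ -chiM mulVg.
Qed.

Lemma twist_hom : unital_star_hom twist.
Proof.
have tl := twist_linear; split; first split=> //.
- move=> a b; rewrite [a in LHS]coef_expand [b in LHS]coef_expand /twist.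
  rewrite -/(twist _) -/(twist _) big_distrlr /= (lin_sum tl) big_distrlr /=.
  apply: eq_bigr => x _; rewrite (lin_sum tl); apply: eq_bigr => y _.
  rewrite tensorM -(free_mulE mf) twist_tensor chiM -scalerAl -scalerAr scalerA.
  by rewrite tensorM -(free_mulE mf).
- move=> a; rewrite [a in LHS]coef_expand star_sum (lin_sum tl) [in RHS]/twist star_sum.
  apply: eq_bigr => x _.
  by rewrite tensor_star (free_starE mf) twist_tensor chiV starZ tensor_star (free_starE mf).
- by rewrite -(tensor11 U) -(free_1 mf) twist_tensor chi1 scale1r.
Qed.

End Twist.

Variables (PP : min_tensor P P) (T : min_tensor U P) (H : PP -> T).
Hypothesis hH : tensor_hom (inl_tensor T \o inr_tensor U) (inr_tensor T) H.
Local Notation l := (inl_tensor T).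
Local Notation r := (inr_tensor T).
Let lh := inl_hom T.
Let rh := inr_hom T.

(** A bilinear form on P x P is extended to (B (x) P) x P by means of a
    retraction of the embedding. *)
Lemma tensor_zero_section (s : seq (P * P)) (k : P -> U) (L : U -> P) :
  linear k -> linear L -> (forall q, L (k q) = q) ->
  tensor_eval (l \o k) r s = 0 -> tensor_zero s.
Proof.
move=> kl Ll Lk s0 beta br bl.
have [[_ _ _ inj] _ _] := min_tensorP T.
have := inj [seq (k p.1, p.2) | p <- s]; rewrite /tensor_eval big_map => /(_ s0).
move=> /(_ (fun z d => beta (L z) d)); rewrite big_map.
under eq_bigr do rewrite Lk; apply; first by move=> z; exact: br.
by move=> d c x y /=; rewrite Ll bl.
Qed.

Lemma legs23_unital : unital_star_hom H.
Proof. by apply: (tensor_hom_unital hH) => /=; rewrite ?(proj2 (inr_hom U)) ?inl1 ?inr1. Qed.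

(** The norm of P (x) P is the least one on the algebraic tensor product, and
    [H] is contractive, so that the inequality extends to limits. *)
Lemma legs23_cnorm_le t : cnorm t <= cnorm (H t).
Proof.
have [_ dPP minPP] := min_tensorP PP.
have emb : tensor_embedding (l \o inr_tensor U) r.
  split=> //.
  - exact: unital_star_hom_comp (inr_hom U).
  - by move=> a b /=; exact: inl_inrC.
  - move=> s; apply: (tensor_zero_section (L := E 1%g)) => //.
    + exact: star_hom_lin (proj1 (inr_hom U)).
    + by move=> q; rewrite inrE -(free_1 mf) EE eqxx scale1r.
apply/ler_addgt0Pr => e e0; have e2 : 0 < e / 2 by lra.
have [_ [s _ <-] lt] := dPP t _ e2; set t' := tensor_eval _ _ s in lt *.
have HE : H t' = tensor_eval (l \o inr_tensor U) r s.
  rewrite /t' /tensor_eval (lin_sum (tensor_hom_lin hH)); apply: eq_bigr => -[a b] _.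
  exact: (tensor_hom_tensor hH).
have := minPP _ _ _ emb s; rewrite -HE -/t' => le.
have := unital_star_hom_contractive legs23_unital (t' - t).
rewrite (linB (tensor_hom_lin hH)) (cnormB t') => c.
have := cnormD (t - t') t'; have := cnormD (H t' - H t) (H t).
rewrite !subrK; lra.
Qed.

Local Notation m x := (l (inl_tensor U (mu x))).

Lemma inl_basis_cnorm x t : cnorm (m x * t) = cnorm t.
Proof.
have mi y z : m y * (m y^-1%g * z) = z.
  rewrite mulrA -(star_homM (proj1 lh)) -(star_homM (proj1 (inl_hom U))) -(free_mulE mf).
  by rewrite mulgV (free_1 mf) inl1 inl1 mul1r.
have le y z : cnorm (m y * z) <= cnorm z.
  apply: (le_trans (cnormM _ _)); rewrite -[leRHS]mul1r ler_wpM2r ?cnorm_ge0//.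
  apply: (le_trans (unital_star_hom_contractive lh _)).
  apply: (le_trans (unital_star_hom_contractive (inl_hom U) _)).
  by rewrite (free_cnorm1 mf).
apply/eqP; rewrite eq_le le /=.
by have := le x^-1%g (m x * t); rewrite -{2}[x]invgK mi.
Qed.

(** Composing the embedding of B (x) P with the automorphism given by the
    character yields another C*-norm on the algebraic tensor product, which
    dominates the least one. *)
Lemma twist_norm_le (chi : gT -> R[i]) x y t t' :
  (forall x y, chi (x * y)%g = chi x * chi y) ->
  (forall x, conjc (chi x) * chi x = 1) ->
  cnorm (m x * H t + m y * H t') <= cnorm (chi x *: (m x * H t) + chi y *: (m y * H t')).
Proof.
move=> chiM chiJ.
have cmod1 z : cmod (chi z) = 1.
  have := cmod_sqr (chi z); rewrite mulrC chiJ => /(@complexI R).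
  move/esym/eqP; rewrite sqrf_eq1 => /orP[/eqP//|/eqP c].
  by have := cmod_ge0 (chi z); rewrite c ler0N1.
have Hl := tensor_hom_lin hH.
have [_ dPP _] := min_tensorP PP; have [_ _ minT] := min_tensorP T.
pose chi' z := chi z^-1%g.
have chi'M a b : chi' (a * b)%g = chi' a * chi' b by rewrite /chi' invMg chiM mulrC.
have chi'J a : conjc (chi' a) * chi' a = 1 by exact: chiJ.
have tw := twist_hom chiM chiJ.
have twK z : twist chi' (twist chi z) = z.
  rewrite {2}[z]coef_expand /twist -/(twist chi' _).
  rewrite (lin_sum (twist_linear chi')); apply: eq_bigr => w _.
  rewrite (linZ (twist_linear chi')) twist_tensor scalerA /chi' -chiM mulgV.
  by rewrite (unitary_character1 chiM chiJ) scale1r.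
have emb : tensor_embedding (l \o twist chi) r.
  split=> //.
  - exact: unital_star_hom_comp tw.
  - by move=> a b /=; exact: inl_inrC.
  - move=> s s0 beta br bl.
    have [[_ _ _ inj] _ _] := min_tensorP T.
    have := inj [seq (twist chi p.1, p.2) | p <- s]; rewrite /tensor_eval big_map => /(_ s0).
    move=> /(_ (fun z d => beta (twist chi' z) d)); rewrite big_map.
    under eq_bigr do rewrite twK; apply; first by move=> z; exact: br.
    by move=> d c a b /=; rewrite (twist_linear chi') bl.
pose V c d a b := c *: (m x * H a) + d *: (m y * H b).
have near c d a b a' b' : cmod c = 1 -> cmod d = 1 ->
    cnorm (V c d a b) <= cnorm (V c d a' b') + cnorm (a - a') + cnorm (b - b').
  move=> c1 d1.
  have -> : V c d a b =
      V c d a' b' + c *: (m x * H (a - a')) + d *: (m y * H (b - b')).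
    rewrite /V !(linB Hl) !mulrBr !scalerBr -[RHS]addrA [RHS]addrACA.
    by congr (_ + _); rewrite addrC subrK.
  apply: (le_trans (cnormD _ _)); apply: lerD.
    apply: (le_trans (cnormD _ _)); apply: lerD => //.
    by rewrite cnormZ c1 mul1r inl_basis_cnorm (unital_star_hom_contractive legs23_unital).
  by rewrite cnormZ d1 mul1r inl_basis_cnorm (unital_star_hom_contractive legs23_unital).
have algebraic sa sb : let a := tensor_eval (inl_tensor PP) (inr_tensor PP) sa in
    let b := tensor_eval (inl_tensor PP) (inr_tensor PP) sb in
    cnorm (V 1 1 a b) <= cnorm (V (chi x) (chi y) a b).
  move=> a b.
  pose sT := [seq (tensor U (mu x) p.1, p.2) | p <- sa] ++
             [seq (tensor U (mu y) p.1, p.2) | p <- sb].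
  have HE w sc : m w * H (tensor_eval (inl_tensor PP) (inr_tensor PP) sc) =
      \sum_(p <- sc) l (tensor U (mu w) p.1) * r p.2.
    rewrite /tensor_eval (lin_sum Hl) mulr_sumr; apply: eq_bigr => -[p q] _ /=.
    rewrite -/(tensor PP p q) (tensor_hom_tensor hH) /= mulrA.
    by rewrite -(star_homM (proj1 lh)).
  have E1 : tensor_eval l r sT = V 1 1 a b.
    by rewrite /tensor_eval big_cat !big_map /V !scale1r /a /b !HE.
  have E2 : tensor_eval (l \o twist chi) r sT = V (chi x) (chi y) a b.
    rewrite /tensor_eval big_cat !big_map /V /a /b !HE !scaler_sumr /=.
    by congr (_ + _); apply: eq_bigr => p _; rewrite twist_tensor
      (linZ (star_hom_lin (proj1 lh))) scalerAl.
  by rewrite -E1 -E2; exact: minT.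
have one : cmod (1 : R[i]) = 1 by rewrite /cmod normr1.
rewrite (_ : m x * H t + m y * H t' = V 1 1 t t'); last by rewrite /V !scale1r.
rewrite -/(V (chi x) (chi y) t t'); apply/ler_addgt0Pr => e e0.
have e4 : 0 < e / 4 by lra.
have [_ [sa _ <-] lta] := dPP t _ e4; have [_ [sb _ <-] ltb] := dPP t' _ e4.
have := algebraic sa sb; set a := tensor_eval _ _ sa in lta *.
set b := tensor_eval _ _ sb in ltb * => /= le.
have := near 1 1 t t' a b one one.
have := near _ _ a b t t' (cmod1 x) (cmod1 y).
rewrite (cnormB a) (cnormB b); lra.
Qed.

(** If the sum vanishes, so does its image under the automorphism given by the
    character, in which the two terms get different weights. *)
Lemma character_separates (chi : gT -> R[i]) x y t t' :
  (forall x y, chi (x * y)%g = chi x * chi y) ->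
  (forall x, conjc (chi x) * chi x = 1) -> chi x != chi y ->
  m x * H t + m y * H t' = 0 -> t = 0.
Proof.
move=> chiM chiJ xy E0.
have chi'M a b : chi (a * b)^-1%g = chi a^-1%g * chi b^-1%g by rewrite invMg chiM mulrC.
have Hl := tensor_hom_lin hH.
have chi1 := unitary_character1 chiM chiJ.
have := twist_norm_le x y (chi x *: t) (chi y *: t') chi'M (fun z => chiJ z^-1%g).
rewrite !(linZ Hl) -!scalerAr !scalerA -!chiM !mulVg chi1 !scale1r E0 cnorm0 => le.
have E1 : chi x *: (m x * H t) + chi y *: (m y * H t') = 0.
  by apply: cnorm_eq0; apply/eqP; rewrite eq_le le cnorm_ge0.
have : (chi x - chi y) *: (m x * H t) = 0.
  have -> : m x * H t = - (m y * H t') by apply/eqP; rewrite -addr_eq0 E0.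
  rewrite scalerBl !scalerN opprK; move: E1.
  have -> : m x * H t = - (m y * H t') by apply/eqP; rewrite -addr_eq0 E0.
  by rewrite scalerN.
move=> /(congr1 ( *:%R (chi x - chi y)^-1)).
rewrite scalerA mulVf ?subr_eq0// scale1r scaler0 => m0.
apply: cnorm_eq0; apply/eqP; rewrite eq_le cnorm_ge0 andbT.
by rewrite (le_trans (legs23_cnorm_le t))// -(inl_basis_cnorm x) m0 cnorm0.
Qed.

End TripleTensor.

(** * Universality *)

Section Universality.
Variables (R : realType) (gT : finGroupType) (g h : gT).
Hypothesis gen : <<[set h; g]>>%g = [set: gT]%SET.
Hypotheses (rel_h : (h ^+ 3)%g = 1%g) (rel_gh : (h^-1 * g * h)%g = (g ^+ 4)%g).
Hypothesis g3 : (g ^+ 3)%g != 1%g.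
Variables (a b : gT -> 'Z_3).
Hypotheses (aM : forall x y, a (x * y)%g = a x + a y).
Hypotheses (bM : forall x y, b (x * y)%g = b x + b y).
Hypotheses (ag : a g = 1) (ah : a h = 0) (bg : b g = 0) (bh : b h = 1).
Local Notation S := ([set h; h^-1; g; g^-1]%g : {set gT}).

Variable s : {perm gT}.
Hypotheses (sM : forall x y, s (x * y)%g = (s x * s y)%g).
Hypotheses (ss : forall x, s (s x) = x) (sg : s g = g^-1%g) (sh : s h = h).

Variables (D : cqg R) (X Y : gT -> D) (dbl : doubled_by s X Y).
Variables (B : cstarType R) (mu : gT -> B) (mb : group_basis mu).
Variables (tau : B -> R[i]) (tauP : is_canonical_trace mu tau).
Variable al : Defs.action B D.
Hypothesis alE : forall x,
  al (mu x) = tensor (act_tensor al) (mu x) (X x) + tensor (act_tensor al) (mu (s x)) (Y (s x)).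

Let mf := gbasis_free mb.
Let gB : group_like B. Proof. by exists gT, mu. Qed.
Let gD := dbl_group_like dbl.

Let gVg : g^-1%g != g.
Proof.
apply/eqP => /(congr1 a) E; have : a g^-1%g = - 1.
  apply: (addrI (a g)); rewrite -aM mulgV ag subrr.
  by apply: (addrI (a 1%g)); rewrite -aM mulg1 addr0.
by rewrite E ag => /(congr1 val).
Qed.

Section Target.
Variables (P : cqg R) (be : Defs.action B P).
Hypothesis be_iso : isometric_action S mu tau be.
Local Notation U := (act_tensor be).

(** The representation and the projection that describe the coefficients cut
    the target into the images of the two copies of the group. *)
Lemma isometric_action_hom : exists f : D -> P, unital_star_hom f /\
  forall x, be (mu x) = tensor U (mu x) (f (X x)) + tensor U (mu (s x)) (f (Y (s x))).
Proof.
have [E [El Eb EE]] := coefficient_maps mb tauP be_iso.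
have cm := coefficient_matrixP mb tauP be_iso El Eb EE.
have [W [P1 [[W1 WM Ws] P1s P11 WP uE]]] :=
  coefficient_form gen rel_h rel_gh g3 aM bM ag ah bg bh cm sM sg sh.
have P1c : P1 * (1 - P1) = 0 by rewrite mulrBr mulr1 P11 subrr.
have cP1 : (1 - P1) * P1 = 0 by rewrite mulrBl mul1r P11 subrr.
have cc : (1 - P1) * (1 - P1) = 1 - P1 by rewrite mulrBl mul1r P1c subr0.
have Wc x : W x * (1 - P1) = (1 - P1) * W x by rewrite mulrBr mulrBl mulr1 mul1r WP.
have mulc (p q : P) x y : W y * p = p * W y -> (W x * p) * (W y * q) = W (x * y)%g * (p * q).
  by move=> c; rewrite WM -!mulrA; congr (_ * _); rewrite !mulrA -c.
have [f [fu fX fY]] : exists f : D -> P, [/\ unital_star_hom f,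
    forall x, f (X x) = W x * P1 & forall x, f (Y x) = W (s x) * (1 - P1)].
  apply: (dbl_hom_ex dbl) => [x y|x y|x y|x y|x|x|].
  - by rewrite mulc ?P11.
  - by rewrite mulc ?cc ?sM.
  - by rewrite mulc ?P1c ?mulr0.
  - by rewrite mulc ?cP1 ?mulr0.
  - by rewrite starM Ws P1s WP.
  - by rewrite starM Ws starB star1 P1s (inv_autV sM) Wc.
  - by rewrite (inv_aut1 sM) W1 !mul1r addrC subrK.
exists f; split=> // x.
rewrite (action_expand be_iso El EE).
under eq_bigr do rewrite uE tensorDr.
rewrite big_split /= fX fY ss; congr (_ + _).
  rewrite (bigD1 x)//= eqxx scale1r big1 ?addr0// => y /negPf->.
  by rewrite scale0r tensor0r.
rewrite (bigD1 (s x))//= eqxx scale1r big1 ?addr0// => y /negPf->.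
by rewrite scale0r tensor0r.
Qed.

Section Hom.
Variable f : D -> P.
Hypothesis fu : unital_star_hom f.
Hypothesis beE : forall x,
  be (mu x) = tensor U (mu x) (f (X x)) + tensor U (mu (s x)) (f (Y (s x))).
Let fl := star_hom_lin (proj1 fu).

Lemma hom_intertwines : intertwines al be f.
Proof.
have [F hF] := tensor_hom_ex gB gD (act_tensor al) (proj1 (inl_hom U))
  (star_hom_comp (proj1 (inr_hom U)) (proj1 fu)) (fun x q => inl_inrC U x (f q)).
exists F; split=> //; have Fl := tensor_hom_lin hF.
have all := star_hom_lin (proj1 (act_hom al)).
have bel := star_hom_lin (proj1 (act_hom be)).
apply: (basis_linear_eq mb (F := F \o al) (F' := be)) => //.
  by move=> c x y /=; rewrite all Fl.
by move=> x /=; rewrite alE beE (linD Fl) !(tensor_hom_tensor hF).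
Qed.

(** The coaction law at lambda_x says that the defects of X x and Y (s x) add up
    to zero with weights lambda_x and lambda_(s x). For x = h the weights are
    equal; for x = g they are separated by a character. *)
Lemma hom_cqg_morphism : cqg_morphism f.
Proof.
split=> //.
have [E [El Eb EE]] := coefficient_maps mb tauP be_iso.
pose PP := tensor2 P.
have [lP rP] := (inl_hom PP, inr_hom PP).
have [ff hff] := tensor_hom_ex gD gD (tensor2 D) (star_hom_comp (proj1 lP) (proj1 fu))
  (star_hom_comp (proj1 rP) (proj1 fu)) (fun x y => inl_inrC PP (f x) (f y)).
exists ff; split=> //; have ffl := tensor_hom_lin hff.
have ffu : unital_star_hom ff.
  by apply: (tensor_hom_unital hff) => /=; rewrite (proj2 fu) ?inl1 ?inr1.
have cD : unital_star_hom (@comul R D) := cqg_comul_hom (cqg_str D).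
have cP : unital_star_hom (@comul R P) := cqg_comul_hom (cqg_str P).
have [T [F [G [H [hF hH hG FG]]]]] := act_coassoc be.
have [[Fl Gl] Hl] := (tensor_hom_lin hF, tensor_hom_lin hG, tensor_hom_lin hH).
have lh := proj1 (inl_hom T); have ll := star_hom_lin lh.
pose m x := inl_tensor T (inl_tensor U (mu x)).
have leg x c d : inl_tensor T (tensor U (mu x) c) * inr_tensor T d = m x * H (tensor PP c d).
  by rewrite (tensor_hom_tensor hH) /= mulrA -(star_homM lh).
have coass x : m x * H (ff (comul (X x)) - comul (f (X x))) +
    m (s x) * H (ff (comul (Y (s x))) - comul (f (Y (s x)))) = 0.
  rewrite !(linB Hl) !mulrBr addrACA -opprD; apply/eqP; rewrite subr_eq0; apply/eqP.
  have := FG (mu x); rewrite beE (linD Fl) (linD Gl).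
  rewrite !(tensor_hom_tensor hF) !(tensor_hom_tensor hG) /= => E2.
  rewrite -/(m x) -/(m (s x)) in E2; rewrite -{}E2.
  rewrite !beE !(linD ll) !mulrDl !leg ss.
  rewrite (dbl_comulX dbl) (dbl_comulY dbl) !(linD ffl) !(tensor_hom_tensor hff) /= ss.
  rewrite !(linD Hl) !mulrDr.
  rewrite [X in _ + X]addrC addrACA; congr (_ + _).
  by rewrite addrC.
have Heq t t' : m h * H (t + t') = 0 -> t + t' = 0.
  move=> m0; apply: cnorm_eq0; apply/eqP; rewrite eq_le cnorm_ge0 andbT.
  by rewrite (le_trans (legs23_cnorm_le mb El EE hH _))// -(inl_basis_cnorm mb h) m0 cnorm0.
have [chi [chiM chiJ chig]] := complex_character R aM ag.
have cg := coass g; rewrite sg in cg.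
have X0 := character_separates mb El Eb EE hH chiM chiJ chig cg.
have chig' : chi g^-1%g != chi g by rewrite eq_sym.
rewrite addrC in cg.
have Y0 := character_separates mb El Eb EE hH chiM chiJ chig' cg.
have XY0 := coass h; rewrite sh -mulrDr -(linD Hl) in XY0.
have {}XY0 := Heq _ _ XY0.
have ffc := unital_star_hom_comp ffu cD.
have cf := unital_star_hom_comp cP fu.
apply: (doubled_hom_eq gen dbl ffc cf) => /=.
- by apply/eqP; rewrite -subr_eq0 X0.
- by apply/eqP; rewrite -subr_eq0 Y0.
- apply/eqP; rewrite -subr_eq0 (linD fl) !(linD (star_hom_lin (proj1 cD))).
  rewrite !(linD (star_hom_lin (proj1 cP))) (linD ffl) opprD addrACA.
  by rewrite XY0.
Qed.

End Hom.

Lemma intertwiner_unique (f f' : D -> P) :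
  unital_star_hom f -> unital_star_hom f' ->
  intertwines al be f -> intertwines al be f' -> f =1 f'.
Proof.
move=> fu fu' [F [hF FE]] [F' [hF' FE']].
have [E [El Eb EE]] := coefficient_maps mb tauP be_iso.
have eqE x : tensor U (mu x) (f (X x)) + tensor U (mu (s x)) (f (Y (s x))) =
    tensor U (mu x) (f' (X x)) + tensor U (mu (s x)) (f' (Y (s x))).
  have := FE (mu x); rewrite -FE' !alE (linD (tensor_hom_lin hF)) (linD (tensor_hom_lin hF')).
  by rewrite !(tensor_hom_tensor hF) !(tensor_hom_tensor hF').
have [fl fl'] := (star_hom_lin (proj1 fu), star_hom_lin (proj1 fu')).
apply: (doubled_hom_eq gen dbl fu fu').
- have := congr1 (E g) (eqE g); rewrite sg !(linD (El _)) !EE eqxx eq_sym (negPf gVg).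
  by rewrite !scale1r !scale0r !addr0.
- have := congr1 (E g^-1%g) (eqE g); rewrite sg !(linD (El _)) !EE eqxx (negPf gVg).
  by rewrite !scale1r !scale0r !add0r.
- have := congr1 (E h) (eqE h); rewrite sh !(linD (El _)) !EE eqxx !scale1r.
  by rewrite (linD fl) (linD fl').
Qed.

End Target.

Lemma dual_action_universal (P : cqg R) (be : Defs.action B P) :
  isometric_action S mu tau be ->
  (exists2 f : D -> P, cqg_morphism f & intertwines al be f) /\
  (forall f f' : D -> P, cqg_morphism f -> intertwines al be f ->
     cqg_morphism f' -> intertwines al be f' -> f =1 f').
Proof.
move=> be_iso; split.
  have [f [fu beE]] := isometric_action_hom be_iso.
  by exists f; [exact: hom_cqg_morphism beE | exact: hom_intertwines beE].
move=> f f' [fu _] fi [fu' _] fi'; exact: (intertwiner_unique be_iso fu fu' fi fi').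
Qed.

End Universality.

Section Isomorphism.
Variable R : realType.

Lemma tensor_hom_comp (A B A' B' A'' B'' : cstarType R) (T : min_tensor A B)
    (T' : min_tensor A' B') (T'' : min_tensor A'' B'') (f : A -> A') (k : B -> B')
    (f' : A' -> A'') (k' : B' -> B'') (F : T -> T') (F' : T' -> T'') :
  tensor_hom (inl_tensor T' \o f) (inr_tensor T' \o k) F ->
  tensor_hom (inl_tensor T'' \o f') (inr_tensor T'' \o k') F' ->
  tensor_hom (inl_tensor T'' \o (f' \o f)) (inr_tensor T'' \o (k' \o k)) (F' \o F).
Proof.
move=> [Fs FE] [Fs' FE']; split; first exact: star_hom_comp.
by move=> a b /=; rewrite FE /= -/(tensor T' (f a) (k b)) FE'.
Qed.

Lemma tensor_hom_id (A B : cstarType R) (T : min_tensor A B) :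
  tensor_hom (inl_tensor T \o id) (inr_tensor T \o id) (@id T).
Proof. by split. Qed.

Lemma cqg_morphism_id (Q : cqg R) : cqg_morphism (@id Q).
Proof. by split=> //; exists id; split=> //; exact: tensor_hom_id. Qed.

Lemma cqg_morphism_comp (P Q Q' : cqg R) (f : P -> Q) (f' : Q -> Q') :
  cqg_morphism f -> cqg_morphism f' -> cqg_morphism (f' \o f).
Proof.
move=> [fu [ff [hff fE]]] [fu' [ff' [hff' fE']]]; split.
  exact: unital_star_hom_comp.
exists (ff' \o ff); split; first exact: tensor_hom_comp hff hff'.
by move=> x /=; rewrite fE fE'.
Qed.

Variables (gT : finGroupType) (S : {set gT}) (B : cstarType R) (mu : gT -> B)
  (tau : B -> R[i]).

Lemma intertwines_id (Q : cqg R) (al : Defs.action B Q) : intertwines al al id.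
Proof. by exists id; split=> //; exact: tensor_hom_id. Qed.

Lemma intertwines_comp (P Q Q' : cqg R) (al : Defs.action B P) (be : Defs.action B Q)
    (ga : Defs.action B Q') (f : P -> Q) (f' : Q -> Q') :
  intertwines al be f -> intertwines be ga f' -> intertwines al ga (f' \o f).
Proof.
move=> [F [hF FE]] [F' [hF' FE']]; exists (F' \o F); split.
  exact: (tensor_hom_comp (f := id) (f' := id) hF hF').
by move=> b /=; rewrite FE FE'.
Qed.

Definition universal_action (Q : cqg R) (al : Defs.action B Q) : Prop :=
  forall (P : cqg R) (be : Defs.action B P), isometric_action S mu tau be ->
    (exists2 f : Q -> P, cqg_morphism f & intertwines al be f) /\
    (forall f f' : Q -> P, cqg_morphism f -> intertwines al be f ->
       cqg_morphism f' -> intertwines al be f' -> f =1 f').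

Lemma universal_action_unique (P Q : cqg R) (al : Defs.action B P) (be : Defs.action B Q) :
  isometric_action S mu tau al -> isometric_action S mu tau be ->
  universal_action al -> universal_action be -> cqg_isomorphic P Q.
Proof.
move=> ali bei alu beu.
have [[f fm fi] _] := alu Q be bei; have [[f' fm' fi'] _] := beu P al ali.
have [_ uP] := alu P al ali; have [_ uQ] := beu Q be bei.
exists f, f'; split=> // x.
  apply: (uP (f' \o f) id) => //; [exact: cqg_morphism_comp | exact: intertwines_comp fi fi' |
    exact: cqg_morphism_id | exact: intertwines_id].
apply: (uQ (f \o f') id) => //; [exact: cqg_morphism_comp | exact: intertwines_comp fi' fi |
    exact: cqg_morphism_id | exact: intertwines_id].
Qed.

End Isomorphism.

Local Open Scope group_scope.

Theorem mainTheorem4 (R : realType) (gT : finGroupType) (g h : gT)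
    (gen : <<[set h; g]>> = [set: gT])
    (rel_g : g ^+ 9 = 1) (rel_h : h ^+ 3 = 1) (rel_gh : h^-1 * g * h = g ^+ 4)
    (pres : [set: gT] \isog
              Grp (y : x : x ^+ 9, y ^+ 3, y^-1 * x * y = x ^+ 4)) :
  let S := [set h; h^-1; g; g^-1] in
  exists s : {perm gT},
    [/\ s \in Aut [set: gT], s g = g^-1, s h = h &
    [/\ exists Q : cqg R, is_quantum_isometry_group S Q,
        exists D : cqg R, is_doubled_group_cqg s D
      & forall Q D : cqg R,
          is_quantum_isometry_group S Q -> is_doubled_group_cqg s D ->
          cqg_isomorphic Q D]].
Proof.
move=> S.
have [s [sA sg sh ss]] := exists_involution gen rel_g rel_h rel_gh pres.
have g3 := g3_neq1 gen rel_g rel_h rel_gh pres.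
have [a [b [aM bM [ag ah bg bh]]]] := characters gen rel_g rel_h rel_gh pres.
have sM x y : s (x * y) = s x * s y.
  by case: (Aut_morphic sA) => /morphicP ->.
have sV x : s x^-1 = (s x)^-1 := inv_autV sM x.
have sS x : x \in S -> s x \in S.
  by rewrite !inE -!orbA => /or4P[] /eqP->; rewrite ?sV ?sg ?sh ?invgK eqxx ?orbT.
have universal (D : cqg R) (B : cstarType R) (mu : gT -> B) (tau : B -> R[i]%C) :
    is_doubled_group_cqg s D -> is_reduced_group_cstar mu -> is_canonical_trace mu tau ->
    exists2 al : Defs.action B D, isometric_action S mu tau al & universal_action S mu tau al.
  move=> /(is_doubled_group_cqgP)[X [Y dbl]] /reduced_group_basis mb tauP.
  have [al alE] := dual_action_ex sM ss dbl mb.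
  exists al; first exact: (dual_action_isometric sM ss dbl mb tauP sS alE).
  move=> P be; exact: (dual_action_universal gen rel_h rel_gh g3 aM bM ag ah bg bh
    sM ss sg sh dbl mb tauP alE).
have [D0 D0d] := doubled_group_cqg_ex R sM ss.
exists s; split=> //; split.
- have [B [mu [tau [mr tauP]]]] := reduced_group_ex R gT.
  have [al ali alu] := universal D0 B mu tau D0d mr tauP.
  by exists D0, B, mu, tau, al.
- by exists D0.
- move=> Q D [B [mu [tau [al [mr tauP ali alu]]]]] Dd.
  have [be bei beu] := universal D B mu tau Dd mr tauP.
  exact: (universal_action_unique ali bei alu beu).
Qed.
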